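(* Let $T$ be an exact transformation of $(X,\mathcal F,\mu)$ and let $f\in L_{2,\pi}^{sym}(\mu^2)$ be a real-valued canonical kernel such that the limit $$g:=\lim_{n_1,n_2\to\infty}\ \sum_{0\le i_1\le n_1-1,\;0\le i_2\le n_2-1}V^{*(i_1,i_2)}f$$ exists in $L_{2,\pi}(\mu^2)$. Let $$g^{\emptyset}=(I-V^{(1,0)}V^{*(1,0)})(I-V^{(0,1)}V^{*(0,1)})\,g ,$$ a real-valued symmetric kernel of a trace class integral operator in $L_2(\mu)$, and let $$g^{\emptyset}(x_1,x_2)=\sum_{m=1}^\infty\lambda_m\varphi_m(x_1)\varphi_m(x_2)$$ be its eigenfunction decomposition, where $(\varphi_m)_{m\ge1}$ is an orthonormal sequence of real-valued functions in $L_2(\mu)$ and $(\lambda_m)_{m\ge1}$ is a real sequence of nonzero (not necessarily distinct) numbers with $\sum_m|\lambda_m|<\infty$ (these sequences may be finite, in which case the sums are finite). Then, as $n\to\infty$, the random variables $$\frac1n\sum_{0\le i_1,i_2\le n-1}D_2V^{(i_1,i_2)}f,\qquad n\ge1,$$ converge in distribution to $$\xi:=\sum_{m=1}^\infty\lambda_m\eta_m^2,$$ where $(\eta_m)_{m\ge1}$ is a sequence of independent standard Gaussian variables. Moreover, $$E\Bigl(\frac1n\sum_{0\le i_1,i_2\le n-1}D_2V^{(i_1,i_2)}f\Bigr)\underset{n\to\infty}{\longrightarrow}\sum_{m=1}^\infty\lambda_m.$$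
   Context: $(X,\mathcal F,\mu)$ is a standard (Lebesgue) probability space and $E$ is the expectation with respect to $\mu$. A measure preserving $T$ is exact if $\bigcap_{n\ge1}T^{-n}\mathcal F$ is the trivial $\sigma$-field. $L_{2,\pi}(\mu^2)$ is the projective tensor product of two copies of $L_2(\mu)$ (completion of the algebraic tensor product in the largest cross norm), identified with a subspace of $L_2(\mu^2)=L_2(X^2,\mathcal F^{\otimes2},\mu^2)$ via $f_1\otimes f_2\mapsto f_1(x_1)f_2(x_2)$; its elements are exactly kernels of trace class operators. The superscript $sym$ denotes the subspace of functions with $f(x_1,x_2)=f(x_2,x_1)$. A kernel $f$ is canonical if $\int f(z,x_2)\,\mu(dz)=0$ and $\int f(x_1,z)\,\mu(dz)=0$ for almost all $x_2$, $x_1$. $V^{(i_1,i_2)}f(x_1,x_2)=f(T^{i_1}x_1,T^{i_2}x_2)$ and $V^{*(i_1,i_2)}$ is its adjoint, i.e. $V^{*i_1}\otimes V^{*i_2}$ with $V^*$ the adjoint of $Vf=f\circ T$; both act on $L_{2,\pi}(\mu^2)$. $D_2:L_{2,\pi}(\mu^2)\to L_1(\mu)$ is the norm one linear map determined by $D_2(f_1\otimes f_2)(x)=f_1(x)f_2(x)$. *)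

(* Defs.v *)
From HB Require Import structures.
From mathcomp Require Import all_boot all_order all_algebra finmap.
From mathcomp Require Import all_classical all_reals all_analysis.

Set Implicit Arguments.
Unset Strict Implicit.
Unset Printing Implicit Defensive.

Import Order.TTheory GRing.Theory Num.Theory.
Import numFieldNormedType.Exports.

Local Open Scope classical_set_scope.
Local Open Scope ring_scope.

(* Elements of L_p are represented by real-valued
   functions in [Lfun mu p], and equality in L_p is equality a.e. *)

Section probability_space.
Context d (X : measurableType d) (R : realType) (mu : probability X R).

(* Isomorphism modulo null sets with a Borel probability on R.  The sets h(A)
   are only required to be Borel up to nu-null sets, so that both a standard
   Borel space and its completion (a Lebesgue space in Rokhlin's sense)
   qualify. *)
Definition standard_space : Prop :=
  exists (nu : probability (measurableTypeR R) R)
         (X0 : set X) (Y0 : set R) (h : X -> R),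
    [/\ measurable X0 /\ mu X0 = 1%E,
        measurable Y0 /\ nu Y0 = 1%E,
        set_bij X0 Y0 h,
        forall B : set R, measurable B ->
          measurable (X0 `&` h @^-1` B) /\ mu (X0 `&` h @^-1` B) = nu B &
        forall A : set X, measurable A -> A `<=` X0 ->
          exists2 B : set R, measurable B &
            nu.-negligible ((h @` A) `\` B `|` B `\` (h @` A))].

Definition measure_preserving (T : X -> X) : Prop :=
  measurable_fun setT T /\
  forall A : set X, measurable A -> mu (T @^-1` A) = mu A.

Definition exact_transformation (T : X -> X) : Prop :=
  measure_preserving T /\
  forall A : set X,
    (forall n : nat, (1 <= n)%N ->
       exists2 B : set X, measurable B & A = iter n T @^-1` B) ->
    mu A = 0%E \/ mu A = 1%E.

(* Up to a.e. equality, the only candidate h is the value at f of the adjoint of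
   the bounded operator U of L_2(mu). *)
Definition L2adjoint (U : (X -> R) -> X -> R) (f : X -> R) : X -> R :=
  xget (cst 0) [set h : X -> R | h \in Lfun mu 2%:E /\
    forall phi : X -> R, phi \in Lfun mu 2%:E ->
      \int[mu]_x (U phi x * f x) = \int[mu]_x (phi x * h x)].

Definition cvg_in_distribution d' (Y : measurableType d')
    (P : probability Y R) (S : nat -> X -> R) (xi : Y -> R) : Prop :=
  (forall n, measurable_fun setT (S n)) /\
  forall h : R -> R, continuous h -> (exists M : R, forall t, `|h t| <= M) ->
    (\int[mu]_x (h (S n x))%:E)%E @[n --> \oo] --> (\int[P]_y (h (xi y))%:E)%E.

Definition independent_family (J : pred nat) (eta : nat -> {RV mu >-> R}) :
    Prop :=
  forall (s : {fset nat}) (B : nat -> set R),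
    (forall m, m \in s -> J m) -> (forall m, m \in s -> measurable (B m)) ->
    mu (\bigcap_(m in [set` s]) (eta m @^-1` B m)) =
    (\prod_(m <- s) mu (eta m @^-1` B m))%E.

End probability_space.

(* Index set of a sequence which is finite, of length k, if N = Some k, and
   infinite if N = None. *)
Definition idx (N : option nat) : pred nat :=
  fun m => if N is Some k then (m < k)%N else true.

Section kernels.
Context d (X : measurableType d) (R : realType) (mu : probability X R).
Local Notation mu2 := (mu \x mu)%E.
Implicit Types (a b : X -> R) (f u : X * X -> R).

Definition tens a b : X * X -> R := fun z => a z.1 * b z.2.

(* The algebraic tensor product of L_2(mu) with itself is identified with its
   image in L_2(mu^2). *)
Definition is_tensor_rep n (a b : 'I_n -> X -> R) u : Prop :=
  (forall k, a k \in Lfun mu 2%:E /\ b k \in Lfun mu 2%:E) /\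
  u = (fun z => \sum_(k < n) tens (a k) (b k) z) %[ae mu2].

Definition alg_tensor u : Prop :=
  u \in Lfun mu2 2%:E /\ exists n (a b : 'I_n -> X -> R), is_tensor_rep a b u.

(* The largest cross norm of the algebraic tensor product is the infimum of the
   costs of the representations; the value is +oo when there is none. *)
Definition alg_pi_norm u : \bar R :=
  ereal_inf [set c | exists n (a b : 'I_n -> X -> R), is_tensor_rep a b u /\
    c = (\sum_(k < n) 'N[mu]_2%:E[EFin \o a k] * 'N[mu]_2%:E[EFin \o b k])%E].

(* The Cauchy sequence u for the largest cross norm represents the element f
   of the completion, seen in L_2(mu^2). *)
Definition pi_represents (u : nat -> X * X -> R) f : Prop :=
  [/\ forall n, alg_tensor (u n),
      alg_pi_norm (u p.1 \- u p.2) @[p --> (\oo, \oo)] --> 0%E &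
      'N[mu2]_2%:E[EFin \o (u n \- f)%R]%E @[n --> \oo] --> 0%E].

Definition L2pi f : Prop :=
  f \in Lfun mu2 2%:E /\ exists u : nat -> X * X -> R, pi_represents u f.

(* The canonical map of the completion to L_2(mu^2) is injective, so the limit
   of the norms does not depend on u: the infimum is over a singleton for f in
   L_{2,pi}(mu^2), and is +oo otherwise. *)
Definition pi_norm f : \bar R :=
  ereal_inf [set l | exists u : nat -> X * X -> R, pi_represents u f /\
    alg_pi_norm (u n) @[n --> \oo] --> l].

Definition symmetric_kernel f : Prop := {ae mu2, forall z, f z = f (z.2, z.1)}.

Definition L2pi_sym f : Prop := L2pi f /\ symmetric_kernel f.

Definition canonical_kernel f : Prop :=
  {ae mu, forall y, (\int[mu]_z (f (z, y))%:E = 0)%E} /\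
  {ae mu, forall x, (\int[mu]_z (f (x, z))%:E = 0)%E}.

Definition V (T : X -> X) (i1 i2 : nat) f : X * X -> R :=
  fun z => f (iter i1 T z.1, iter i2 T z.2).

Definition Vstar (T : X -> X) (i1 i2 : nat) : (X * X -> R) -> X * X -> R :=
  L2adjoint mu2 (V T i1 i2).

Definition I_sub_VVstar (T : X -> X) (i1 i2 : nat) f : X * X -> R :=
  f \- V T i1 i2 (Vstar T i1 i2 f).

Definition g_empty (T : X -> X) (g : X * X -> R) : X * X -> R :=
  I_sub_VVstar T 1 0 (I_sub_VVstar T 0 1 g).

(* These properties determine D2 up to a.e. equality.  The norm is exactly one
   because of the value at 1 (x) 1. *)
Record is_D2 (D2 : (X * X -> R) -> X -> R) : Prop := {
  D2_L1 : forall f, L2pi f -> D2 f \in Lfun mu 1%E ;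
  D2_linear : forall (c : R) f1 f2, L2pi f1 -> L2pi f2 ->
    D2 (fun z => c * f1 z + f2 z) =
    (fun x => c * D2 f1 x + D2 f2 x) %[ae mu] ;
  D2_norm : forall f, L2pi f -> ('N[mu]_1[EFin \o D2 f] <= pi_norm f)%E ;
  D2_tens : forall a b, a \in Lfun mu 2%:E -> b \in Lfun mu 2%:E ->
    D2 (tens a b) = (fun x => a x * b x) %[ae mu]
}.

Record eigen_decomposition f (N : option nat) (lambda : nat -> R)
    (phi : nat -> X -> R) : Prop := {
  eigen_L2 : forall m, idx N m -> phi m \in Lfun mu 2%:E ;
  eigen_orthonormal : forall m k, idx N m -> idx N k ->
    \int[mu]_x (phi m x * phi k x) = (m == k)%:R ;
  eigen_neq0 : forall m, idx N m -> lambda m != 0 ;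
  eigen_summable : cvgn (fun n => \sum_(m < n | idx N m) `|lambda m|) ;
  eigen_expansion :
    'N[mu2]_2%:E[EFin \o (f \- (fun z =>
        \sum_(m < n | idx N m) lambda m * tens (phi m) (phi m) z))%R]%E
      @[n --> \oo] --> 0%E
}.

End kernels.

(* Main.v *)
(* Let A1, A2 be the adjoints of the compositions V1, V2 of a kernel with T in its
   first and second variable.  Canonicity and exactness give
   f = (I - A1) (I - A2) g.  On a tensor a (x) b, the sum over i1, i2 < n of
   V^(i1,i2) (I - A1) (I - A2) is a product of two ergodic sums; replacing
   (I - A1) (I - A2) by (I - V1 A1) (I - V2 A2) changes each factor by a coboundary,
   hence the projective norm of the result by O(sqrt n), against the normalization
   1/n.  So f may be replaced by g^0 = sum lambda_m phi_m (x) phi_m, whose diagonal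
   sums are sum lambda_m (n^(-1/2) sum_(i < n) phi_m o T^i)^2, with a tail which is
   uniformly small in L_1.  As A1 g^0 = 0, the phi_m generate reversed martingale
   differences, and these obey a multivariate central limit theorem, proved here
   through E cos(theta s_(k+1)) = (1 - theta^2 sigma^2 / 2) E cos(theta s_k) +
   o(theta^2), in which exactness decouples the conditional variance.  A function of a
   quadratic form is approximated by trigonometric polynomials, so that only cosines
   are needed. *)

From HB Require Import structures.
Require Import Defs.
From mathcomp Require Import all_boot all_order all_algebra finmap.
From mathcomp Require Import all_classical all_reals all_analysis.
From mathcomp Require Import measurable_realfun ring lra.

Set Implicit Arguments.
Unset Strict Implicit.
Unset Printing Implicit Defensive.

Import Order.TTheory GRing.Theory Num.Theory.
Import numFieldNormedType.Exports.

Local Open Scope classical_set_scope.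
Local Open Scope ring_scope.

(** * Square integrable functions *)

(** In general the diagonal of X^2 is a null set, so an estimate in L_2(mu^2) says nothing about
    [D2]: every approximation has to be made in the projective norm. That norm is an infimum over
    representations followed by a completion, and it is handled through upper bounds only. If an
    operator bounded on L_2(mu^2) sends each a (x) b to a tensor of cost at most k |a| |b|, it
    multiplies these bounds by k ([op_piB]); two bounded operators that agree on tensors agree on
    L_{2,pi} ([op_ext]). Two-variable estimates thus reduce to norms of one-variable ergodic sums.
    The eigenfunction expansion, however, is given in L_2(mu^2) only; the summability of [lambda]
    makes its partial sums Cauchy in the projective norm ([piB_expansion_tail]), also after
    summation over the orbit, where each squared norm becomes n and the factor 1/n compensates.
    Adjoints are chosen functions, determined up to null sets, so their identities are obtained by
    testing against all square integrable functions. *)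

Section L2.
Context d (X : measurableType d) (R : realType) (mu : probability X R).
Implicit Types f g h : X -> R.

Definition L1 f := mu.-integrable setT (EFin \o f).
Definition L2 f := f \in Lfun mu 2%:E.
Definition ip f g := \int[mu]_x (f x * g x).
Definition nrm f := Num.sqrt (ip f f).

Lemma L2_meas f : L2 f -> measurable_fun setT f.
Proof. by rewrite /L2 inE => /andP[/[!inE]/=]. Qed.

Lemma L1_meas f : L1 f -> measurable_fun setT f.
Proof. by move=> /(measurable_int mu) /measurable_EFinP. Qed.

Lemma L1_le f g : measurable_fun setT f -> L1 g ->
  (forall x, `|f x| <= g x) -> L1 f.
Proof.
move=> mf ig fg; apply: le_integrable ig => //; first exact/measurable_EFinP.
by move=> x _ /=; rewrite lee_fin (le_trans (fg x))// ler_norm.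
Qed.

Lemma L1_cst c : L1 (fun=> c).
Proof. exact: finite_measure_integrable_cst. Qed.

Lemma L1D f g : L1 f -> L1 g -> L1 (fun x => f x + g x).
Proof. by move=> h1 h2; exact: (integrableD measurableT h1 h2). Qed.

Lemma L1B f g : L1 f -> L1 g -> L1 (fun x => f x - g x).
Proof. by move=> h1 h2; exact: (integrableB measurableT h1 h2). Qed.

Lemma L1Z c f : L1 f -> L1 (fun x => c * f x).
Proof. by move=> h; exact: (integrableZl measurableT c h). Qed.

Lemma L1_abs f : L1 f -> L1 (fun x => `|f x|).
Proof. by move=> h; exact: (integrable_norm h). Qed.

Lemma L1_sum I (s : seq I) (P : pred I) (F : I -> X -> R) :
  (forall i, P i -> L1 (F i)) -> L1 (fun x => \sum_(i <- s | P i) F i x).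
Proof.
move=> h; elim: s => [|a s IH].
  by under eq_fun do rewrite big_nil; exact: L1_cst.
rewrite (_ : (fun x => _) = (fun x => if P a then F a x +
  \sum_(i <- s | P i) F i x else \sum_(i <- s | P i) F i x)); last first.
  by apply/funext => x; rewrite big_cons.
by case: (boolP (P a)) => Pa //; apply: L1D => //; exact: h.
Qed.

Lemma E_sum I (s : seq I) (P : pred I) (F : I -> X -> R) :
  (forall i, P i -> L1 (F i)) ->
  \int[mu]_x (\sum_(i <- s | P i) F i x) = \sum_(i <- s | P i) \int[mu]_x (F i x).
Proof.
move=> h; elim: s => [|a s IH].
  rewrite big_nil; under eq_Rintegral do rewrite big_nil.
  by rewrite Rintegral_cst// mul0r.
under eq_Rintegral do rewrite big_cons.
rewrite big_cons; case: (boolP (P a)) => Pa //.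
by rewrite RintegralD ?IH//; [exact: h|exact: L1_sum].
Qed.

Lemma E_cst c : \int[mu]_x c = c.
Proof.
by rewrite Rintegral_cst// [X in fine X](@probability_setT _ _ _ mu)/= mulr1.
Qed.

Lemma ED f g : L1 f -> L1 g ->
  \int[mu]_x (f x + g x) = \int[mu]_x f x + \int[mu]_x g x.
Proof. by move=> ? ?; rewrite RintegralD. Qed.

Lemma EB f g : L1 f -> L1 g ->
  \int[mu]_x (f x - g x) = \int[mu]_x f x - \int[mu]_x g x.
Proof. by move=> ? ?; rewrite RintegralB. Qed.

Lemma EZ c f : L1 f -> \int[mu]_x (c * f x) = c * \int[mu]_x f x.
Proof. by move=> ?; rewrite RintegralZl. Qed.

Lemma E_le f g : L1 f -> L1 g -> (forall x, f x <= g x) ->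
  \int[mu]_x f x <= \int[mu]_x g x.
Proof. by move=> ? ? ?; apply: le_Rintegral. Qed.

Lemma E_abs f : L1 f -> `|\int[mu]_x f x| <= \int[mu]_x `|f x|.
Proof. by move=> ?; apply: le_normr_Rintegral. Qed.

Lemma E_ge0 f : (forall x, 0 <= f x) -> 0 <= \int[mu]_x f x.
Proof. by move=> ?; apply: Rintegral_ge0. Qed.

Lemma EFin_E f : L1 f -> (\int[mu]_x (f x)%:E)%E = (\int[mu]_x f x)%:E.
Proof. by move=> h; rewrite /Rintegral fineK//; exact: integrable_fin_num. Qed.

Lemma ae_E f g : measurable_fun setT f -> measurable_fun setT g ->
  f = g %[ae mu] -> \int[mu]_x f x = \int[mu]_x g x.
Proof.
move=> mf mg fg; congr fine; apply: ae_eq_integral => //.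
- exact/measurable_EFinP.
- exact/measurable_EFinP.
- by apply: filterS fg => x /= h /h ->.
Qed.

Lemma E_ae0 f : L1 f -> \int[mu]_x `|f x| = 0 -> f = cst 0 %[ae mu].
Proof.
move=> intf f0.
have : (\int[mu]_x `|(EFin \o f) x|)%E = 0%E.
  by rewrite /= (EFin_E (L1_abs intf)) f0.
have mf : measurable_fun setT (EFin \o f) by exact/measurable_EFinP/L1_meas.
move=> /(ae_eq_integral_abs mu measurableT mf).
by apply: filterS => x /= h /h [].
Qed.

Lemma L2P f : L2 f <-> measurable_fun setT f /\ L1 (fun x => f x ^+ 2).
Proof.
split=> [l2f|[mf i2]].
  by split; [exact: L2_meas|exact: Lfun2_integrable_sqr].
rewrite /L2 inE; apply/andP; split; rewrite inE//= /finite_norm unlock/=.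
rewrite poweR_lty// (_ : integral _ _ _ = (\int[mu]_x (f x ^+ 2)%:E)%E).
  exact: integrable_lty.
by apply: eq_integral => x _; rewrite powR_mulrn// real_normK// num_real.
Qed.

Lemma L2_mul f g : L2 f -> L2 g -> L1 (fun x => f x * g x).
Proof. by move=> ? ?; apply/Lfun1_integrable; exact: Lfun2_mul_Lfun1. Qed.

Lemma L2_L1 f : L2 f -> L1 f.
Proof.
move=> hf; apply/Lfun1_integrable; apply: Lfun_subset12 => //.
exact: fin_num_measure.
Qed.

Lemma L2_sqr f : L2 f -> L1 (fun x => f x ^+ 2).
Proof. by move=> /L2P[]. Qed.

Lemma L2_cst c : L2 (fun=> c).
Proof. exact: Lfun_cst. Qed.

Lemma L2D f g : L2 f -> L2 g -> L2 (fun x => f x + g x).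
Proof.
move=> hf hg; apply/L2P; split.
  by apply: measurable_funD; exact: L2_meas.
have -> : (fun x => (f x + g x) ^+ 2) =
  (fun x => (f x ^+ 2 + 2 * (f x * g x)) + g x ^+ 2).
  by apply/funext => x; ring.
apply: L1D; last exact: L2_sqr.
by apply: L1D; [exact: L2_sqr|apply: L1Z; exact: L2_mul].
Qed.

Lemma L2Z c f : L2 f -> L2 (fun x => c * f x).
Proof.
move=> hf; apply/L2P; split; first by apply: measurable_funM => //; exact: L2_meas.
by under eq_fun do rewrite exprMn; apply: L1Z; exact: L2_sqr.
Qed.

Lemma L2B f g : L2 f -> L2 g -> L2 (fun x => f x - g x).
Proof.
move=> hf hg; have := L2D hf (L2Z (-1) hg).
by under eq_fun do rewrite mulN1r.
Qed.

Lemma L2_sum I (s : seq I) (P : pred I) (F : I -> X -> R) :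
  (forall i, P i -> L2 (F i)) -> L2 (fun x => \sum_(i <- s | P i) F i x).
Proof.
move=> h; elim: s => [|a s IH].
  by under eq_fun do rewrite big_nil; exact: L2_cst.
rewrite (_ : (fun x => _) = (fun x => if P a then F a x +
  \sum_(i <- s | P i) F i x else \sum_(i <- s | P i) F i x)); last first.
  by apply/funext => x; rewrite big_cons.
by case: (boolP (P a)) => Pa //; apply: L2D => //; exact: h.
Qed.

Lemma L2_bounded f M : measurable_fun setT f -> (forall x, `|f x| <= M) -> L2 f.
Proof.
move=> mf fM; apply/L2P; split=> //.
apply: (@L1_le _ (fun=> M ^+ 2)); [exact: measurable_funX|exact: L1_cst|].
move=> x; rewrite normrX lerXn2r ?nnegrE//.
by rewrite (le_trans _ (fM x)).
Qed.

Lemma L1_mulb f g M : measurable_fun setT f -> (forall x, `|f x| <= M) ->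
  L1 g -> L1 (fun x => f x * g x).
Proof.
move=> mf fM hg.
apply: (@L1_le _ (fun x => M * `|g x|)).
- by apply: measurable_funM => //; exact: L1_meas.
- by apply: L1Z; exact: L1_abs.
by move=> x; rewrite normrM ler_wpM2r.
Qed.

Lemma ipC f g : ip f g = ip g f.
Proof. by apply: eq_Rintegral => x _; rewrite mulrC. Qed.

Lemma ipDl f g h : L2 f -> L2 g -> L2 h ->
  ip (fun x => f x + g x) h = ip f h + ip g h.
Proof.
move=> hf hg hh; rewrite /ip -ED; [|exact: L2_mul..].
by apply: eq_Rintegral => x _; rewrite mulrDl.
Qed.

Lemma ipBl f g h : L2 f -> L2 g -> L2 h ->
  ip (fun x => f x - g x) h = ip f h - ip g h.
Proof.
move=> hf hg hh; rewrite /ip -EB; [|exact: L2_mul..].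
by apply: eq_Rintegral => x _; rewrite mulrBl.
Qed.

Lemma ipZl c f h : L2 f -> L2 h -> ip (fun x => c * f x) h = c * ip f h.
Proof.
move=> hf hh; rewrite /ip -EZ; [|exact: L2_mul..].
by apply: eq_Rintegral => x _; rewrite mulrA.
Qed.

Lemma ip_suml I (s : seq I) (P : pred I) (F : I -> X -> R) h :
  (forall i, P i -> L2 (F i)) -> L2 h ->
  ip (fun x => \sum_(i <- s | P i) F i x) h = \sum_(i <- s | P i) ip (F i) h.
Proof.
move=> hF hh; rewrite /ip -E_sum; last by move=> i Pi; apply: L2_mul => //; exact: hF.
by apply: eq_Rintegral => x _; rewrite mulr_suml.
Qed.

Lemma ipDr f g h : L2 f -> L2 g -> L2 h ->
  ip h (fun x => f x + g x) = ip h f + ip h g.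
Proof. by move=> *; rewrite ipC ipDl// !(ipC _ h). Qed.

Lemma ipBr f g h : L2 f -> L2 g -> L2 h ->
  ip h (fun x => f x - g x) = ip h f - ip h g.
Proof. by move=> *; rewrite ipC ipBl// !(ipC _ h). Qed.

Lemma ipZr c f h : L2 f -> L2 h -> ip h (fun x => c * f x) = c * ip h f.
Proof. by move=> *; rewrite ipC ipZl// !(ipC _ h). Qed.

Lemma ip_sumr I (s : seq I) (P : pred I) (F : I -> X -> R) h :
  (forall i, P i -> L2 (F i)) -> L2 h ->
  ip h (fun x => \sum_(i <- s | P i) F i x) = \sum_(i <- s | P i) ip h (F i).
Proof.
by move=> hF hh; rewrite ipC ip_suml//; apply: eq_bigr => i _; rewrite ipC.
Qed.

Lemma ip_aer f f' h : L2 f -> L2 f' -> L2 h -> f = f' %[ae mu] ->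
  ip h f = ip h f'.
Proof.
move=> hf hf' hh ff'; apply: ae_E.
- by apply: measurable_funM; exact: L2_meas.
- by apply: measurable_funM; exact: L2_meas.
- by apply: filterS ff' => x /= e /e ->.
Qed.

Lemma ip_ael f f' h : L2 f -> L2 f' -> L2 h -> f = f' %[ae mu] ->
  ip f h = ip f' h.
Proof. by move=> *; rewrite !(ipC _ h); exact: ip_aer. Qed.

Lemma ip_ge0 f : 0 <= ip f f.
Proof. by apply: E_ge0 => x; rewrite -expr2 sqr_ge0. Qed.

Lemma nrm_ge0 f : 0 <= nrm f.
Proof. exact: sqrtr_ge0. Qed.

Lemma nrmK f : nrm f ^+ 2 = ip f f.
Proof. by rewrite sqr_sqrtr// ip_ge0. Qed.

Lemma nrmB_sqr f g : L2 f -> L2 g ->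
  nrm (fun x => f x - g x) ^+ 2 = nrm f ^+ 2 - 2 * ip f g + nrm g ^+ 2.
Proof.
move=> hf hg; rewrite !nrmK ipBl ?ipBr// ?(ipC g f); last exact: L2B.
lra.
Qed.

Lemma nrm_ae f g : L2 f -> L2 g -> f = g %[ae mu] -> nrm f = nrm g.
Proof.
by move=> hf hg fg; rewrite /nrm (ip_ael hf hg hf fg) (ip_aer hf hg hg fg).
Qed.

Lemma nrmZ c f : L2 f -> nrm (fun x => c * f x) = `|c| * nrm f.
Proof.
move=> hf; rewrite /nrm ipZl// ?ipZr//; last exact: L2Z.
by rewrite mulrA -expr2 sqrtrM ?sqr_ge0// sqrtr_sqr.
Qed.

Lemma cauchy_schwarz f g : L2 f -> L2 g -> `|ip f g| <= nrm f * nrm g.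
Proof.
move=> hf hg.
have key (t : R) : 0 <= t ^+ 2 * ip f f + 2 * t * ip f g + ip g g.
  have := ip_ge0 (fun x => t * f x + g x).
  rewrite ipDl ?ipDr ?ipZl ?ipZr ?(ipC g f)//; [|by try exact: L2Z..|].
    by move/le_trans; apply; rewrite le_eqVlt; apply/orP; left; apply/eqP; ring.
  by apply: L2D => //; exact: L2Z.
rewrite -ler_sqr ?nnegrE ?mulr_ge0 ?nrm_ge0// exprMn !nrmK real_normK ?num_real//.
have := ip_ge0 f; rewrite le_eqVlt => /predU1P[f0|f0].
  rewrite -f0 mul0r; move: key; rewrite -f0 => key.
  have [->|fg0] := eqVneq (ip f g) 0; first by rewrite expr0n.
  (* With [ip f f = 0] the form is affine in t; at this t it takes the value -1. *)
  have := key (- (ip g g + 1) / (2 * ip f g)).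
  rewrite mulr0 add0r.
  rewrite (_ : _ * _ + _ = -1); last by field.
  by rewrite ler0N1.
have := key (- ip f g / ip f f).
rewrite (_ : _ + _ = (ip f f * ip g g - ip f g ^+ 2) / ip f f).
  by rewrite pmulr_lge0 ?invr_gt0// subr_ge0.
by field; rewrite gt_eqF.
Qed.

Lemma nrmD f g : L2 f -> L2 g -> nrm (fun x => f x + g x) <= nrm f + nrm g.
Proof.
move=> hf hg; rewrite -ler_sqr ?nnegrE ?addr_ge0 ?nrm_ge0//.
rewrite sqrrD !nrmK ipDl ?ipDr// ?(ipC g f); last exact: L2D.
have := le_trans (ler_norm _) (cauchy_schwarz hf hg); lra.
Qed.

Lemma nrmB f g : L2 f -> L2 g -> nrm (fun x => f x - g x) <= nrm f + nrm g.
Proof.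
move=> hf hg; have := nrmD hf (L2Z (-1) hg).
rewrite (nrmZ _ hg) normrN1 mul1r.
by under eq_fun do rewrite mulN1r.
Qed.

Lemma nrmBC f g : nrm (fun x => f x - g x) = nrm (fun x => g x - f x).
Proof.
by congr Num.sqrt; apply: eq_Rintegral => x _; rewrite -opprB mulrNN.
Qed.

Lemma nrmD3 f g h : L2 f -> L2 g -> L2 h ->
  nrm (fun x => f x - g x) <= nrm (fun x => f x - h x) + nrm (fun x => h x - g x).
Proof.
move=> hf hg hh; have := nrmD (L2B hf hh) (L2B hh hg).
by under eq_fun do rewrite subrKA.
Qed.

Lemma nrm_sum I (s : seq I) (P : pred I) (F : I -> X -> R) :
  (forall i, P i -> L2 (F i)) ->
  nrm (fun x => \sum_(i <- s | P i) F i x) <= \sum_(i <- s | P i) nrm (F i).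
Proof.
move=> h; elim: s => [|a s IH].
  rewrite big_nil; under eq_fun do rewrite big_nil.
  by rewrite /nrm /ip; under eq_Rintegral do rewrite mul0r; rewrite E_cst sqrtr0.
rewrite (_ : (fun x => _) = (fun x => if P a then F a x +
  \sum_(i <- s | P i) F i x else \sum_(i <- s | P i) F i x)); last first.
  by apply/funext => x; rewrite big_cons.
rewrite big_cons; case: (boolP (P a)) => Pa //.
rewrite (le_trans (nrmD _ _)) ?lerD2l//; first exact: h.
exact: L2_sum.
Qed.

Lemma LnormE f : L2 f -> 'N[mu]_2%:E[EFin \o f]%E = (nrm f)%:E.
Proof.
move=> hf; rewrite unlock /Lnorm.
rewrite (_ : integral _ _ _ = (\int[mu]_x (f x * f x)%:E)%E).
  rewrite EFin_E; last exact: L2_mul.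
  by rewrite poweR_EFin powR12_sqrt// ip_ge0.
by apply: eq_integral => x _; rewrite /= powR_mulrn// real_normK// ?num_real// expr2.
Qed.

Lemma nrm0_ae f : L2 f -> nrm f = 0 -> f = cst 0 %[ae mu].
Proof.
move=> hf /eqP; rewrite sqrtr_eq0 => f0.
have {}f0 : ip f f = 0 by apply/le_anti; rewrite f0 ip_ge0.
have : (fun x => f x * f x) = cst 0 %[ae mu].
  apply: E_ae0; first exact: L2_mul.
  rewrite -f0; apply: eq_Rintegral => x _.
  by rewrite ger0_norm// -expr2 sqr_ge0.
by apply: filterS => x /= h /h /eqP; rewrite mulf_eq0 orbb => /eqP.
Qed.

(** Testing with [f - g] itself gives norm zero. Adjoints are specified by their inner products
    only, and this is how identities between them become identities almost everywhere. *)
Lemma weak_ae f g : L2 f -> L2 g -> (forall h, L2 h -> ip h f = ip h g) ->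
  f = g %[ae mu].
Proof.
move=> hf hg fg; have hfg := L2B hf hg.
have : (fun x => f x - g x) = cst 0 %[ae mu].
  apply: nrm0_ae => //; rewrite /nrm ipBr// fg// subrr; exact: sqrtr0.
by apply: filterS => x /= h /h /eqP; rewrite subr_eq0 => /eqP.
Qed.

Lemma ae_nrm0 f g : L2 f -> L2 g -> nrm (fun x => f x - g x) = 0 ->
  f = g %[ae mu].
Proof.
move=> hf hg /(nrm0_ae (L2B hf hg)).
by apply: filterS => x /= h /h /eqP; rewrite subr_eq0 => /eqP.
Qed.

(** Cauchy-Schwarz against the constant 1, whose norm is 1 because [mu] is a probability. *)
Lemma E_nrm f : L2 f -> \int[mu]_x `|f x| <= nrm f.
Proof.
move=> hf; have h1 : L2 (fun=> 1 : R) by exact: L2_cst.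
have habs : L2 (fun x => `|f x|).
  apply/L2P; split; first by apply: measurableT_comp => //; exact: L2_meas.
  under eq_fun do rewrite real_normK ?num_real//.
  exact: L2_sqr.
have := cauchy_schwarz habs h1.
rewrite {1}/ip; under eq_Rintegral do rewrite mulr1.
rewrite ger0_norm; last by apply: E_ge0.
rewrite [X in _ * X](_ : _ = 1); last first.
  by rewrite /nrm /ip; under eq_Rintegral do rewrite mulr1; rewrite E_cst sqrtr1.
rewrite mulr1 => /le_trans; apply.
rewrite le_eqVlt; apply/orP; left; apply/eqP; congr Num.sqrt.
by apply: eq_Rintegral => x _; rewrite -normrM ger0_norm// -expr2 sqr_ge0.
Qed.

End L2.
Arguments L2_cst {d X R} mu c.
Arguments L1_cst {d X R} mu c.

(** The Radon-Nikodym derivative of [nu] and the given density [f] have the same integral over every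
    measurable set, hence agree almost everywhere, and the change of variables formula for the
    former carries over. *)
Lemma integral_density d (X : measurableType d) (R : realType)
    (nu : {finite_measure set X -> \bar R})
    (m : {sigma_finite_measure set X -> \bar R}) (f phi : X -> R) :
  nu `<< m -> m.-integrable setT (EFin \o f) ->
  (forall A, measurable A -> nu A = \int[m]_(x in A) (f x)%:E)%E ->
  measurable_fun setT phi -> (forall x, 0 <= phi x) ->
  (\int[nu]_x (phi x)%:E = \int[m]_x (phi x * f x)%:E)%E.
Proof.
move=> hd intf nuE mphi phi0.
have mf : measurable_fun setT f by exact/measurable_EFinP/(measurable_int m).
rewrite -(Radon_Nikodym_SigmaFinite.change_of_variables hd)//;
  last exact/measurable_EFinP.
apply: ae_eq_integral => //.
- apply: emeasurable_funM; first exact/measurable_EFinP.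
  exact: (measurable_int m (Radon_Nikodym_SigmaFinite.f_integrable hd)).
- by apply/measurable_EFinP; apply: measurable_funM.
apply: (@ae_eqe_mul2l _ _ _ m setT (Radon_Nikodym_SigmaFinite.f nu m)
  (EFin \o f) (EFin \o phi)).
apply: integral_ae_eq => //.
- exact: Radon_Nikodym_SigmaFinite.f_integrable.
- exact/measurable_EFinP.
- by move=> E _ mE; rewrite -Radon_Nikodym_SigmaFinite.f_integral// nuE.
Qed.

(** * Finite measures with a density, and their images *)

Section measures_with_density.
Context d (X : measurableType d) (R : realType) (mu : probability X R).
Variables (f : X -> R) (f0 : forall x, 0 <= f x) (intf : L1 mu f).

(** The dummy [let] makes the definition depend on [f0] and [intf] after the section is closed, so
    that the measure structure declared below is attached to [dens f0 intf]. *)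
Definition dens (A : set X) : \bar R :=
  let _ := (f0, intf) in (\int[mu]_(t in A) (f t)%:E)%E.

Let dens0 : dens set0 = 0%E.
Proof. by rewrite /dens integral_set0. Qed.

Let dens_ge0 A : (0 <= dens A)%E.
Proof. by apply: integral_ge0 => x _; rewrite lee_fin. Qed.

Let dens_sigma_additive : semi_sigma_additive dens.
Proof.
apply: semi_sigma_additive_nng_induced => //.
by apply/measurable_EFinP; exact: L1_meas intf.
Qed.

HB.instance Definition _ := isMeasure.Build _ _ _ dens
  dens0 dens_ge0 dens_sigma_additive.

Let dens_fin : fin_num_fun dens.
Proof.
move=> A mA; apply: integrable_fin_num => //.
exact: (integrableS measurableT).
Qed.

HB.instance Definition _ := Measure_isFinite.Build _ _ _ dens dens_fin.

Lemma dens_dominates : dens `<< mu.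
Proof.
apply/null_content_dominatesP => A mA muA.
apply: null_set_integral => //.
by apply/measurable_EFinP; apply: measurable_funTS; exact: L1_meas intf.
Qed.

Lemma integral_dens (phi : X -> R) : measurable_fun setT phi ->
  (forall x, 0 <= phi x) ->
  (\int[dens]_x (phi x)%:E = \int[mu]_x (phi x * f x)%:E)%E.
Proof.
by move=> mphi phi0; apply: integral_density => //; exact: dens_dominates.
Qed.

Context d' (Y : measurableType d') (F : X -> Y) (mF : measurable_fun setT F).

(** The image of [dens] under its own name and with [mF] as an argument, so that it can carry an
    instance of finite measure. *)
Definition pdens (A : set Y) : \bar R := let _ := mF in pushforward dens F A.

Let pdens0 : pdens set0 = 0%E.
Proof. by rewrite /pdens /pushforward preimage_set0 measure0. Qed.

Let pdens_ge0 A : (0 <= pdens A)%E.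
Proof. exact: measure_ge0. Qed.

Let pre A : measurable A -> measurable (F @^-1` A).
Proof. by move=> mA; rewrite -[X in measurable X]setTI; exact: mF. Qed.

Let pdens_sigma_additive : semi_sigma_additive pdens.
Proof.
move=> G mG tG mUG; rewrite /pdens /pushforward preimage_bigcup.
apply: measure_semi_sigma_additive.
- by move=> n; exact: pre.
- apply/trivIsetP => /= i j _ _ ij; rewrite -preimage_setI.
  by move/trivIsetP : tG => /(_ _ _ _ _ ij) ->//; rewrite preimage_set0.
- by rewrite -preimage_bigcup; exact: pre.
Qed.

HB.instance Definition _ := isMeasure.Build _ _ _ pdens
  pdens0 pdens_ge0 pdens_sigma_additive.

Let pdens_fin : fin_num_fun pdens.
Proof. by move=> A mA; exact: (dens_fin (pre mA)). Qed.

HB.instance Definition _ := Measure_isFinite.Build _ _ _ pdens pdens_fin.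

Lemma integral_pdens (phi : Y -> R) : measurable_fun setT phi ->
  (forall y, 0 <= phi y) ->
  (\int[pdens]_y (phi y)%:E = \int[mu]_x (phi (F x) * f x)%:E)%E.
Proof.
move=> mphi phi0.
transitivity (\int[dens]_x ((phi \o F) x)%:E)%E; last first.
  apply: integral_dens; first exact: (measurableT_comp mphi mF).
  by move=> x; exact: phi0.
apply: (@ge0_integral_pushforward _ _ _ _ _ F mF dens setT (EFin \o phi)) => //.
- exact/measurable_EFinP.
- by move=> y _; rewrite lee_fin.
Qed.

End measures_with_density.

(** * Dominated convergence, truncation and Fatou's lemma *)

Section DCT.
Context d (X : measurableType d) (R : realType) (mu : probability X R).

Lemma DCT (F : nat -> X -> R) (f G : X -> R) :
  (forall n, measurable_fun setT (F n)) -> measurable_fun setT f -> L1 mu G ->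
  (forall n x, `|F n x| <= G x) ->
  {ae mu, forall x, F n x @[n --> \oo] --> f x} ->
  (\int[mu]_x F n x) @[n --> \oo] --> \int[mu]_x f x.
Proof.
move=> mF mf iG FG Ff.
have := @dominated_convergence _ _ _ mu setT measurableT
  (fun n => EFin \o F n) (EFin \o f) (EFin \o G).
case => //.
- by move=> n; exact/measurable_EFinP.
- exact/measurable_EFinP.
- by apply: filterS Ff => x /= h _; apply/cvg_EFin; [exact: nearW|].
- by apply: aeW => x n _ /=; rewrite lee_fin.
move=> intf _ h.
have iF n : L1 mu (F n) by exact: L1_le iG _.
move: h; rewrite (_ : integral _ _ _ = (\int[mu]_x f x)%:E); last exact: EFin_E.
rewrite (_ : [sequence _]_n = EFin \o (fun n => \int[mu]_x F n x)); last first.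
  by apply/funext => n /=; rewrite -EFin_E.
by move/fine_cvgP => [].
Qed.

Lemma E_trunc (f : X -> R) : L1 mu f ->
  (\int[mu]_x (if `|f x| <= n%:R then 0 else `|f x|)) @[n --> \oo] --> (0 : R).
Proof.
move=> intf; rewrite -[X in _ --> X](E_cst mu 0).
apply: (@DCT _ _ (fun x => `|f x|)) => //.
- move=> n; apply: measurable_fun_ifT => //.
  + apply: measurable_fun_ler => //.
    by apply: measurableT_comp => //; exact: L1_meas intf.
  + by apply: measurableT_comp => //; exact: L1_meas intf.
- exact: L1_abs.
- by move=> n x; case: ifPn; rewrite ?normr0// normr_id.
- apply: aeW => x; apply: cvg_near_cst; near=> n.
  rewrite ifT//; apply/ltW.
  rewrite (lt_le_trans (truncnS_gt _))// ler_nat.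
  by near: n; exact: nbhs_infty_ge.
Unshelve. all: by end_near. Qed.

(** Cut to zero rather than clamped: the product of [trunc_fun f M] with [f] is then its own square,
    which [adj_exists] exploits. *)
Definition trunc_fun (f : X -> R) (M : R) x := if `|f x| <= M then f x else 0.

Lemma trunc_fun_meas f M : measurable_fun setT f ->
  measurable_fun setT (trunc_fun f M).
Proof.
move=> mf; apply: measurable_fun_ifT => //.
by apply: measurable_fun_ler => //; exact: measurableT_comp.
Qed.

Lemma trunc_fun_le f M x : 0 <= M -> `|trunc_fun f M x| <= M.
Proof. by rewrite /trunc_fun; case: ifPn => //; rewrite normr0. Qed.

Lemma trunc_fun_cvg f x : trunc_fun f n%:R x @[n --> \oo] --> f x.
Proof.
apply: cvg_near_cst; near=> n; rewrite /trunc_fun ifT//; apply/ltW.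
rewrite (lt_le_trans (truncnS_gt _))// ler_nat.
by near: n; exact: nbhs_infty_ge.
Unshelve. all: by end_near. Qed.

Lemma trunc_nrm f : L2 mu f ->
  nrm mu (fun x => f x - trunc_fun f n%:R x) @[n --> \oo] --> (0 : R).
Proof.
move=> hf; rewrite -[X in _ --> X]sqrtr0.
rewrite /nrm; apply: continuous_cvg; first exact: sqrt_continuous.
rewrite /ip -[X in _ --> X](E_cst mu 0).
have mf := L2_meas hf.
apply: (@DCT _ _ (fun x => f x ^+ 2)) => //.
- by move=> n; apply: measurable_funM; apply: measurable_funB => //;
    exact: trunc_fun_meas.
- exact: L2_sqr.
- move=> n x; rewrite /trunc_fun; case: ifPn => _.
    by rewrite subrr mul0r normr0 sqr_ge0.
  by rewrite subr0 -expr2 ger0_norm// sqr_ge0.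
- apply: aeW => x.
  rewrite [X in _ --> X](_ : 0 = (f x - f x) * (f x - f x) :> R); last by rewrite subrr mul0r.
  by apply: cvgM; (apply: cvgB; [exact: cvg_cst|exact: trunc_fun_cvg]).
Qed.

Lemma L1_bounded (f : X -> R) M : measurable_fun setT f -> (forall x, `|f x| <= M) ->
  L1 mu f.
Proof. by move=> mf fM; apply/L2_L1/L2_bounded; eauto. Qed.

(** Besides the bound, this gives integrability of the limit, which is how square integrability of
    limits is obtained below. The conclusion has an absolute value because [f] is nonnegative only
    almost everywhere. *)
Lemma fatou_L1 (F : nat -> X -> R) (f : X -> R) (C : R) :
  (forall n, L1 mu (F n)) -> (forall n x, 0 <= F n x) ->
  (forall n, \int[mu]_x F n x <= C) -> measurable_fun setT f ->
  {ae mu, forall x, F n x @[n --> \oo] --> f x} ->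
  L1 mu f /\ \int[mu]_x `|f x| <= C.
Proof.
move=> iF F0 FC mf Ff.
have mF n : measurable_fun setT (fun x => (F n x)%:E).
  by apply/measurable_EFinP; exact: L1_meas (iF n).
have fC : (\int[mu]_x `|f x|%:E <= C%:E)%E.
  have -> : (\int[mu]_x `|f x|%:E =
      \int[mu]_x limn_einf (fun n => (F n x)%:E))%E.
    apply: ae_eq_integral => //.
    - by apply/measurable_EFinP; exact: measurableT_comp.
    - rewrite /limn_einf; apply: measurableT_comp => //.
      apply: (@measurable_fun_limn_esup _ _ _ _ (fun n x => (- (F n x)%:E)%E)).
      by move=> n; apply: measurableT_comp.
    - apply: filterS Ff => x Fx _.
      have cF : (F n x)%:E @[n --> \oo] --> (f x)%:E.
        by apply/cvg_EFin; [exact: nearW|].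
      rewrite is_cvg_limn_einfE; last by apply/cvg_ex; eexists; exact: cF.
      rewrite (cvg_lim _ cF)// ger0_norm// -(cvg_lim _ Fx)//.
      apply: limr_ge; first by apply/cvg_ex; eexists; exact: Fx.
      exact: nearW.
  apply: (le_trans (fatou mu measurableT mF _)).
    by move=> n x _; rewrite lee_fin.
  rewrite limn_einf_lim; apply: lime_le; first exact: is_cvg_einfs.
  apply: nearW => n; apply: (@le_trans _ _ (\int[mu]_x (F n x)%:E)%E).
    by apply: ereal_inf_lbound; exists n => //=.
  by rewrite EFin_E// lee_fin.
have intf : L1 mu f.
  apply/integrableP; split; first exact/measurable_EFinP.
  by apply: (le_lt_trans fC); exact: ltry.
by split => //; rewrite -lee_fin -EFin_E//; exact: L1_abs.
Qed.

End DCT.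

(* Locked, so that unification does not unfold the choice in [L2adjoint]. *)
HB.lock Definition adj d (X : measurableType d) (R : realType)
    (mu : probability X R) (S : X -> X) (f : X -> R) : X -> R :=
  L2adjoint mu (fun phi x => phi (S x)) f.

(** * Measure preserving maps and adjoints *)

Section measure_preserving.
Context d (X : measurableType d) (R : realType) (mu : probability X R).
Variables (S : X -> X) (hS : measure_preserving mu S).
Implicit Types f g h phi : X -> R.

Let mS : measurable_fun setT S. Proof. by case: hS. Qed.

Lemma mp_meas f : measurable_fun setT f -> measurable_fun setT (fun x => f (S x)).
Proof. by move=> mf; apply: (measurableT_comp mf mS). Qed.

Lemma mp_ge0_integral (f : X -> \bar R) : measurable_fun setT f ->
  (forall x, 0 <= f x)%E -> (\int[mu]_x f (S x) = \int[mu]_x f x)%E.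
Proof.
move=> mf f0.
rewrite -[LHS](@ge0_integral_pushforward _ _ _ _ _ S mS mu setT f)//.
by apply: eq_measure_integral => A mA _; case: hS => _; exact.
Qed.

Lemma mp_L1 f : L1 mu f -> L1 mu (fun x => f (S x)).
Proof.
move=> /[dup] intf /integrableP[mf foo]; apply/integrableP; split.
  by apply/measurable_EFinP; apply: mp_meas; exact: L1_meas intf.
rewrite (@mp_ge0_integral (fun x => `|(f x)%:E|%E))//.
exact: measurableT_comp.
Qed.

Lemma mp_E f : L1 mu f -> \int[mu]_x f (S x) = \int[mu]_x f x.
Proof.
move=> intf; congr fine.
have mf : measurable_fun setT (EFin \o f) by apply/measurable_EFinP; exact: L1_meas intf.
rewrite -[LHS](@integral_pushforward _ _ _ _ _ S mS mu setT (EFin \o f))//.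
  by apply: eq_measure_integral => A mA _; case: hS => _; exact.
exact: mp_L1.
Qed.

Lemma mp_L2 f : L2 mu f -> L2 mu (fun x => f (S x)).
Proof.
move=> /L2P[mf i2]; apply/L2P; split; first exact: mp_meas.
exact: (mp_L1 i2).
Qed.

Lemma mp_ip f g : L2 mu f -> L2 mu g ->
  ip mu (fun x => f (S x)) (fun x => g (S x)) = ip mu f g.
Proof. by move=> hf hg; apply: (mp_E (L2_mul hf hg)). Qed.

Lemma mp_nrm f : L2 mu f -> nrm mu (fun x => f (S x)) = nrm mu f.
Proof. by move=> hf; rewrite /nrm mp_ip. Qed.

Lemma mp_ae (P : X -> Prop) : {ae mu, forall x, P x} ->
  {ae mu, forall x, P (S x)}.
Proof.
move=> [N [mN N0 PN]]; exists (S @^-1` N); split.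
- by rewrite -[X in measurable X]setTI; exact: mS.
- by case: hS => _ ->.
- by move=> x /= nP; exact: PN.
Qed.

(* The density of A |-> \int_(S^-1 A) f represents phi |-> E[phi o S * f]. *)
Lemma adj_ge0 f : (forall x, 0 <= f x) -> L1 mu f ->
  exists h, L1 mu h /\ forall phi, measurable_fun setT phi ->
    (forall x, 0 <= phi x) ->
    (\int[mu]_x (phi (S x) * f x)%:E = \int[mu]_x (phi x * h x)%:E)%E.
Proof.
move=> f0 intf; pose nu := pdens f0 intf mS.
have dom : nu `<< mu.
  apply/null_content_dominatesP => A mA muA.
  have /null_content_dominatesP := dens_dominates f0 intf; apply.
  - by rewrite -[X in measurable X]setTI; exact: mS.
  - by rewrite -muA; exact: (proj2 hS).
pose h := Radon_Nikodym_SigmaFinite.f nu mu.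
have hE x : (fine (h x))%:E = h x.
  by rewrite fineK//; exact: Radon_Nikodym_SigmaFinite.f_fin_num.
exists (fine \o h); split.
  rewrite /L1 (_ : EFin \o _ = h); last by apply/funext => x /=.
  exact: Radon_Nikodym_SigmaFinite.f_integrable.
move=> phi mphi phi0; rewrite -(integral_pdens f0 intf mS)//.
rewrite -(Radon_Nikodym_SigmaFinite.change_of_variables dom)//.
  by apply: eq_integral => x _ /=; rewrite EFinM hE.
exact/measurable_EFinP.
Qed.

(** [adj_ge0] is applied to the positive and negative parts of [f]. A bounded test function of
    arbitrary sign is made nonnegative by adding [M]; what this adds is the same identity for a
    constant test function. *)
Lemma adj_L1 f : L1 mu f ->
  exists h, L1 mu h /\ forall phi M, measurable_fun setT phi ->
    (forall x, `|phi x| <= M) ->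
    \int[mu]_x (phi (S x) * f x) = \int[mu]_x (phi x * h x).
Proof.
move=> intf.
have mf := L1_meas intf.
have intp : L1 mu f^\+.
  apply: (L1_le _ (L1_abs intf)); first exact: measurable_funrpos.
  move=> x; rewrite ger0_norm ?funrpos_ge0//.
  by rewrite /funrpos ge_max ler_norm normr_ge0.
have intn : L1 mu f^\-.
  apply: (L1_le _ (L1_abs intf)); first exact: measurable_funrneg.
  move=> x; rewrite ger0_norm ?funrneg_ge0//.
  by rewrite /funrneg ge_max normr_ge0 -normrN ler_norm.
have [p [intp' pE]] := adj_ge0 (@funrpos_ge0 _ _ f) intp.
have [q [intq' qE]] := adj_ge0 (@funrneg_ge0 _ _ f) intn.
exists (fun x => p x - q x); split; first exact: L1B.
have fE x : f x = f^\+ x - f^\- x by rewrite -[f in LHS]funrposBneg.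
have key phi M : measurable_fun setT phi -> (forall x, `|phi x| <= M) ->
    (forall x, 0 <= phi x) ->
    \int[mu]_x (phi (S x) * f x) = \int[mu]_x (phi x * (p x - q x)).
  move=> mphi phiM phi0; have mphiS := mp_meas mphi.
  transitivity (\int[mu]_x (phi (S x) * f^\+ x - phi (S x) * f^\- x)).
    by apply: eq_Rintegral => x _; rewrite -mulrBr -fE.
  rewrite EB; [|by apply: L1_mulb mphiS _ _; eauto..].
  rewrite /Rintegral (pE _ mphi phi0) (qE _ mphi phi0).
  rewrite -!/(Rintegral _ _ _) -EB; [|by apply: L1_mulb mphi phiM _..].
  by apply: eq_Rintegral => x _; rewrite mulrBr.
move=> phi M mphi phiM.
have M0 : 0 <= M by rewrite (le_trans _ (phiM point)).
have mphiS := mp_meas mphi.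
have intpq : L1 mu (fun x => p x - q x) by exact: L1B.
transitivity (\int[mu]_x ((phi (S x) + M) * f x) - \int[mu]_x (M * f x)).
  rewrite -EB.
  - by apply: eq_Rintegral => x _; rewrite mulrDl addrK.
  - apply: (@L1_mulb _ _ _ _ _ _ (M + M)) => //; first exact: measurable_funD.
    by move=> x; rewrite (le_trans (ler_normD _ _))// lerD// ger0_norm.
  - exact: L1Z.
transitivity (\int[mu]_x ((phi x + M) * (p x - q x)) -
              \int[mu]_x (M * (p x - q x))); last first.
  rewrite -EB.
  - by apply: eq_Rintegral => x _; rewrite mulrDl addrK.
  - apply: (@L1_mulb _ _ _ _ _ _ (M + M)) => //; first exact: measurable_funD.
    by move=> x; rewrite (le_trans (ler_normD _ _))// lerD// ger0_norm.
  - exact: L1Z.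
congr (_ - _).
- apply: (key (fun x => phi x + M) (M + M)); first exact: measurable_funD.
  + by move=> x; rewrite (le_trans (ler_normD _ _))// lerD// ger0_norm.
  + by move=> x; rewrite -lerBlDr sub0r; move: (phiM x); rewrite ler_norml => /andP[].
- by apply: (key (fun=> M) M) => // x; rewrite ger0_norm.
Qed.

(** Let h be the L_1 adjoint and h_n its truncation. Testing with h_n gives |h_n|^2 = <h_n o S, f>
    <= |h_n| |f|, so |h_n| <= |f|, and Fatou's lemma puts h in L_2. Truncating [phi] then extends
    the identity to all square integrable test functions. *)
Lemma adj_exists f : L2 mu f ->
  exists2 h, L2 mu h & forall phi, L2 mu phi ->
    ip mu (fun x => phi (S x)) f = ip mu phi h.
Proof.
move=> hf; have [h [inth hE]] := adj_L1 (L2_L1 hf).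
have mh := L1_meas inth.
have htr n : L2 mu (trunc_fun h n%:R).
  apply: (@L2_bounded _ _ _ _ _ n%:R); first exact: trunc_fun_meas.
  by move=> x; exact: trunc_fun_le.
have hn n : nrm mu (trunc_fun h n%:R) <= nrm mu f.
  have := cauchy_schwarz (mp_L2 (htr n)) hf.
  rewrite mp_nrm// /ip.
  rewrite (hE _ n%:R) //; [|exact: trunc_fun_meas|by move=> x; exact: trunc_fun_le].
  rewrite (_ : \int[mu]_x _ = nrm mu (trunc_fun h n%:R) ^+ 2); last first.
    rewrite nrmK; apply: eq_Rintegral => x _.
    by rewrite /trunc_fun; case: ifPn => //; rewrite !mul0r.
  rewrite ger0_norm ?sqr_ge0// expr2.
  have := nrm_ge0 mu (trunc_fun h n%:R); rewrite le_eqVlt => /predU1P[<- _|n0].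
    exact: nrm_ge0.
  by rewrite ler_pM2l.
have L2h : L2 mu h.
  apply/L2P; split => //.
  have [] := @fatou_L1 _ _ _ mu (fun n x => trunc_fun h n%:R x ^+ 2)
    (fun x => h x ^+ 2) (nrm mu f ^+ 2) => //.
  - by move=> n; exact: L2_sqr.
  - by move=> n x; exact: sqr_ge0.
  - move=> n; apply: (@le_trans _ _ (nrm mu (trunc_fun h n%:R) ^+ 2)).
      by rewrite nrmK.
    by rewrite lerXn2r ?nnegrE ?nrm_ge0.
  - exact: measurable_funX.
  - apply: aeW => x; rewrite -[X in _ --> X]/((fun t => t ^+ 2) (h x)).
    by apply: continuous_cvg; [exact: exprn_continuous|exact: trunc_fun_cvg].
exists h => // phi hphi.
have mphi := L2_meas hphi.
have phin n : ip mu (fun x => trunc_fun phi n%:R (S x)) f =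
    ip mu (trunc_fun phi n%:R) h.
  rewrite /ip (hE (trunc_fun phi n%:R) n%:R)//; first exact: trunc_fun_meas.
  by move=> x; exact: trunc_fun_le.
have hpn n : L2 mu (trunc_fun phi n%:R).
  apply: (@L2_bounded _ _ _ _ _ n%:R); first exact: trunc_fun_meas.
  by move=> x; exact: trunc_fun_le.
apply/eqP; rewrite -subr_eq0 -normr_eq0; apply/eqP/le_anti; rewrite normr_ge0 andbT.
have cv : nrm mu (fun x => phi x - trunc_fun phi n%:R x) *
    (nrm mu f + nrm mu h) @[n --> \oo] --> (0 : R).
  rewrite -[X in _ --> X](mul0r (nrm mu f + nrm mu h)).
  by apply: cvgM; [exact: trunc_nrm|exact: cvg_cst].
rewrite -[leRHS](cvg_lim _ cv)//; apply: limr_ge; first by apply/cvg_ex; eexists; exact: cv.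
apply: nearW => n.
have -> : ip mu (fun x => phi (S x)) f - ip mu phi h =
  ip mu (fun x => phi (S x) - trunc_fun phi n%:R (S x)) f -
  ip mu (fun x => phi x - trunc_fun phi n%:R x) h.
  rewrite !ipBl//; [|exact: mp_L2..].
  by rewrite phin; lra.
rewrite (le_trans (ler_normB _ _))// mulrDr lerD//.
- rewrite -(@mp_nrm (fun x => phi x - trunc_fun phi n%:R x)); last exact: L2B.
  by apply: cauchy_schwarz => //; exact: (mp_L2 (L2B _ _)).
- by apply: cauchy_schwarz => //; exact: L2B.
Qed.


Local Notation adj := (adj mu S).

Lemma adjP f : L2 mu f -> L2 mu (adj f) /\
  forall phi, L2 mu phi -> ip mu (fun x => phi (S x)) f = ip mu phi (adj f).
Proof.
move=> hf; rewrite adj.unlock /L2adjoint; case: xgetP => [h _ [hh hE]|no].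
  by split.
have [h hh hE] := adj_exists hf.
by exfalso; exact: (no h).
Qed.

Lemma adj_L2 f : L2 mu f -> L2 mu (adj f).
Proof. by move=> /adjP[]. Qed.

Lemma ip_adj f phi : L2 mu f -> L2 mu phi ->
  ip mu phi (adj f) = ip mu (fun x => phi (S x)) f.
Proof. by move=> /adjP[_ h] hphi; rewrite h. Qed.

(** With A the adjoint, |A f|^2 = <A f o S, f> <= |A f| |f|, since composition with [S] preserves
    norms; the case |A f| = 0 is apart because |A f| is cancelled. *)
Lemma adj_nrm f : L2 mu f -> nrm mu (adj f) <= nrm mu f.
Proof.
move=> hf; have ha := adj_L2 hf.
have := cauchy_schwarz (mp_L2 ha) hf.
rewrite -ip_adj// mp_nrm// -nrmK ger0_norm ?sqr_ge0// expr2.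
have := nrm_ge0 mu (adj f); rewrite le_eqVlt => /predU1P[<- _|n0].
  exact: nrm_ge0.
by rewrite ler_pM2l.
Qed.

Lemma adj_uniq f h : L2 mu f -> L2 mu h ->
  (forall phi, L2 mu phi -> ip mu (fun x => phi (S x)) f = ip mu phi h) ->
  adj f = h %[ae mu].
Proof.
move=> hf hh hE; apply: weak_ae => //; first exact: adj_L2.
by move=> phi hphi; rewrite ip_adj// hE.
Qed.

Lemma adj_lin c f g : L2 mu f -> L2 mu g ->
  adj (fun x => c * f x + g x) = (fun x => c * adj f x + adj g x) %[ae mu].
Proof.
move=> hf hg; have haf := adj_L2 hf; have hag := adj_L2 hg.
apply: adj_uniq.
- by apply: L2D => //; exact: L2Z.
- by apply: L2D => //; exact: L2Z.
move=> phi hphi; have hp := mp_L2 hphi.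
rewrite !ipDr ?ipZr ?ip_adj//; exact: L2Z.
Qed.

Lemma adjK f : L2 mu f -> adj (fun x => f (S x)) = f %[ae mu].
Proof.
move=> hf; apply: adj_uniq => //; first exact: mp_L2.
by move=> phi hphi; exact: mp_ip.
Qed.

Lemma adj_ae f g : L2 mu f -> L2 mu g -> f = g %[ae mu] -> adj f = adj g %[ae mu].
Proof.
move=> hf hg fg; apply: adj_uniq => //; first exact: adj_L2.
move=> phi hphi; rewrite ip_adj//; apply: ip_aer => //; exact: mp_L2.
Qed.

End measure_preserving.

Lemma mp_iter d (X : measurableType d) (R : realType) (mu : probability X R)
  (S : X -> X) n : measure_preserving mu S -> measure_preserving mu (iter n S).
Proof.
move=> [mS hS]; elim: n => [|n [mI hI]]; first by split => //; exact: measurable_id.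
split; first exact: (measurableT_comp mS mI).
move=> A mA; rewrite -[RHS]hS//; apply: hI.
by rewrite -[X in measurable X]setTI; exact: mS.
Qed.

Lemma le_expr_half (R : realType) (x : R) : (forall k, x <= (2^-1) ^+ k) -> x <= 0.
Proof.
move=> h; have c := @cvg_geometric R 1 (2^-1) _.
have {c} /c c : `|2^-1 : R| < 1 by rewrite ger0_norm; lra.
rewrite -(cvg_lim _ c)//; apply: limr_ge; first by apply/cvg_ex; eexists; exact: c.
by apply: nearW => k; rewrite /geometric/= mul1r.
Qed.

(** * Exactness *)

Section ae_cvg.
Context d (X : measurableType d) (R : realType) (mu : probability X R).

(** The increments have summable L_1 norms, so the sum of their absolute values is integrable, hence
    finite almost everywhere; where it is finite, the telescoping series converges absolutely. *)
Lemma ae_cvg_fast (q : nat -> X -> R) : (forall k, L1 mu (q k)) ->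
  (forall k, \int[mu]_x `|q k.+1 x - q k x| <= 2^-1 ^+ k) ->
  {ae mu, forall x, cvgn (fun k => q k x)}.
Proof.
move=> iq qE.
pose D k x := (`|q k.+1 x - q k x|)%:E.
have mD k : measurable_fun setT (D k).
  apply/measurable_EFinP; apply: measurableT_comp => //.
  by apply: measurable_funB; exact: L1_meas.
have D0 k x : setT x -> (0 <= D k x)%E by rewrite lee_fin.
have lty : (\int[mu]_x (\sum_(k <oo) D k x) <= 2%:E)%E.
  rewrite integral_nneseries//.
  apply: lime_le; first by apply: is_cvg_nneseries => n _ _; apply: integral_ge0 => x; exact: D0.
  apply: nearW => n; apply: (@le_trans _ _ (\sum_(0 <= k < n) (2^-1 ^+ k : R)%:E)%E).
    apply: lee_sum => k _; rewrite /D EFin_E ?lee_fin ?qE//.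
    by apply: L1_abs; exact: L1B.
  rewrite sumEFin lee_fin.
  have := @geometric_seriesE R 1 2^-1 _.
  move=> /(_ _)/(congr1 (fun F => F n)); rewrite /series/=.
  under eq_bigr do rewrite /geometric/= mul1r.
  rewrite mul1r => ->; last by rewrite neq_lt; apply/orP; left; lra.
  have : 0 <= (2^-1 : R) ^+ n by rewrite exprn_ge0// invr_ge0.
  rewrite (_ : 1 - 2^-1 = 2^-1 :> R); last by field.
  by rewrite invrK; lra.
have intS : mu.-integrable setT (fun x => \sum_(k <oo) D k x)%E.
  apply/integrableP; split; first by apply: ge0_emeasurable_sum => // k x xT _; exact: D0.
  rewrite (eq_integral (fun x => \sum_(k <oo) D k x)%E); last first.
    by move=> x _; rewrite gee0_abs//; apply: nneseries_ge0 => k _ _; exact: D0.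
  by apply: (le_lt_trans lty); rewrite ltry.
have := integrable_ae measurableT intS.
apply: filterS => x /(_ I) xfin.
have : cvgn [normed series (telescope (fun k => q k x))].
  apply: nondecreasing_is_cvgn.
    apply/nondecreasing_seqP => n /=.
    by rewrite /series/= big_nat_recr//= lerDl.
  exists (fine (\sum_(k <oo) D k x)%E) => _ [n _ <-].
  rewrite -lee_fin fineK//= /series/= -sumEFin.
  apply: nneseries_lim_ge => k _ _; exact: D0.
move=> /normed_cvg; rewrite telescopeK => /cvg_ex[l hl].
apply/cvg_ex; exists (l + q 0%N x).
rewrite (_ : (fun k => q k x) = (fun k => (q k x - q 0%N x) + q 0%N x)).
  by apply: cvgD => //; exact: cvg_cst.
by apply/funext => k; rewrite subrK.
Qed.

End ae_cvg.

(** An upper limit only sees the tail. In [exact_adj0] this turns the limit into a function of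
    [iter n T x] for every n. *)
Lemma limn_esup_near (R : realType) (u v : (\bar R)^nat) :
  (\forall n \near \oo, u n = v n) -> limn_esup u = limn_esup v.
Proof.
move=> [N _ uv]; rewrite !limn_esup_lim.
have uve : {near \oo, esups u =1 esups v}.
  exists N => // n /= Nn; rewrite /esups /=; congr ereal_sup.
  by rewrite eqEsubset; split => _ [m /= nm <-]; exists m => //;
    rewrite uv//= (leq_trans Nn).
apply/esym/cvg_lim => //.
apply: cvg_trans; last exact: (is_cvg_esups (u := u)).
exact: near_eq_cvg.
Qed.

Section exactness.
Context d (X : measurableType d) (R : realType) (mu : probability X R).
Variables (T : X -> X) (hT : exact_transformation mu T).

Let mpT : measure_preserving mu T. Proof. by case: hT. Qed.
Let mpTn n : measure_preserving mu (iter n T). Proof. exact: mp_iter. Qed.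
Local Notation A n a := (adj mu (iter n T) a).
Local Notation P n a := (fun x => A n a (iter n T x)).

Let AL2 n a : L2 mu a -> L2 mu (A n a).
Proof. by move=> ha; exact: (adj_L2 (mpTn n) ha). Qed.

Let PL2 n a : L2 mu a -> L2 mu (P n a).
Proof. by move=> ha; exact: (mp_L2 (mpTn n) (AL2 n ha)). Qed.

(** [P n] is the conditional expectation given T^-n F. These sigma-fields decrease, so for n <= m
    the projection [P m] absorbs [P n], and composition with T^m preserves norms. *)
Lemma ip_proj n m a : L2 mu a -> (n <= m)%N ->
  ip mu (P n a) (P m a) = nrm mu (A m a) ^+ 2.
Proof.
move=> ha nm; rewrite nrmK.
have e x : iter m T x = iter (m - n) T (iter n T x) by rewrite -iterD subnK.
have hmn := mp_L2 (mpTn (m - n)) (AL2 m ha).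
rewrite ipC; under [X in ip _ X _]funext do rewrite e.
rewrite (mp_ip (mpTn n) hmn (AL2 n ha)).
rewrite (ip_adj (mpTn n) ha hmn).
under [X in ip _ X _]funext do rewrite -e.
by rewrite -(ip_adj (mpTn m) ha)//; exact: AL2.
Qed.

(** Pythagoras for nested projections. In particular the norms decrease, and a small decrease of the
    norm forces a small increment. *)
Lemma nrm_projB n m a : L2 mu a -> (n <= m)%N ->
  nrm mu (fun x => P m a x - P n a x) ^+ 2 =
  nrm mu (A n a) ^+ 2 - nrm mu (A m a) ^+ 2.
Proof.
move=> ha nm; have hm := PL2 m ha; have hn := PL2 n ha.
have e k : nrm mu (P k a) = nrm mu (A k a) by exact: (mp_nrm (mpTn k) (AL2 k ha)).
rewrite nrmBC (nrmB_sqr hn hm) (ip_proj ha nm) !e; lra.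
Qed.

Let a_dec a : L2 mu a -> nonincreasing_seq (fun n => nrm mu (A n a) ^+ 2).
Proof.
move=> ha n m nm; rewrite -subr_ge0 -nrm_projB//; exact: sqr_ge0.
Qed.

(* P n a = (V*^n a) o T^n is a reversed martingale; a subsequence converges a.e., and
   its limit is measurable for the tail sigma-field, hence constant. *)
Lemma exact_adj0 a : L2 mu a -> \int[mu]_x a x = 0 ->
  nrm mu (A n a) @[n --> \oo] --> (0 : R).
Proof.
move=> ha Ea.
pose b n := nrm mu (A n a) ^+ 2.
have blb : has_lbound (range b) by exists 0 => _ [n _ <-]; exact: sqr_ge0.
have cb := nonincreasing_cvgn (a_dec ha) blb.
set l := inf _ in cb.
have bl n : l <= b n by apply: ge_inf => //; exists n.
(* Squared increments of at most 4^-k give increments of at most 2^-k, as [ae_cvg_fast] requires.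
   The partial sums of [N i + i] make [s] monotone with [k <= s k]. *)
have [s [sge sE]] : exists s : nat -> nat, (forall k, (k <= s k)%N /\ (s k <= s k.+1)%N) /\
    forall k, b (s k) - l <= (4^-1) ^+ k.
  have h k : exists N, forall n, (N <= n)%N -> b n - l <= (4^-1) ^+ k.
    have /cvgrPdist_le/(_ ((4^-1) ^+ k)) := cb.
    case; first by rewrite exprn_gt0// invr_gt0.
    move=> N _ hN; exists N => n Nn; have := hN n Nn.
    by rewrite distrC ger0_norm ?subr_ge0 ?bl//.
  have /choice[N hN] := h.
  exists (fun k => \sum_(i < k.+1) (N i + i))%N; split => k; last first.
    by apply: hN; rewrite big_ord_recr/= addnCA leq_addr.
  by split; [rewrite big_ord_recr/= addnA leq_addl|rewrite [leqRHS]big_ord_recr/= leq_addr].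
pose q k := P (s k) a.
have hq k : L2 mu (q k) by exact: PL2.
have qB k : nrm mu (fun x => q k.+1 x - q k x) <= (2^-1) ^+ k.
  rewrite -ler_sqr ?nnegrE ?nrm_ge0 ?exprn_ge0 ?invr_ge0//.
  rewrite nrm_projB//; last by case: (sge k).
  rewrite -exprM mulnC exprM (_ : (2^-1) ^+ 2 = 4^-1 :> R); last by field.
  by apply: le_trans (sE k); rewrite lerD2l lerN2; exact: bl.
have cvq : {ae mu, forall x, cvgn (fun k => q k x)}.
  apply: ae_cvg_fast => k; first exact: L2_L1.
  by apply: le_trans (qB k); apply: E_nrm; exact: L2B.
(* The upper limit is defined and measurable everywhere, and equals the limit almost everywhere. *)
pose p x : \bar R := limn_esup (fun k => (q k x)%:E).
have mp : measurable_fun setT p.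
  apply: measurable_fun_limn_esup => k.
  by apply/measurable_EFinP; exact: L2_meas.
have pE : {ae mu, forall x, q k x @[k --> \oo] --> fine (p x)}.
  apply: filterS cvq => x cx.
  have cE : (q k x)%:E @[k --> \oo] --> (limn (fun k => q k x))%:E.
    by apply/cvg_EFin => //; exact: nearW.
  rewrite /p is_cvg_limn_esupE; last by apply/cvg_ex; eexists; exact: cE.
  by rewrite (cvg_lim _ cE).
pose r x := fine (p x).
have mr : measurable_fun setT r by exact: measurableT_comp.
have qr k : L1 mu (fun x => (r x - q k x) ^+ 2) /\
    \int[mu]_x `|(r x - q k x) ^+ 2| <= (2^-1 ^+ k) ^+ 2.
  apply: (@fatou_L1 _ _ _ mu (fun j x => (q (k + j)%N x - q k x) ^+ 2)).
  - by move=> j; apply: L2_sqr; exact: L2B.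
  - by move=> j x; exact: sqr_ge0.
  - move=> j; rewrite (_ : Rintegral _ _ _ =
        nrm mu (fun x => q (k + j)%N x - q k x) ^+ 2); last first.
      by rewrite nrmK /ip; apply: eq_Rintegral => x _; rewrite expr2.
    have ss i : (s k <= s (k + i))%N.
      elim: i => [|i IH]; first by rewrite addn0.
      by rewrite addnS (leq_trans IH)//; case: (sge (k + i)%N).
    rewrite nrm_projB//.
    rewrite -exprM mulnC exprM (_ : (2^-1) ^+ 2 = 4^-1 :> R); last by field.
    by apply: le_trans (sE k); rewrite lerD2l lerN2; exact: bl.
  - apply: measurable_funX; apply: measurable_funB => //.
    exact: L2_meas.
  - apply: filterS pE => x hx.
    rewrite -[X in _ --> X]/((fun t => t ^+ 2) (r x - q k x)).
    apply: continuous_cvg; first exact: exprn_continuous.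
    apply: cvgB; last exact: cvg_cst.
    by apply: (cvg_comp _ (fun j => q j x) (@cvg_addnl k)).
have hr : L2 mu r.
  have -> : r = (fun x => (r x - q 0%N x) + q 0%N x).
    by apply/funext => x; rewrite subrK.
  apply: L2D => //; apply/L2P; split; last by case: (qr 0%N).
  by apply: measurable_funB => //; exact: L2_meas.
have hrq k : L2 mu (fun x => r x - q k x) by exact: L2B.
have nrq k : nrm mu (fun x => r x - q k x) <= 2^-1 ^+ k.
  rewrite -ler_sqr ?nnegrE ?nrm_ge0 ?exprn_ge0 ?invr_ge0//.
  apply: le_trans (proj2 (qr k)); rewrite nrmK /ip le_eqVlt; apply/orP; left.
  by apply/eqP/eq_Rintegral => x _; rewrite ger0_norm ?sqr_ge0// expr2.
have h1 : L2 mu (fun=> 1) by exact: L2_cst.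
have Eq k : \int[mu]_x q k x = 0.
  rewrite (mp_E (mpTn (s k)) (L2_L1 (AL2 (s k) ha))).
  transitivity (ip mu (fun=> 1) (A (s k) a)).
    by apply: eq_Rintegral => x _; rewrite mul1r.
  rewrite (ip_adj (mpTn (s k)) ha h1) -Ea.
  by apply: eq_Rintegral => x _; rewrite mul1r.
have Er : \int[mu]_x r x = 0.
  apply/eqP; rewrite -normr_eq0; apply/eqP/le_anti; rewrite normr_ge0 andbT.
  apply: le_expr_half => k; rewrite -[X in `|X|]subr0 -(Eq k) -EB//; [|exact: L2_L1..].
  apply: le_trans (nrq k); apply: le_trans (E_nrm (hrq k)).
  by apply: E_abs; exact: L2_L1.
have r0 : r = cst 0 %[ae mu].
  have mneg : measurable [set x | (p x < 0)%E].
    by rewrite -[X in measurable X]setTI; exact: emeasurable_fun_infty_o.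
  apply: E_ae0; first exact: L2_L1.
  (* For k >= n the term [q k] is a function of [iter n T x], because [n <= s k]; so is the upper
     limit. *)
  have tail n : (1 <= n)%N -> exists2 B : set X, measurable B &
      [set x | (p x < 0)%E] = iter n T @^-1` B.
    move=> n1.
    pose Q y := limn_esup (fun k => (A (s k) a (iter (s k - n) T y))%:E).
    have mQ : measurable_fun setT Q.
      apply: measurable_fun_limn_esup => k; apply/measurable_EFinP.
      exact: (mp_meas (mpTn (s k - n)) (L2_meas (AL2 (s k) ha))).
    exists [set y | (Q y < 0)%E].
      by rewrite -[X in measurable X]setTI; exact: emeasurable_fun_infty_o.
    apply/seteqP; split => x /=; rewrite (_ : Q (iter n T x) = p x) //;
      (apply: limn_esup_near; exists n => // k /= nk; rewrite /q -iterD subnK//;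
       by rewrite (leq_trans nk)//; case: (sge k)).
  (* By exactness [r] has constant sign almost everywhere. Its mean is zero, so in either case the
     integral of its absolute value vanishes. *)
  have [neg0|neg1] := (proj2 hT) _ tail.
  - transitivity (\int[mu]_x r x); last exact: Er.
    apply: ae_E => //; first exact: measurableT_comp.
    exists [set x | (p x < 0)%E]; split => // x /=.
    apply: contra_notP => /negP; rewrite -leNgt => px _.
    by rewrite ger0_norm// fine_ge0.
  - transitivity (- \int[mu]_x r x); last by rewrite Er oppr0.
    rewrite -mulN1r -EZ; last exact: L2_L1.
    apply: ae_E; [exact: measurableT_comp|exact: measurable_funM|].
    exists (~` [set x | (p x < 0)%E]); split => //.
    + exact: measurableC.
    + by rewrite probability_setC// neg1 subee.
    + move=> x /=; apply: contra_not => px _.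
      by rewrite mulN1r ler0_norm// fine_le0// ltW.
(* [q k] has the norm of [A (s k) a] and lies within 2^-k of [r], which is zero. *)
have l0 : l = 0.
  apply/le_anti/andP; split; last by apply: lb_le_inf => //; [exists (b 0%N), 0%N|move=> _ [n _ <-]; exact: sqr_ge0].
  apply: le_expr_half => k.
  apply: (le_trans (bl (s k))); rewrite /b -(mp_nrm (mpTn (s k)) (AL2 (s k) ha)).
  rewrite (@nrm_ae _ _ _ _ _ (fun x => q k x - r x))//; last 2 first.
  - exact: L2B.
  - by apply: filterS r0 => x /= h /h ->; rewrite subr0.
  rewrite nrmBC expr2 (@le_trans _ _ (2^-1 ^+ k * 1))//; last by rewrite mulr1.
  rewrite ler_pM ?nrm_ge0 ?nrq//.
  apply: (le_trans (nrq k)); rewrite exprn_ile1//; lra.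
  exact: (hq k).
have cb0 : b @ \oo --> (0 : R) by rewrite -l0.
rewrite -[X in _ --> X]sqrtr0 (_ : (fun n => _) = (fun n => Num.sqrt (b n))).
  by apply: continuous_cvg => //; exact: sqrt_continuous.
by apply/funext => n; rewrite /b sqrtr_sqr ger0_norm// nrm_ge0.
Qed.

(** The point is that n does not depend on [psi]. Once [Y] is truncated and centred, composition
    with T^n is moved to it as an adjoint, whose norm [exact_adj0] makes small; [psi] enters only
    through its bound 1. *)
Lemma exact_mixing (Y : X -> R) (e : R) : L1 mu Y -> \int[mu]_x Y x = 0 -> 0 < e ->
  exists n : nat, forall psi : X -> R, measurable_fun setT psi ->
    (forall x, `|psi x| <= 1) -> `|\int[mu]_x (Y x * psi (iter n T x))| <= e.
Proof.
move=> hY EY e0; have mY := L1_meas hY.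
have e4 : 0 < e / 4 by lra.
have /cvgrPdist_le/(_ _ e4)[N _ hN] := E_trunc hY.
have {hN} := hN N (leqnn N).
set Z := trunc_fun Y N%:R.
rewrite sub0r normrN => hN.
have hZ : L2 mu Z.
  apply: (@L2_bounded _ _ _ _ _ N%:R); first exact: trunc_fun_meas.
  by move=> x; exact: trunc_fun_le.
have hYZ : \int[mu]_x `|Y x - Z x| <= e / 4.
  apply: le_trans hN; apply: le_trans (ler_norm _); rewrite le_eqVlt.
  apply/orP; left; apply/eqP/eq_Rintegral => x _; rewrite /Z /trunc_fun.
  by case: ifPn; rewrite ?subrr ?normr0// subr0.
pose c := \int[mu]_x Z x.
have hc : `|c| <= e / 4.
  apply: le_trans hYZ; rewrite -normrN -[X in `|X|]add0r -EY /c -EB//; last exact: L2_L1.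
  by apply: E_abs; apply: L1B => //; exact: L2_L1.
have hW : L2 mu (fun x => Z x - c) by apply: L2B => //; exact: L2_cst.
have EW : \int[mu]_x (Z x - c) = 0.
  by rewrite EB ?E_cst ?subrr//; [exact: L2_L1|exact: L1_cst].
have /cvgrPdist_le/(_ _ e4)[n _ hn] := exact_adj0 hW EW.
have {hn} := hn n (leqnn n); rewrite sub0r normrN ger0_norm ?nrm_ge0// => hn.
exists n => psi mpsi psi1.
have hpsi : L2 mu psi by exact: L2_bounded psi1.
have hpsin := mp_L2 (mpTn n) hpsi.
have mpsin := L2_meas hpsin.
have n1 : nrm mu psi <= 1.
  rewrite -sqrtr1; apply: ler_wsqrtr; rewrite -[leRHS](E_cst mu).
  apply: E_le; [exact: L2_mul|exact: L1_cst|move=> x].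
  by rewrite -expr2 -real_normK ?num_real// expr_le1.
have b1 (U : X -> R) : L1 mu U -> L1 mu (fun x => U x * psi (iter n T x)).
  move=> hU; under eq_fun do rewrite mulrC.
  exact: (@L1_mulb _ _ _ _ _ _ 1).
have -> : \int[mu]_x (Y x * psi (iter n T x)) =
  \int[mu]_x ((Y x - Z x) * psi (iter n T x)) + (c * \int[mu]_x psi (iter n T x) +
   ip mu (fun x => psi (iter n T x)) (fun x => Z x - c)).
  rewrite -EZ; last exact: L2_L1.
  rewrite /ip -ED; [|by apply: L1Z; exact: L2_L1|exact: L2_mul].
  rewrite -ED; [|by apply: b1; apply: L1B => //; exact: L2_L1|].
    by apply: eq_Rintegral => x _; lra.
  by apply: L1D; [apply: L1Z; exact: L2_L1|exact: L2_mul].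
rewrite -(ip_adj (mpTn n) hW hpsi).
have i1 : `|\int[mu]_x ((Y x - Z x) * psi (iter n T x))| <= e / 4.
  apply: le_trans hYZ; apply: (le_trans (E_abs _)).
    by apply: b1; apply: L1B => //; exact: L2_L1.
  apply: E_le.
  - by apply/L1_abs/b1; apply: L1B => //; exact: L2_L1.
  - by apply/L1_abs; apply: L1B => //; exact: L2_L1.
  - by move=> x; rewrite normrM ler_piMr.
have i2 : `|c * \int[mu]_x psi (iter n T x)| <= e / 4.
  rewrite normrM; apply: le_trans hc; rewrite ler_piMr//.
  apply: le_trans n1; rewrite -(mp_nrm (mpTn n) hpsi).
  by apply: le_trans (E_nrm hpsin); apply: E_abs; exact: L2_L1.
have i3 : `|ip mu psi (A n (fun x => Z x - c))| <= e / 4.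
  apply: (le_trans (cauchy_schwarz hpsi (AL2 n hW))).
  by apply: le_trans hn; rewrite ler_piMl// nrm_ge0.
have := ler_normD (\int[mu]_x ((Y x - Z x) * psi (iter n T x)))
  (c * \int[mu]_x psi (iter n T x) + ip mu psi (A n (fun x => Z x - c))).
have := ler_normD (c * \int[mu]_x psi (iter n T x)) (ip mu psi (A n (fun x => Z x - c))).
lra.
Qed.

End exactness.

(** * Central limit theorem for reversed martingale differences *)

Section trig_bounds.
Context {R : realType}.
Implicit Types x y : R.

(** Mean value theorem. Each Taylor bound of [sin] and [cos] below has the preceding one as its
    derivative, so they follow from one another. *)
Lemma ge0_derive_ge0 (f df : R -> R) x : (forall y, is_derive y 1 f (df y)) ->
  (forall y, 0 <= y -> 0 <= df y) -> f 0 = 0 -> 0 <= x -> 0 <= f x.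
Proof.
move=> fd df0 f0 x0.
have [] := @MVT_segment _ f df 0 x x0.
  apply: continuous_subspaceT => y.
  exact/differentiable_continuous/derivable1_diffP/ex_derive.
move=> c; rewrite in_itv/= => /andP[c0 _].
  by rewrite f0 !subr0 => ->; rewrite mulr_ge0// df0.
Qed.

Lemma sin_le x : 0 <= x -> sin x <= x.
Proof.
move=> x0; rewrite -subr_ge0; move: x0.
have fd y : is_derive y 1 (fun y => y - sin y) (1 - cos y).
  by apply: is_derive_eq.
apply: (ge0_derive_ge0 fd).
- by move=> y _; rewrite subr_ge0 cos_le1.
- by rewrite sin0 subrr.
Qed.

Lemma cos_ge x : 0 <= x -> 0 <= cos x - 1 + x ^+ 2 / 2.
Proof.
have fd y : is_derive y 1 (fun y => cos y - 1 + y ^+ 2 / 2) (- sin y + y).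
  by apply: is_derive_eq; rewrite /GRing.scale/=; lra.
apply: (ge0_derive_ge0 fd).
- by move=> y y0; have := sin_le y0; lra.
- by rewrite cos0 expr0n/= mul0r subrr addr0.
Qed.

Lemma sin_ge x : 0 <= x -> 0 <= sin x - x + x ^+ 3 / 6.
Proof.
have fd y : is_derive y 1 (fun y => sin y - y + y ^+ 3 / 6) (cos y - 1 + y ^+ 2 / 2).
  by apply: is_derive_eq; rewrite /GRing.scale/=; lra.
apply: (ge0_derive_ge0 fd).
- exact: cos_ge.
- by rewrite sin0 expr0n/= mul0r subrr addr0.
Qed.

Lemma cos_le x : 0 <= x -> 0 <= x ^+ 4 / 24 - (cos x - 1 + x ^+ 2 / 2).
Proof.
have fd y : is_derive y 1 (fun y => y ^+ 4 / 24 - (cos y - 1 + y ^+ 2 / 2))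
    (sin y - y + y ^+ 3 / 6).
  by apply: is_derive_eq; rewrite /GRing.scale/=; lra.
apply: (ge0_derive_ge0 fd).
- exact: sin_ge.
- by rewrite cos0 !expr0n/= !mul0r subrr addr0 subrr.
Qed.

(** This factor keeps Taylor remainders bounded and small at once. Only second moments are
    available: [Z ^+ 2 * min1 (th * Z)] is dominated by [Z ^+ 2] and tends to 0 with [th]. *)
Definition min1 x := Num.min 1 `|x|.

Lemma min1_ge0 x : 0 <= min1 x.
Proof. by rewrite /min1 le_min ler01 normr_ge0. Qed.

Lemma min1_le1 x : min1 x <= 1.
Proof. by rewrite /min1 ge_min lexx. Qed.

Lemma min1_le x : min1 x <= `|x|.
Proof. by rewrite /min1 ge_min lexx orbT. Qed.

Lemma sin_abs_le x : `|sin x| <= `|x|.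
Proof.
wlog x0 : x / 0 <= x.
  move=> h; have [/h//|/ltW x0] := leP 0 x.
  by have := h (- x); rewrite sinN !normrN; apply; rewrite oppr_ge0.
rewrite (ger0_norm x0) ler_norml sin_le// andbT.
have [x1|/ltW x1] := leP 1 x.
  by apply: le_trans (sin_geN1 x); rewrite lerN2.
by have := sin_ge x0; have : x ^+ 3 <= x; [nra|lra].
Qed.

Lemma cosB_abs_le x y : `|cos x - cos y| <= `|x - y|.
Proof.
have -> : cos x - cos y = - 2 * sin ((x + y) / 2) * sin ((x - y) / 2).
  pose a := (x + y) / 2; pose b := (x - y) / 2.
  have ex : x = a + b by rewrite /a /b; field.
  have ey : y = a - b by rewrite /a /b; field.
  rewrite -/a -/b [in cos x]ex [in cos y]ey cosD cosB; ring.
rewrite !normrM normrN (ger0_norm (ler0n _ 2)).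
have := sin_abs_le ((x - y) / 2).
rewrite (@normrM _ (x - y)) (@ger0_norm _ (2^-1)) ?invr_ge0//.
have := sin_max ((x + y) / 2); have := normr_ge0 (sin ((x - y) / 2)); nra.
Qed.

Lemma cosB_min1 x y : `|cos x - cos y| <= 2 * min1 (x - y).
Proof.
rewrite /min1; case: (leP 1 `|x - y|) => h.
  rewrite mulr1 (le_trans (ler_normB _ _))//.
  by have := cos_max x; have := cos_max y; lra.
by have := cosB_abs_le x y; have := normr_ge0 (x - y); lra.
Qed.

Lemma cos_taylor x : `|cos x - 1 + x ^+ 2 / 2| <= x ^+ 2 * min1 x.
Proof.
wlog x0 : x / 0 <= x.
  move=> h; have [/h//|/ltW x0] := leP 0 x.
  by have := h (- x); rewrite cosN sqrrN /min1 normrN; apply; rewrite oppr_ge0.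
rewrite ger0_norm ?cos_ge// /min1 (ger0_norm x0); case: (leP 1 x) => h.
  by have := cos_le1 x; have := sqr_ge0 x; lra.
have := cos_le x0; rewrite (_ : x ^+ 4 = x ^+ 2 * x ^+ 2); last by rewrite -exprD.
by rewrite !expr2; nra.
Qed.

Lemma sin_taylor x : `|sin x - x| <= 2 * x ^+ 2 * min1 x.
Proof.
wlog x0 : x / 0 <= x.
  move=> h; have [/h//|/ltW x0] := leP 0 x.
  have := h (- x); rewrite sinN sqrrN /min1 normrN -opprD normrN; apply.
  by rewrite oppr_ge0.
rewrite /min1 (ger0_norm x0) distrC ger0_norm ?subr_ge0 ?sin_le//; case: (leP 1 x) => h.
  by have := sin_geN1 x; rewrite expr2; nra.
by have := sin_ge x0; rewrite expr2 !exprS expr0; nra.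
Qed.

(** The exponential lies between [1 - v] and [(1 + v)^-1], which differ by at most [v ^+ 2]. *)
Lemma expR_taylor (v : R) : 0 <= v -> `|expR (- v) - (1 - v)| <= v ^+ 2.
Proof.
move=> v0; rewrite ger0_norm; last by rewrite subr_ge0 expR_ge1Dx.
have : expR (- v) <= (1 + v)^-1.
  by rewrite expRN lef_pV2 ?posrE ?expR_gt0 ?expR_ge1Dx//; lra.
have -> : (1 + v)^-1 = 1 - v + v ^+ 2 / (1 + v) by field; lra.
have : v ^+ 2 / (1 + v) <= v ^+ 2 by rewrite ler_pdivrMr ?expr2; nra.
lra.
Qed.

Lemma measurable_min1 : measurable_fun [set: R] (fun x : R => min1 x).
Proof. by apply: measurable_minr => //; exact: measurableT_comp. Qed.

End trig_bounds.

(** The factor [1 - v] and the powers of [expR (- v)] lie in [0, 1], so the errors of the n steps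
    add up without being amplified. Comparing with [expR (- v)] gives the exact limit when [n * v]
    is constant. *)
Lemma geometric_recursion (R : realType) (a : nat -> R) (v c : R) n :
  0 <= v <= 1 -> 0 <= c -> a 0%N = 1 ->
  (forall k, `|a k.+1 - (1 - v) * a k| <= c) ->
  `|a n - expR (- v) ^+ n| <= n%:R * (c + v ^+ 2).
Proof.
move=> /andP[v0 v1] c0 a0 ha; elim: n => [|n IH].
  by rewrite a0 expr0 subrr normr0 mul0r.
set x := expR (- v) in IH *.
have x01 : `|x ^+ n| <= 1.
  by rewrite normrX exprn_ile1// ger0_norm ?expR_ge0// -[leRHS]expR0 ler_expR oppr_le0.
have -> : a n.+1 - x ^+ n.+1 = (a n.+1 - (1 - v) * a n) +
    ((1 - v) * (a n - x ^+ n) - (x - (1 - v)) * x ^+ n) by rewrite exprS; ring.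
rewrite (le_trans (ler_normD _ _))// -natr1 [leRHS]mulrDl mul1r.
have h1 : `|(1 - v) * (a n - x ^+ n)| <= n%:R * (c + v ^+ 2).
  by apply: le_trans IH; rewrite normrM ler_piMl// ger0_norm; lra.
have h2 : `|(x - (1 - v)) * x ^+ n| <= v ^+ 2.
  by rewrite normrM (le_trans _ (expR_taylor v0))// ler_piMr.
have := ha n; have := ler_normB ((1 - v) * (a n - x ^+ n)) ((x - (1 - v)) * x ^+ n).
lra.
Qed.

(** * Cosine transform of the normalized ergodic sums *)

Section CLT.
Context d (X : measurableType d) (R : realType) (mu : probability X R).
Variables (T : X -> X) (hT : exact_transformation mu T).
Let mpT : measure_preserving mu T. Proof. by case: hT. Qed.
Let mpTn n : measure_preserving mu (iter n T). Proof. exact: mp_iter. Qed.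

Definition psum (Z : X -> R) n x := \sum_(i < n) Z (iter i T x).

Lemma psumS Z n x : psum Z n.+1 x = Z x + psum Z n (T x).
Proof.
rewrite /psum big_ord_recl/=; congr (_ + _).
by apply: eq_bigr => i _; rewrite /bump/= -iterS iterSr.
Qed.

Variables (Z : X -> R) (hZ : L2 mu Z).
Hypothesis martZ : forall psi, L2 mu psi -> ip mu (fun x => psi (T x)) Z = 0.

Lemma psum_L2 n : L2 mu (psum Z n).
Proof. by apply: L2_sum => i _; exact: (mp_L2 (mpTn i) hZ). Qed.

(** The term of index 0 is split off: the rest is [psum Z n] composed with [T], to which [Z] is
    orthogonal by [martZ]. *)
Lemma nrm_psum n : nrm mu (psum Z n) ^+ 2 = n%:R * nrm mu Z ^+ 2.
Proof.
rewrite !nrmK; elim: n => [|n IH].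
  rewrite mul0r /ip -[RHS](E_cst mu 0); apply: eq_Rintegral => x _.
  by rewrite /psum big_ord0 mul0r.
have hs := psum_L2 n; have hsT := mp_L2 mpT hs.
rewrite (_ : psum Z n.+1 = fun x => Z x + psum Z n (T x)); last first.
  by apply/funext => x; rewrite psumS.
rewrite (ipDl hZ hsT (L2D hZ hsT)) (ipDr hZ hsT hZ) (ipDr hZ hsT hsT).
rewrite (ipC _ Z (fun x => psum Z n (T x))) martZ// addr0 add0r.
by rewrite (mp_ip mpT hs hs) IH -natr1 mulrDl mul1r addrC.
Qed.

Let s2 := nrm mu Z ^+ 2.
Let mZ : measurable_fun setT Z. Proof. exact: (L2_meas hZ). Qed.
Let Y x := Z x ^+ 2 - s2.
Let w L x := \sum_(i < L) `|Z (iter i.+1 T x)|.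

Let hY : L1 mu Y.
Proof. by apply: L1B; [exact: L2_sqr|exact: L1_cst]. Qed.

Let EY : \int[mu]_x Y x = 0.
Proof.
rewrite EB ?E_cst; [|exact: L2_sqr|exact: L1_cst].
apply/eqP; rewrite subr_eq0 /s2 nrmK; apply/eqP/eq_Rintegral => x _.
by rewrite expr2.
Qed.

(** Omitting L terms leaves a function of [iter L T x], to which [exact_mixing] applies. For k <= L
    the truncated subtraction makes the shortened sum empty. *)
Let psumT_approx L k x :
  `|psum Z k (T x) - psum Z (k - L) (iter L T (T x))| <= w L x.
Proof.
have w_le j : (j <= L)%N -> `|psum Z j (T x)| <= w L x.
  move=> jL; rewrite /psum (le_trans (ler_norm_sum _ _ _))//.
  rewrite /w -(big_mkord xpredT (fun i => `|Z (iter i T (T x))|)).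
  rewrite -(big_mkord xpredT (fun i => `|Z (iter i.+1 T x)|)).
  rewrite [leRHS](big_cat_nat (n := j))//=.
  rewrite (eq_bigr (fun i => `|Z (iter i.+1 T x)|)); last first.
    by move=> i _; rewrite -iterSr.
  by rewrite lerDl sumr_ge0.
have [kL|Lk] := leqP k L.
  move: (kL); rewrite -subn_eq0 => /eqP ->.
  by rewrite {2}/psum big_ord0 subr0; exact: w_le.
have -> : psum Z k (T x) - psum Z (k - L) (iter L T (T x)) = psum Z L (T x).
  apply/eqP; rewrite subr_eq; apply/eqP; rewrite /psum.
  rewrite -(subnKC (ltnW Lk)) addKn big_split_ord/=; congr (_ + _).
  by apply: eq_bigr => i _; rewrite -iterD addnC.
exact: w_le.
Qed.

Let a th k := \int[mu]_x cos (th * psum Z k x).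
(** Error of omitting L terms of the sum; [dm] below is the Taylor remainder, a term of Lindeberg
    type. *)
Let dl th L := \int[mu]_x (`|Y x| * min1 (th * w L x)).
Let dm th := \int[mu]_x (Z x ^+ 2 * min1 (th * Z x)).

Let mw L : measurable_fun setT (w L).
Proof.
apply: measurable_sum => i; apply: measurableT_comp => //.
exact: (mp_meas (mpTn i.+1) mZ).
Qed.

Let mmin th (U : X -> R) : measurable_fun setT U ->
  measurable_fun setT (fun x => min1 (th * U x)).
Proof.
move=> mU; apply: (measurableT_comp measurable_min1).
exact: measurable_funM.
Qed.

Let mincvg (U : X -> R) (V : X -> R) : measurable_fun setT U -> L1 mu V ->
  (forall x, 0 <= V x) ->
  (\int[mu]_x (V x * min1 ((Num.sqrt n.+1%:R)^-1 * U x))) @[n --> \oo] --> (0 : R).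
Proof.
move=> mU hV V0; have mV := L1_meas hV.
rewrite -[X in _ --> X](E_cst mu).
apply: (@DCT _ _ _ mu _ _ V) => //.
- by move=> n; apply: measurable_funM => //; exact: mmin.
- by move=> n x; rewrite normrM (ger0_norm (V0 _)) ger0_norm ?min1_ge0// ler_piMr// min1_le1.
apply: aeW => x; rewrite -[X in _ --> X](mulr0 (V x)).
apply: cvgM; first exact: cvg_cst.
have c0 : ((Num.sqrt n.+1%:R)^-1 * U x) @[n --> \oo] --> (0 : R).
  rewrite -[X in _ --> X](mul0r (U x)); apply: cvgM; last exact: cvg_cst.
  rewrite -[X in _ --> X]sqrtr0.
  rewrite (_ : (fun n => _) = (fun n => Num.sqrt (harmonic n))).
    by apply: continuous_cvg; [exact: sqrt_continuous|exact: cvg_harmonic].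
  by apply/funext => n; rewrite /harmonic/= sqrtrV.
apply: (@squeeze_cvgr _ _ _ _ (fun=> 0) (fun n => `|(Num.sqrt n.+1%:R)^-1 * U x|)).
- by apply: nearW => n; rewrite min1_ge0 min1_le.
- exact: cvg_cst.
- by move/cvg_norm : c0; rewrite normr0.
Qed.

Let cos_psum_L2 th k : L2 mu (fun x => cos (th * psum Z k x)).
Proof.
apply: (@L2_bounded _ _ _ _ _ 1) => [|x]; last exact: cos_max.
apply: (measurableT_comp (continuous_measurable_fun (@continuous_cos R))).
by apply: measurable_funM => //; exact: (L2_meas (psum_L2 k)).
Qed.

Let sin_psum_L2 th k : L2 mu (fun x => sin (th * psum Z k x)).
Proof.
apply: (@L2_bounded _ _ _ _ _ 1) => [|x]; last exact: sin_max.
apply: (measurableT_comp (continuous_measurable_fun (@continuous_sin R))).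
by apply: measurable_funM => //; exact: (L2_meas (psum_L2 k)).
Qed.

(** L is chosen from [e] alone, so the bound is uniform in [th] and k: the cosine of the shortened
    sum is an admissible [psi] in [exact_mixing], and the shortening costs [2 * dl th L]. *)
Let Ymix e : 0 < e -> exists L, forall th k,
  `|\int[mu]_x (Y x * cos (th * psum Z k (T x)))| <= e + 2 * dl th L.
Proof.
move=> e0; have [L hL] := exact_mixing hT hY EY e0; exists L => th k.
have mY := L1_meas hY.
have hc (U : X -> R) : L2 mu U -> (forall x, `|U x| <= 1) ->
    L1 mu (fun x => Y x * U x).
  move=> hU U1; under eq_fun do rewrite mulrC.
  exact: (L1_mulb (L2_meas hU) U1 hY).
pose c1 x := cos (th * psum Z k (T x)).
pose c2 x := cos (th * psum Z (k - L) (T x)).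
have hc1 : L2 mu c1 by exact: (mp_L2 mpT (cos_psum_L2 th k)).
have hc2 : L2 mu c2 by exact: (mp_L2 mpT (cos_psum_L2 th (k - L))).
have hc2L : L2 mu (fun x => c2 (iter L T x)) by exact: (mp_L2 (mpTn L) hc2).
have i1 : L1 mu (fun x => Y x * c1 x) by apply: hc => // x; exact: cos_max.
have i2 : L1 mu (fun x => Y x * c2 (iter L T x)).
  by apply: hc => // x; exact: cos_max.
have idl : L1 mu (fun x => `|Y x| * min1 (th * w L x)).
  apply: (L1_le _ (L1_abs hY)).
    by apply: measurable_funM; [exact: measurableT_comp|exact: mmin].
  by move=> x; rewrite normrM normr_id ger0_norm ?min1_ge0// ler_piMr// min1_le1.
have -> : \int[mu]_x (Y x * cos (th * psum Z k (T x))) =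
  \int[mu]_x (Y x * c1 x - Y x * c2 (iter L T x)) +
  \int[mu]_x (Y x * c2 (iter L T x)) by rewrite EB//; lra.
rewrite addrC (le_trans (ler_normD _ _))// lerD//.
  by apply: hL; [exact: (L2_meas hc2)|move=> x; exact: cos_max].
apply: (le_trans (E_abs (L1B i1 i2))); rewrite /dl -EZ//.
apply: E_le; [exact/L1_abs/L1B|exact: L1Z|move=> x].
rewrite -mulrBr normrM mulrCA ler_wpM2l// (le_trans (cosB_min1 _ _))//.
rewrite ler_pM2l// -mulrBr /min1 le_min ge_min lexx/=.
rewrite ge_min; apply/orP; right; rewrite !normrM ler_wpM2l//.
have eT : iter L T (T x) = T (iter L T x) by rewrite -iterS iterSr.
have := psumT_approx L k x; rewrite eT => /le_trans; apply; exact: ler_norm.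
Qed.

(** The cosine is expanded in its first summand [th * Z x]. The linear term vanishes by [martZ],
    since the sine it carries is a function of [T x]; in the quadratic term Z^2 is replaced by its
    mean at the cost [e]. The 3 adds the constant 1 of [cos_taylor] and the 2 of [sin_taylor]. *)
Let step th k e : 0 <= th -> `|\int[mu]_x (Y x * cos (th * psum Z k (T x)))| <= e ->
  `|a th k.+1 - (1 - th ^+ 2 * s2 / 2) * a th k| <= th ^+ 2 * (e + 3 * dm th).
Proof.
move=> th0 he.
pose C x := cos (th * psum Z k (T x)).
pose D x := sin (th * psum Z k (T x)).
have hC : L2 mu C by exact: (mp_L2 mpT (cos_psum_L2 th k)).
have hD : L2 mu D by exact: (mp_L2 mpT (sin_psum_L2 th k)).
have iZC : L1 mu (fun x => Z x ^+ 2 * C x).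
  under eq_fun do rewrite mulrC.
  by apply: (@L1_mulb _ _ _ _ _ _ 1);
    [exact: (L2_meas hC)|move=> x; exact: cos_max|exact: L2_sqr].
have iZD : L1 mu (fun x => D x * Z x) by exact: L2_mul.
pose r x := cos (th * psum Z k.+1 x) - (C x - th ^+ 2 / 2 * (Z x ^+ 2 * C x)
  - th * (D x * Z x)).
have idm : L1 mu (fun x => Z x ^+ 2 * min1 (th * Z x)).
  apply: (L1_le _ (L2_sqr hZ)).
    by apply: measurable_funM; [exact: measurable_funX|exact: mmin].
  by move=> x; rewrite normrM ger0_norm ?sqr_ge0// ger0_norm ?min1_ge0// ler_piMr ?sqr_ge0// min1_le1.
have rle x : `|r x| <= 3 * th ^+ 2 * (Z x ^+ 2 * min1 (th * Z x)).
  have -> : r x = (cos (th * Z x) - 1 + (th * Z x) ^+ 2 / 2) * C x -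
      (sin (th * Z x) - th * Z x) * D x.
    by rewrite /r psumS mulrDr cosD -/(C x) -/(D x); ring.
  rewrite (le_trans (ler_normB _ _))// !normrM.
  have := cos_taylor (th * Z x); have := sin_taylor (th * Z x).
  have : `|C x| <= 1 by exact: cos_max.
  have : `|D x| <= 1 by exact: sin_max.
  rewrite exprMn; set u := `|sin _ - _|; set v := `|cos _ - _ + _|.
  have : 0 <= u by exact: normr_ge0.
  have : 0 <= v by exact: normr_ge0.
  move=> v0 u0 D1 C1 hu hv.
  have : v * `|C x| <= v by rewrite ler_piMr.
  have : u * `|D x| <= u by rewrite ler_piMr.
  lra.
have i1 : L1 mu (fun x => C x - th ^+ 2 / 2 * (Z x ^+ 2 * C x)).
  by apply: L1B; [exact: L2_L1|exact: L1Z].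
have i2 : L1 mu (fun x => C x - th ^+ 2 / 2 * (Z x ^+ 2 * C x) - th * (D x * Z x)).
  by apply: L1B => //; exact: L1Z.
have ir : L1 mu r by apply: L1B => //; exact/L2_L1/cos_psum_L2.
have ak : \int[mu]_x C x = a th k by exact: (mp_E mpT (L2_L1 (cos_psum_L2 th k))).
have DZ0 : \int[mu]_x (D x * Z x) = 0 by exact: (martZ (sin_psum_L2 th k)).
have YC : \int[mu]_x (Y x * C x) = \int[mu]_x (Z x ^+ 2 * C x) - s2 * a th k.
  rewrite -ak -EZ; last exact: L2_L1.
  rewrite -EB//; last by apply: L1Z; exact: L2_L1.
  by apply: eq_Rintegral => x _; rewrite mulrBl.
have aE : a th k.+1 = a th k - th ^+ 2 / 2 * \int[mu]_x (Z x ^+ 2 * C x) +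
    \int[mu]_x r x.
  have -> : a th k.+1 = \int[mu]_x ((C x - th ^+ 2 / 2 * (Z x ^+ 2 * C x)
      - th * (D x * Z x)) + r x).
    by apply: eq_Rintegral => x _; rewrite /r; ring.
  rewrite ED// EB//; last exact: L1Z.
  rewrite EB ?EZ//; [|exact: L2_L1|exact: L1Z].
  by rewrite DZ0 ak; ring.
have -> : a th k.+1 - (1 - th ^+ 2 * s2 / 2) * a th k =
    - (th ^+ 2 / 2 * \int[mu]_x (Y x * C x)) + \int[mu]_x r x.
  by rewrite aE YC; ring.
rewrite (le_trans (ler_normD _ _))// normrN normrM ger0_norm; last first.
  by rewrite divr_ge0// sqr_ge0.
have ht := sqr_ge0 th.
have i3 : `|\int[mu]_x r x| <= 3 * th ^+ 2 * dm th.
  apply: (le_trans (E_abs ir)); rewrite /dm -EZ//.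
  by apply: E_le => //; [exact: L1_abs|exact: L1Z].
have i4 : th ^+ 2 / 2 * `|\int[mu]_x (Y x * C x)| <= th ^+ 2 * e.
  have e0 : 0 <= e by apply: le_trans he.
  by have := ler_wpM2l ht he; nra.
lra.
Qed.

(* psum n.+1 = Z + psum n o T, where Z is orthogonal to all psi o T, and Z^2 - E Z^2
   asymptotically so: each step of [geometric_recursion] makes an error o(1/n). *)
Lemma clt_cos :
  (\int[mu]_x cos ((Num.sqrt n%:R)^-1 * psum Z n x)) @[n --> \oo] -->
  expR (- (nrm mu Z ^+ 2 / 2)).
Proof.
(* The shift to [n.+1] leaves the limit unchanged and makes the normalization invertible. *)
rewrite -(cvg_shiftS (fun n => \int[mu]_x cos ((Num.sqrt n%:R)^-1 * psum Z n x))) /=.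
apply/cvgrPdist_le => e e0.
have e4 : 0 < e / 4 by lra.
have [L hL] := Ymix e4.
have cdl : dl ((Num.sqrt n.+1%:R)^-1) L @[n --> \oo] --> (0 : R).
  by apply: mincvg => //; exact: L1_abs.
have cdm : dm ((Num.sqrt n.+1%:R)^-1) @[n --> \oo] --> (0 : R).
  by apply: mincvg => //; [exact: L2_sqr|move=> x; exact: sqr_ge0].
have ch : (s2 / 2 * (n.+1%:R)^-1) @[n --> \oo] --> (0 : R).
  rewrite -[X in _ --> X](mulr0 (s2 / 2)); apply: cvgM; first exact: cvg_cst.
  exact: cvg_harmonic.
have cv : (s2 / 2 * (s2 / 2 * (n.+1%:R)^-1)) @[n --> \oo] --> (0 : R).
  by rewrite -[X in _ --> X](mulr0 (s2 / 2)); apply: cvgM; [exact: cvg_cst|].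
(* Of [e], a quarter goes to the mixing error, 5/24 to [2 * dl + 3 * dm], and a quarter to the error
   [n.+1 * v ^+ 2] of the exponential. *)
have e24 : 0 < e / 24 by lra.
have l01 : 0 < (1 : R) by [].
have s0 : 0 <= s2 by exact: sqr_ge0.
near=> n.
set th := (Num.sqrt n.+1%:R)^-1.
have th0 : 0 <= th by rewrite invr_ge0 sqrtr_ge0.
have th2 : th ^+ 2 = (n.+1%:R)^-1 by rewrite /th exprVn sqr_sqrtr.
set v := th ^+ 2 * s2 / 2.
have vE : v = s2 / 2 * (n.+1%:R)^-1 by rewrite /v th2; ring.
have v0 : 0 <= v by rewrite vE mulr_ge0// ?divr_ge0// invr_ge0.
have v1 : v <= 1.
  rewrite vE; near: n; have /cvgrPdist_le/(_ _ l01) := ch.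
  by apply: filterS => n; rewrite sub0r normrN; apply: le_trans; exact: ler_norm.
have vs : s2 / 2 * v <= e / 4.
  rewrite vE; near: n; have /cvgrPdist_le/(_ _ e4) := cv.
  by apply: filterS => n; rewrite sub0r normrN; apply: le_trans; exact: ler_norm.
have dle : dl th L <= e / 24.
  rewrite /th; near: n; have /cvgrPdist_le/(_ _ e24) := cdl.
  by apply: filterS => n; rewrite sub0r normrN; apply: le_trans; exact: ler_norm.
have dme : dm th <= e / 24.
  rewrite /th; near: n; have /cvgrPdist_le/(_ _ e24) := cdm.
  by apply: filterS => n; rewrite sub0r normrN; apply: le_trans; exact: ler_norm.
have dl0 : 0 <= dl th L.
  by apply: E_ge0 => x; rewrite mulr_ge0// min1_ge0.
have dm0 : 0 <= dm th.
  by apply: E_ge0 => x; rewrite mulr_ge0 ?sqr_ge0// min1_ge0.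
pose de := e / 4 + 2 * dl th L + 3 * dm th.
have a0 : a th 0 = 1.
  rewrite /a -[RHS](E_cst mu); apply: eq_Rintegral => x _.
  by rewrite /psum big_ord0 mulr0 cos0.
have v01 : 0 <= v <= 1 by rewrite v0 v1.
have c0 : 0 <= th ^+ 2 * de by rewrite mulr_ge0 ?sqr_ge0 /de//; lra.
have := @geometric_recursion _ (a th) v _ n.+1 v01 c0 a0 (fun k => step th0 (hL th k)).
have -> : expR (- v) ^+ n.+1 = expR (- (s2 / 2)).
  by rewrite -expRM_natr; congr expR; rewrite vE; field; rewrite addrC natr1.
rewrite distrC => /le_trans; apply.
have -> : n.+1%:R * (th ^+ 2 * de + v ^+ 2) = de + s2 / 2 * v.
  by rewrite {1}vE th2 expr2 {1}vE; field; rewrite addrC natr1.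
by rewrite /de; lra.
Unshelve. all: by end_near.
Qed.

End CLT.

(** * Approximation by trigonometric polynomials *)

Section weierstrass.
Context {R : realType}.
Implicit Types (f : nat -> R) (x y : R).

(* The Bernstein polynomial of f, as the expectation of f at a binomial
   variable, defined by conditioning on the first trial. *)
Fixpoint bernstein n f : {poly R} :=
  if n is n'.+1 then 'X * bernstein n' (fun k => f k.+1) + (1 - 'X) * bernstein n' f
  else (f 0%N)%:P.

Lemma bernsteinS n f x : (bernstein n.+1 f).[x] =
  x * (bernstein n (fun k => f k.+1)).[x] + (1 - x) * (bernstein n f).[x].
Proof. by rewrite /= !hornerE. Qed.

Lemma bernstein_lin n c f g x :
  (bernstein n (fun k => c * f k + g k)).[x] =
  c * (bernstein n f).[x] + (bernstein n g).[x].
Proof.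
elim: n f g => [|n IH] f g; first by rewrite /= !hornerE.
rewrite !bernsteinS (IH (fun k => f k.+1) (fun k => g k.+1)) IH; ring.
Qed.

Lemma bernstein_cst n c x : (bernstein n (fun=> c)).[x] = c.
Proof.
elim: n => [|n IH]; first by rewrite /= hornerC.
by rewrite bernsteinS IH; ring.
Qed.

Lemma bernstein_le n f g x : 0 <= x <= 1 -> (forall k, (k <= n)%N -> f k <= g k) ->
  (bernstein n f).[x] <= (bernstein n g).[x].
Proof.
move=> /andP[x0 x1]; elim: n f g => [|n IH] f g fg.
  by rewrite /= !hornerC; exact: fg.
rewrite !bernsteinS lerD// ler_wpM2l ?subr_ge0//; apply: IH => k kn; apply: fg => //.
exact: leqW.
Qed.

(** The centre c is arbitrary for the sake of the induction: a success at the first trial moves it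
    to [c - 1]. At [c = n * x] this is the binomial variance. *)
Lemma bernstein_var n c x : (bernstein n (fun k => (k%:R - c) ^+ 2)).[x] =
  n%:R * (x * (1 - x)) + (n%:R * x - c) ^+ 2.
Proof.
elim: n c => [|n IH] c; first by rewrite /= hornerC; ring.
rewrite bernsteinS IH.
rewrite (_ : (fun k => _) = (fun k => (k%:R - (c - 1)) ^+ 2)); last first.
  by apply/funext => k; rewrite -natr1; ring.
by rewrite IH -natr1; ring.
Qed.

(** A modulus quadratic in [x - y] suits Bernstein polynomials: the binomial mean of
    [(k / n - x) ^+ 2] is at most [1 / n], and n is taken with [C / n <= e]. *)
Lemma weierstrass01 (h : R -> R) (e C : R) : 0 < e -> 0 <= C ->
  (forall x y, 0 <= x <= 1 -> 0 <= y <= 1 -> `|h x - h y| <= e + C * (x - y) ^+ 2) ->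
  exists p : {poly R}, forall x, 0 <= x <= 1 -> `|h x - p.[x]| <= 2 * e.
Proof.
move=> e0 C0 hh.
pose n := (Num.truncn (C / e)).+1.
have n0 : 0 < n%:R :> R by rewrite ltr0n.
have Cn : C / n%:R <= e.
  rewrite ler_pdivrMr// mulrC -ler_pdivrMr//; apply: ltW; exact: truncnS_gt.
exists (bernstein n (fun k => h (k%:R / n%:R))) => x x01.
pose u k : R := C / n%:R ^+ 2 * (k%:R - n%:R * x) ^+ 2 + e.
have kn k : (k <= n)%N -> `|h x - h (k%:R / n%:R)| <= u k.
  move=> kn; have -> : u k = e + C * (x - k%:R / n%:R) ^+ 2.
    by rewrite /u; field; rewrite gt_eqF.
  by apply: hh => //; rewrite divr_ge0//= ler_pdivrMr// mul1r ler_nat.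
have uE : (bernstein n u).[x] <= 2 * e.
  rewrite /u bernstein_lin bernstein_cst bernstein_var subrr expr0n/= addr0.
  have -> : C / n%:R ^+ 2 * (n%:R * (x * (1 - x))) = C / n%:R * (x * (1 - x)).
    by field; rewrite gt_eqF.
  have : x * (1 - x) <= 1 by case/andP: x01; nra.
  have : 0 <= C / n%:R by rewrite divr_ge0// ltW.
  nra.
rewrite ler_norml; apply/andP; split.
(* The Bernstein operator is monotone; it is applied to [h x - u <= h (k / n) <= h x + u]. *)
- have := @bernstein_le n (fun k => h (k%:R / n%:R)) (fun k => 1 * u k + h x) x x01.
  rewrite bernstein_lin bernstein_cst => H.
  suff : (bernstein n (fun k => h (k%:R / n%:R))).[x] <= 1 * (bernstein n u).[x] + h x by lra.
  by apply: H => k /kn; rewrite ler_norml => /andP[]; lra.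
- have := @bernstein_le n (fun k => (-1) * u k + h x) (fun k => h (k%:R / n%:R)) x x01.
  rewrite bernstein_lin bernstein_cst => H.
  suff : -1 * (bernstein n u).[x] + h x <= (bernstein n (fun k => h (k%:R / n%:R))).[x] by lra.
  by apply: H => k /kn; rewrite ler_norml => /andP[]; lra.
Qed.

(** Otherwise there are pairs with [e + n |x - y| < |h x - h y|]. As [h] is bounded, [|x - y|] is
    O(1/n); along a subsequence both points tend to the same l, against continuity. *)
Lemma modulus (h : R -> R) (M K e : R) : continuous h -> (forall t, `|h t| <= M) ->
  0 < e -> exists2 C, 0 <= C & forall x y, `|x| <= K -> `|y| <= K ->
    `|h x - h y| <= e + C * `|x - y|.
Proof.
move=> ch hM e0; apply: contrapT => no.
have bad n : exists p : R * R, [/\ `|p.1| <= K, `|p.2| <= K &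
    e + n%:R * `|p.1 - p.2| < `|h p.1 - h p.2|].
  apply: contrapT => nn; apply: no; exists n%:R => // x y xK yK.
  by rewrite leNgt; apply/negP => lt; apply: nn; exists (x, y).
have /choice[p hp] := bad.
have bx : bounded_fun (fun n => (p n).1).
  exists K; split; first exact: num_real.
  by move=> z Kz n _; have [+ _ _] := hp n; move=> /le_trans; apply; exact: ltW.
have [s sinc /cvg_ex[l cl]] := bolzano_weierstrass bx.
have sge n : (n <= s n)%N.
  elim: n => // n IH; apply: leq_ltn_trans IH _.
  by have /increasing_seqP/(_ n) := sinc; rewrite ltEnat.
have M0 : 0 <= M by apply: le_trans (hM 0).
have cd : (p (s n)).1 - (p (s n)).2 @[n --> \oo] --> (0 : R).
  apply/norm_cvg0P.
  (* [n D <= 2 M] comes from the bound of [h] and [D <= 2 K] from the interval; their sum bounds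
     [(n + 1) D]. *)
  apply: (@squeeze_cvgr _ _ _ _ (fun=> 0) (fun n => (2 * M + 2 * K) * harmonic n)).
  - apply: nearW => n; rewrite normr_ge0/=.
    have [h1 h2 h3] := hp (s n); set D := `|_ - _| in h3 *.
    have D2K : D <= 2 * K by have := ler_normB (p (s n)).1 (p (s n)).2; rewrite -/D; lra.
    have h4 := ler_normB (h (p (s n)).1) (h (p (s n)).2).
    have h5 := hM (p (s n)).1; have h6 := hM (p (s n)).2.
    have nD : n%:R * D <= (s n)%:R * D by rewrite ler_wpM2r ?normr_ge0// ler_nat.
    by rewrite /harmonic/= ler_pdivlMr ?ltr0n// -natr1 mulrDr mulr1 (mulrC D); lra.
  - exact: cvg_cst.
  - rewrite -[X in _ --> X](mulr0 (2 * M + 2 * K)).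
    by apply: cvgM; [exact: cvg_cst|exact: cvg_harmonic].
have cl2 : (p (s n)).2 @[n --> \oo] --> l.
  rewrite -[X in _ --> X](subr0 l).
  rewrite (_ : (fun n => _) = (fun n => (p (s n)).1 - ((p (s n)).1 - (p (s n)).2))).
    exact: cvgB.
  by apply/funext => n; rewrite subKr.
have ch1 : h (p (s n)).1 @[n --> \oo] --> h l by apply: continuous_cvg => //; exact: ch.
have ch2 : h (p (s n)).2 @[n --> \oo] --> h l by apply: continuous_cvg => //; exact: ch.
have cc : h (p (s n)).1 - h (p (s n)).2 @[n --> \oo] --> (0 : R).
  by rewrite -(subrr (h l)); exact: cvgB.
move/cvgrPdist_lt : cc => /(_ _ e0)[N _ hN]; have := hN N (leqnn N).
rewrite sub0r normrN; have [_ _] := hp (s N).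
have : 0 <= (s N)%:R * `|(p (s N)).1 - (p (s N)).2| by rewrite mulr_ge0.
lra.
Qed.

Lemma weierstrass (h : R -> R) (M K e : R) : continuous h -> (forall t, `|h t| <= M) ->
  0 < K -> 0 < e -> exists p : {poly R}, forall x, `|x| <= K -> `|h x - p.[x]| <= e.
Proof.
move=> ch hM K0 e0.
have e4 : 0 < e / 4 by lra.
have [C C0 hC] := modulus K ch hM e4.
pose h' t := h (2 * K * t - K).
pose D := C * (2 * K).
have D0 : 0 <= D by rewrite mulr_ge0// mulr_ge0// ltW.
have [||x y /andP[x0 x1] /andP[y0 y1]|p hp] := @weierstrass01 h' (e / 2) (D ^+ 2 / e).
- by lra.
- by rewrite divr_ge0 ?sqr_ge0// ltW.
- have := hC (2 * K * x - K) (2 * K * y - K); rewrite /h'.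
  have -> : 2 * K * x - K - (2 * K * y - K) = 2 * K * (x - y) by ring.
  rewrite normrM (ger0_norm (_ : 0 <= 2 * K)) ?mulr_ge0 ?(ltW K0)// mulrA -/D.
  move=> /(_ _ _)/le_trans; apply.
  + by rewrite ler_norml; apply/andP; split; nra.
  + by rewrite ler_norml; apply/andP; split; nra.
  (* AM-GM: D t <= e / 4 + D^2 t^2 / e *)
  have -> : D ^+ 2 / e * (x - y) ^+ 2 = (D * `|x - y|) ^+ 2 / e.
    by rewrite -(real_normK (num_real (x - y))); ring.
  set t := D * _.
  have : 0 <= (t - e / 2) ^+ 2 / e by rewrite divr_ge0 ?sqr_ge0// ltW.
  have -> : (t - e / 2) ^+ 2 / e = t ^+ 2 / e - t + e / 4 by field; rewrite gt_eqF.
  lra.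
exists (p \Po ((2 * K)^-1 *: 'X + (2^-1)%:P)) => x xK.
rewrite horner_comp !hornerE.
have xx : 2 * K * ((2 * K)^-1 * x + 2^-1) - K = x by field; rewrite gt_eqF.
have := hp ((2 * K)^-1 * x + 2^-1); rewrite /h' xx mulrCA divff// mulr1; apply.
have K2 : 0 < 2 * K by rewrite mulr_gt0.
have := xK; rewrite ler_norml => /andP[x1 x2].
rewrite (_ : _ + _ = (x + K) / (2 * K)); last by field; rewrite gt_eqF.
by apply/andP; split; [rewrite divr_ge0|rewrite ler_pdivrMr]; lra.
Qed.

(* Quantifies that convergence in L_1 implies convergence in law. *)
Lemma growth_modulus (h : R -> R) (M e : R) : continuous h -> (forall t, `|h t| <= M) ->
  0 < e -> exists2 C, 0 <= C & forall x y, `|h x - h y| <= e + e * `|x| + C * `|x - y|.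
Proof.
move=> ch hM e0.
have M0 : 0 <= M by apply: le_trans (hM 0).
(* Beyond K the term [e |x|] already exceeds [2 * M]. Below K, the modulus on [[- (K + 1), K + 1]]
   serves at distances up to 1, and the summand [2 * M] of the constant at larger ones. *)
pose K := 2 * M / e.
have [C C0 hC] := modulus (K + 1) ch hM e0.
exists (C + 2 * M); first by rewrite addr_ge0// mulr_ge0.
move=> x y.
have h2 : `|h x - h y| <= 2 * M.
  by have := ler_normB (h x) (h y); have := hM x; have := hM y; lra.
have x0 := normr_ge0 x; have d0 := normr_ge0 (x - y).
have [xK|Kx] := leP `|x| K; last first.
  have : 2 * M <= e * `|x| by rewrite (mulrC e) -ler_pdivrMr// ltW.
  have := mulr_ge0 C0 d0; have := mulr_ge0 M0 d0; nra.
have [d1|d1] := leP `|x - y| 1; last first.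
  have := mulr_ge0 C0 d0; have := mulr_ge0 (ltW e0) x0; nra.
have yK : `|y| <= K + 1.
  by have := ler_normB x (x - y); rewrite subKr; lra.
have := hC x y _ yK; move=> /(_ _)/le_trans; apply; first by lra.
have := mulr_ge0 M0 d0; have := mulr_ge0 (ltW e0) x0; nra.
Qed.

End weierstrass.

(** * Trigonometric polynomials in finitely many variables *)

Section trigonometric_polynomials.
Context {R : realType} (n : nat).
Implicit Types (F G : (nat -> R) -> R) (w t : nat -> R).

Definition trigp F := exists s : seq (R * (nat -> R)),
  forall w, F w = \sum_(p <- s) p.1 * cos (\sum_(m < n) p.2 m * w m).

Lemma trigp_cos c t : trigp (fun w => c * cos (\sum_(m < n) t m * w m)).
Proof. by exists [:: (c, t)] => w; rewrite big_seq1. Qed.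

Lemma trigp_eq F G : F =1 G -> trigp F -> trigp G.
Proof. by move=> FG [s hs]; exists s => w; rewrite -FG. Qed.

Lemma trigp_cst c : trigp (fun=> c).
Proof.
apply: trigp_eq (trigp_cos c (fun=> 0)) => w.
by rewrite big1 ?cos0 ?mulr1// => i _; rewrite mul0r.
Qed.

Lemma trigpD F G : trigp F -> trigp G -> trigp (fun w => F w + G w).
Proof. by move=> [s hs] [s' hs']; exists (s ++ s') => w; rewrite big_cat hs hs'. Qed.

Lemma trigp_sum I (r : seq I) (P : pred I) (F : I -> (nat -> R) -> R) :
  (forall i, P i -> trigp (F i)) -> trigp (fun w => \sum_(i <- r | P i) F i w).
Proof.
move=> h; elim: r => [|a r IH].
  by apply: trigp_eq (trigp_cst 0) => w; rewrite big_nil.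
case: (boolP (P a)) => Pa; last first.
  by apply: trigp_eq IH => w; rewrite big_cons (negbTE Pa).
apply: trigp_eq (trigpD (h a Pa) IH) => w; by rewrite big_cons Pa.
Qed.

Lemma trigpM F G : trigp F -> trigp G -> trigp (fun w => F w * G w).
Proof.
move=> [s hs] [s' hs'].
pose H (p q : R * (nat -> R)) w :=
  p.1 * q.1 / 2 * cos (\sum_(m < n) (p.2 m + q.2 m) * w m) +
  p.1 * q.1 / 2 * cos (\sum_(m < n) (p.2 m - q.2 m) * w m).
apply: (@trigp_eq (fun w => \sum_(p <- s) \sum_(q <- s') H p q w)).
  move=> w; rewrite hs hs' mulr_suml; apply: eq_bigr => p _.
  rewrite mulr_sumr; apply: eq_bigr => q _; rewrite /H.
  under eq_bigr do rewrite mulrDl.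
  under [X in _ + _ * cos X]eq_bigr do rewrite mulrBl.
  by rewrite sumrB big_split/= cosD cosB; field.
apply: (@trigp_sum _ s xpredT (fun p w => \sum_(q <- s') H p q w)) => p _.
apply: (@trigp_sum _ s' xpredT (H p)) => q _.
exact: (trigpD (trigp_cos _ (fun m => p.2 m + q.2 m))
  (trigp_cos _ (fun m => p.2 m - q.2 m))).
Qed.

Lemma trigp_horner (p : {poly R}) F : trigp F -> trigp (fun w => p.[F w]).
Proof.
move=> hF; elim/poly_ind: p => [|p c IH].
  by apply: trigp_eq (trigp_cst 0) => w; rewrite horner0.
by apply: trigp_eq (trigpD (trigpM IH hF) (trigp_cst c)) => w; rewrite !hornerE.
Qed.

Lemma trigp_coord a i : (i < n)%N -> trigp (fun w => cos (a * w i)).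
Proof.
move=> ni; apply: trigp_eq (trigp_cos 1 (fun m => if m == i then a else 0)) => w.
rewrite mul1r (bigD1 (Ordinal ni))//= eqxx big1 ?addr0// => m mi.
by rewrite ifN ?mul0r.
Qed.

(* For small a, w^2 is approximated by the bounded function 2 / a^2 (1 - cos (a w)),
   and h by a polynomial on the range of the resulting form. *)
Lemma trigp_approx (h : R -> R) (M e : R) (la : nat -> R) :
  continuous h -> (forall x, `|h x| <= M) -> 0 < e ->
  exists2 F, trigp F & forall w,
    `|h (\sum_(m < n) la m * w m ^+ 2) - F w| <= e * (1 + \sum_(m < n) w m ^+ 2).
Proof.
move=> ch hM e0.
have M0 : 0 <= M by apply: le_trans (hM 0).
pose La := \sum_(m < n) `|la m|.
have La0 : 0 <= La by apply: sumr_ge0.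
(* With W the sum of the squares, [e1 * (2 + (1 + La) * W)] is spent on replacing the squares and
   [e1] on the polynomial. *)
pose e1 := e / (3 + La).
have e10 : 0 < e1 by rewrite divr_gt0//; lra.
have [C C0 hC] := growth_modulus ch hM e10.
(* Chosen with [e1 * K ^+ 2 = 2 * M]: if some coordinate exceeds K, the trivial bound [2 * M] is
   within the allowed error. *)
pose K := Num.sqrt (2 * M / e1).
have K2 : K ^+ 2 = 2 * M / e1 by rewrite sqr_sqrtr// divr_ge0 ?(ltW e10)// mulr_ge0.
have K0 : 0 <= K by exact: sqrtr_ge0.
pose B := C * (La * (2 * K ^+ 3)).
have B0 : 0 <= B.
  by apply: mulr_ge0 => //; apply: mulr_ge0 => //; apply: mulr_ge0 => //; apply: exprn_ge0.
(* If all [|w m| <= K], the form changes by at most [La * (2 * K ^+ 3) * a]; this [a] brings C times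
   that below [e1]. *)
pose a := e1 / (B + 1).
have a0 : 0 < a by rewrite divr_gt0//; lra.
have Ba : B * a <= e1.
  have aE : a * (B + 1) = e1 by rewrite /a divfK// gt_eqF//; lra.
  lra.
pose rho (x : R) := 2 / a ^+ 2 * (1 - cos (a * x)).
pose S w := \sum_(m < n) la m * w m ^+ 2.
pose S' w := \sum_(m < n) la m * rho (w m).
have rho_sqr x : `|x ^+ 2 - rho x| <= 2 * x ^+ 2 * min1 (a * x).
  have -> : x ^+ 2 - rho x = 2 / a ^+ 2 * (cos (a * x) - 1 + (a * x) ^+ 2 / 2).
    by rewrite /rho; field; rewrite gt_eqF.
  rewrite normrM ger0_norm; last by rewrite divr_ge0// sqr_ge0.
  have := cos_taylor (a * x).
  have a2 : 0 < 2 / a ^+ 2 by rewrite divr_gt0// exprn_gt0.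
  rewrite -(ler_pM2l a2) => /le_trans; apply.
  rewrite le_eqVlt; apply/orP; left; apply/eqP; field; rewrite gt_eqF//.
have Sb w : `|S w| <= La * \sum_(m < n) w m ^+ 2.
  rewrite (le_trans (ler_norm_sum _ _ _))// mulr_suml; apply: ler_sum => m _.
  rewrite normrM ler_wpM2l// ger0_norm ?sqr_ge0// (bigD1 m)//= lerDl.
  by apply: sumr_ge0 => i _; exact: sqr_ge0.
have W0 w : 0 <= \sum_(m < n) w m ^+ 2 by apply: sumr_ge0 => i _; exact: sqr_ge0.
have SS' w : `|h (S w) - h (S' w)| <= e1 * (2 + (1 + La) * \sum_(m < n) w m ^+ 2).
  have [wK|] := pselect (forall m : 'I_n, `|w m| <= K).
    have d : `|S w - S' w| <= La * (2 * K ^+ 3) * a.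
      rewrite /S /S' -sumrB (le_trans (ler_norm_sum _ _ _))// !mulr_suml.
      apply: ler_sum => m _; rewrite -mulrBr normrM -mulrA ler_wpM2l//.
      apply: (le_trans (rho_sqr _)).
      have := min1_le (a * w m); rewrite normrM (gtr0_norm a0) => hm.
      rewrite -[leLHS]mulrA -[leRHS]mulrA ler_pM2l// -(real_normK (num_real (w m))).
      apply: (@le_trans _ _ (`|w m| ^+ 2 * (a * `|w m|))).
        by rewrite ler_wpM2l// sqr_ge0.
      rewrite mulrCA -exprSr mulrC ler_wpM2r ?(ltW a0)//.
      by rewrite lerXn2r ?nnegrE.
    apply: (le_trans (hC _ _)).
    have : C * `|S w - S' w| <= B * a by rewrite /B -mulrA ler_wpM2l.
    have : e1 * `|S w| <= e1 * (La * \sum_(m < n) w m ^+ 2) by rewrite ler_pM2l.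
    have := mulr_ge0 (ltW e10) (W0 w).
    lra.
  move=> /existsNP[m /negP]; rewrite -ltNge => Kw.
  have h2 : `|h (S w) - h (S' w)| <= 2 * M.
    by have := ler_normB (h (S w)) (h (S' w)); have := hM (S w); have := hM (S' w); lra.
  apply: (le_trans h2).
  have -> : 2 * M = e1 * K ^+ 2 by rewrite K2; field; rewrite gt_eqF.
  rewrite ler_pM2l//.
  have : K ^+ 2 <= w m ^+ 2.
    by rewrite -(real_normK (num_real (w m))) lerXn2r ?nnegrE// ltW.
  have : w m ^+ 2 <= \sum_(m < n) w m ^+ 2.
    by rewrite (bigD1 m)//= lerDl; apply: sumr_ge0 => i _; exact: sqr_ge0.
  have := mulr_ge0 La0 (W0 w); lra.
pose K' := 4 / a ^+ 2 * La + 1.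
have K'0 : 0 < K' by rewrite ltr_wpDl// mulr_ge0// divr_ge0// sqr_ge0.
have S'b w : `|S' w| <= K'.
  apply: (@le_trans _ _ (4 / a ^+ 2 * La)); last by rewrite lerDl.
  rewrite (le_trans (ler_norm_sum _ _ _))// mulr_sumr; apply: ler_sum => m _.
  have a2 : 0 < 2 / a ^+ 2 by rewrite divr_gt0// exprn_gt0.
  rewrite normrM mulrC ler_wpM2r// /rho normrM (ger0_norm (ltW a2)).
  have c2 : `|1 - cos (a * w m)| <= 2.
    by have := ler_normB 1 (cos (a * w m)); have := cos_max (a * w m); rewrite normr1; lra.
  have := ler_wpM2l (ltW a2) c2; lra.
have [p hp] := weierstrass ch hM K'0 e10.
exists (fun w => p.[S' w]).
  apply: trigp_horner.
  apply: (@trigp_sum _ _ _ (fun (m : 'I_n) w => la m * rho (w m))) => m _.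
  apply: (trigp_eq _ (trigpD (trigp_cst (la m * (2 / a ^+ 2)))
    (trigpM (trigp_cst (- (la m * (2 / a ^+ 2)))) (trigp_coord a (ltn_ord m))))).
  by move=> w; rewrite /rho; ring.
move=> w; rewrite -/(S w).
have := ler_normD (h (S w) - h (S' w)) (h (S' w) - p.[S' w]).
rewrite subrKA; have := SS' w; have := hp _ (S'b w).
have eE : e = e1 * (3 + La) by rewrite /e1; field; rewrite gt_eqF//; lra.
rewrite eE; have := W0 w; set W := \sum_(m < n) _; move=> W0'.
have := mulr_ge0 (ltW e10) W0'; have := mulr_ge0 (ltW e10) La0; nra.
Qed.

End trigonometric_polynomials.

(** * Independent Gaussian variables *)

Section gaussian.
Context {R : realType}.
Let nu : probability (measurableTypeR R) R := normal_prob 0 1.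
Let g : R -> R := normal_pdf 0 1.
Let lam := @lebesgue_measure R.

Let gE x : g x = normal_peak 1 * expR (- x ^+ 2 / 2).
Proof.
rewrite /g normal_pdfE ?oner_eq0// /normal_fun subr0 expr1n.
by congr (_ * expR (_ / _)).
Qed.

Let g_ge0 x : 0 <= g x. Proof. exact: normal_pdf_ge0. Qed.

Let mg : measurable_fun setT g. Proof. exact: measurable_normal_pdf. Qed.

Let ge0_nuE (phi : R -> R) : measurable_fun setT phi -> (forall x, 0 <= phi x) ->
  (\int[nu]_x (phi x)%:E = \int[lam]_x (phi x * g x)%:E)%E.
Proof.
move=> mphi phi0; apply: integral_density => //.
- exact: normal_prob_dominates.
- exact: integrable_normal_pdf.
Qed.

(** Since [|x| <= 5 / 2 * expR (x ^+ 2 / 4)], the product of [|x|] with the density is at most a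
    multiple of the centred Gaussian density of variance 2. *)
Lemma normal_L1_id : L1 nu (fun x => x).
Proof.
apply/integrableP; split; first exact/measurable_EFinP.
rewrite [X in (X < _)%E](_ : _ = \int[nu]_x `|x|%:E)%E//.
rewrite ge0_nuE//.
pose k : R := 5 / 2 * (normal_peak 1 / normal_peak (Num.sqrt 2)).
have s2 : Num.sqrt 2 != 0 :> R by rewrite gt_eqF// sqrtr_gt0.
have pk1 := @normal_peak_gt0 R 1 (oner_neq0 R).
have pk2 := @normal_peak_gt0 R _ s2.
apply: (@le_lt_trans _ _ (\int[lam]_x (k * normal_pdf 0 (Num.sqrt 2) x)%:E)%E).
  apply: ge0_le_integral => //.
  - by move=> x _; rewrite lee_fin mulr_ge0.
  - by apply/measurable_EFinP; apply: measurable_funM => //; exact: measurableT_comp.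
  - by apply/measurable_EFinP; apply: measurable_funM => //; exact: measurable_normal_pdf.
  move=> x _; rewrite lee_fin gE normal_pdfE// /normal_fun subr0 sqr_sqrtr//.
  rewrite /k.
  have -> : 5 / 2 * (normal_peak 1 / normal_peak (Num.sqrt 2)) *
      (normal_peak (Num.sqrt 2) * expR (- x ^+ 2 / (2 *+ 2))) =
      normal_peak 1 * (5 / 2 * expR (- x ^+ 2 / 4)).
    have -> : 2 *+ 2 = 4 :> R by rewrite mulr2n; lra.
    by field; rewrite gt_eqF.
  rewrite mulrCA ler_pM2l//.
  have -> : - x ^+ 2 / 2 = - x ^+ 2 / 4 + - x ^+ 2 / 4 by field.
  rewrite expRD mulrA ler_pM2r ?expR_gt0//.
  rewrite -ler_pdivlMr ?expR_gt0// -expRN -mulNr opprK.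
  have := expR_ge1Dx (x ^+ 2 / 4).
  have : 0 <= (`|x| - 1) ^+ 2 by exact: sqr_ge0.
  rewrite -(real_normK (num_real x)); set a := `|x|; nra.
rewrite [X in (X < _)%E](_ : _ = \int[lam]_x (k%:E * (normal_pdf 0 (Num.sqrt 2) x)%:E))%E//.
rewrite integralZl//; last exact: integrable_normal_pdf.
by rewrite integral_normal_pdf mule1 ltry.
Qed.

Let mcos t c : measurable_fun setT (fun x : R => cos (t * x + c)).
Proof.
apply: (measurableT_comp (continuous_measurable_fun (@continuous_cos R))).
by apply: measurable_funD => //; exact: measurable_funM.
Qed.

Let msin t c : measurable_fun setT (fun x : R => sin (t * x + c)).
Proof.
apply: (measurableT_comp (continuous_measurable_fun (@continuous_sin R))).
by apply: measurable_funD => //; exact: measurable_funM.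
Qed.

(** [st t c x * g x] is the derivative of [sin (t * x + c) * g x], because g' = - x g. *)
Let st t c x : R := t * cos (t * x + c) - x * sin (t * x + c).

Let dst t c (x : R) : is_derive x 1 (fun x => sin (t * x + c) * g x) (st t c x * g x).
Proof.
rewrite (_ : (fun x => _) = (fun x => sin (t * x + c) * (normal_peak 1 * expR (- x ^+ 2 / 2)))); last first.
  by apply/funext => y; rewrite gE.
by apply: is_derive_eq; rewrite /st gE /GRing.scale/=; field.
Qed.

Let nuE (phi : R -> R) : L1 nu phi ->
  \int[nu]_x phi x = \int[lam]_x (phi x * g x).
Proof.
move=> hphi; have mphi := L1_meas hphi.
have hp : L1 nu phi^\+.
  apply: (L1_le _ (L1_abs hphi)); first exact: measurable_funrpos.
  by move=> x; rewrite ger0_norm ?funrpos_ge0// /funrpos ge_max ler_norm normr_ge0.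
have hn : L1 nu phi^\-.
  apply: (L1_le _ (L1_abs hphi)); first exact: measurable_funrneg.
  by move=> x; rewrite ger0_norm ?funrneg_ge0// /funrneg ge_max normr_ge0 -normrN ler_norm.
have hL (u : R -> R) : measurable_fun setT u -> (forall x, 0 <= u x) -> L1 nu u ->
    lam.-integrable setT (EFin \o (fun x => u x * g x)).
  move=> mu u0 hu; apply/integrableP; split.
    by apply/measurable_EFinP; exact: measurable_funM.
  rewrite (_ : integral _ _ _ = \int[lam]_x (u x * g x)%:E)%E.
    by rewrite -ge0_nuE// EFin_E// ltry.
  by apply: eq_integral => x _ /=; rewrite ger0_norm// mulr_ge0.
have mp : measurable_fun setT phi^\+ by exact: L1_meas hp.
have mn : measurable_fun setT phi^\- by exact: L1_meas hn.
transitivity (\int[nu]_x (phi^\+ x - phi^\- x)).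
  by apply: eq_Rintegral => x _; rewrite -[phi in LHS]funrposBneg.
rewrite EB// /Rintegral (ge0_nuE mp (@funrpos_ge0 _ _ phi))
  (ge0_nuE mn (@funrneg_ge0 _ _ phi)).
rewrite -!/(Rintegral _ _ _) -RintegralB//.
- by apply: eq_Rintegral => x _; rewrite -mulrBl -[phi in RHS]funrposBneg.
- by apply: hL => //; exact: funrpos_ge0.
- by apply: hL => //; exact: funrneg_ge0.
Qed.

Let L1st t c : L1 nu (st t c).
Proof.
apply: (L1_le _ (L1D (L1_cst nu `|t|) (L1_abs normal_L1_id))).
  by apply: measurable_funB; apply: measurable_funM => //; [exact: mcos|exact: msin].
move=> x; rewrite /st (le_trans (ler_normB _ _))// !normrM lerD//.
- by rewrite ler_piMr// cos_max.
- by rewrite ler_piMr// sin_max.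
Qed.

Let cont_g : continuous g. Proof. by apply: continuous_normal_pdf; exact: oner_neq0. Qed.

(** Integration by parts: over [[- n.+1, n.+1]] the integral is a difference of boundary values of
    [sin (t * x + c) * g x], which are O(1/n); dominated convergence gives the whole line. *)
Lemma normal_stein t c :
  \int[nu]_x (t * cos (t * x + c) - x * sin (t * x + c)) = 0.
Proof.
pose F x := sin (t * x + c) * g x.
pose psi n x := if `|x| <= n.+1%:R then st t c x else 0.
have mst : measurable_fun setT (st t c) by exact: (L1_meas (L1st t c)).
have mpsi n : measurable_fun setT (psi n).
  apply: measurable_fun_ifT; [|exact: mst|exact: measurable_cst].
  by apply: measurable_fun_ler => //; exact: measurableT_comp.
have cpsi : (\int[nu]_x psi n x) @[n --> \oo] --> \int[nu]_x st t c x.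
  apply: (@DCT _ _ _ nu _ _ _ mpsi mst (L1_abs (L1st t c))).
    by move=> n x; rewrite /psi; case: ifPn => // _; rewrite normr0.
  apply: aeW => x; apply: cvg_near_cst; near=> n; rewrite /psi ifT//; apply/ltW.
  rewrite (lt_le_trans (truncnS_gt _))// ler_nat ltnS.
  by near: n; exact: nbhs_infty_ge.
suff : (\int[nu]_x psi n x) @[n --> \oo] --> (0 : R).
  move=> c0; transitivity (\int[nu]_x st t c x) => //.
  by rewrite -(cvg_lim _ cpsi)// -(cvg_lim _ c0).
have Fcont : continuous F.
  move=> x; exact/differentiable_continuous/derivable1_diffP/(@ex_derive _ _ _ _ _ _ _ (dst t c x)).
have psiE n : \int[nu]_x psi n x = F n.+1%:R - F (- n.+1%:R).
  rewrite nuE; last first.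
    apply: (@L1_le _ _ _ nu _ _ (mpsi n) (L1_abs (L1st t c))) => x.
    by rewrite /psi; case: ifPn => // _; rewrite normr0.
  pose a : R := n.+1%:R; rewrite -/a.
  have a0 : 0 < a by rewrite ltr0n.
  pose I : set R := `[(- a), a]%classic.
  rewrite /Rintegral (_ : integral _ _ _ =
      \int[lam]_(x in I) (st t c x * g x)%:E)%E; last first.
    rewrite [RHS]integral_mkcond; apply: eq_integral => x _.
    rewrite patchE /psi /I mem_setE in_itv/= -ler_norml.
    by case: ifPn; rewrite ?mul0r.
  rewrite (@continuous_FTC2 _ (fun x => st t c x * g x) F).
  - by rewrite -EFinB.
  - by rewrite -subr_gt0 opprK addr_gt0.
  - apply: continuous_subspaceT => x.
    apply: continuousM; last exact: cont_g.
    have cl : {for x, continuous (fun x => t * x + c)}.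
      by apply: cvgD; [apply: cvgM; [exact: cvg_cst|exact: cvg_id]|exact: cvg_cst].
    apply: cvgB.
      apply: cvgM; first exact: cvg_cst.
      exact: (continuous_comp cl (@continuous_cos R _)).
    apply: cvgM; first exact: cvg_id.
    exact: (continuous_comp cl (@continuous_sin R _)).
  - split.
    + by move=> x _; exact: (@ex_derive _ _ _ _ _ _ _ (dst t c x)).
    + by apply: cvg_at_right_filter; exact: Fcont.
    + by apply: cvg_at_left_filter; exact: Fcont.
  - by move=> x _; rewrite derive1E; exact: (@derive_val _ _ _ _ _ _ _ (dst t c x)).
apply/norm_cvg0P.
apply: (@squeeze_cvgr _ _ _ _ (fun=> 0) (fun n => 2 * normal_peak 1 * harmonic n)).
- apply: nearW => n; rewrite normr_ge0/= psiE (le_trans (ler_normB _ _))//.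
  have gN : g (- n.+1%:R) = g n.+1%:R by rewrite !gE sqrrN.
  rewrite /F !normrM gN (ger0_norm (g_ge0 _)).
  have gh : g n.+1%:R <= normal_peak 1 * harmonic n.
    rewrite gE ler_pM2l ?normal_peak_gt0 ?oner_eq0// mulNr expRN lef_pV2 ?posrE ?expR_gt0 ?ltr0n//.
    apply: le_trans (expR_ge1Dx _); set a := n.+1%:R.
    by have := sqr_ge0 (a - 1); rewrite expr2; nra.
  apply: (@le_trans _ _ (g n.+1%:R + g n.+1%:R)).
    by apply: lerD; rewrite ler_piMl// sin_max.
  by rewrite -mulrA mulr_natl mulr2n lerD.
- exact: cvg_cst.
- rewrite -[X in _ --> X](mulr0 (2 * normal_peak 1)).
  by apply: cvgM; [exact: cvg_cst|exact: cvg_harmonic].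
Unshelve. all: by end_near.
Qed.

(** After differentiation under the integral, [normal_stein] reads C' = - s C, so
    [C s * expR (s ^+ 2 / 2)] is constant. The phase c covers the sine as well. *)
Lemma normal_cos t c : \int[nu]_x cos (t * x + c) = expR (- (t ^+ 2 / 2)) * cos c.
Proof.
pose C (t : R) := \int[nu]_x cos (t * x + c).
have icos s : L1 nu (fun x => cos (s * x + c)).
  by apply: (@L1_bounded _ _ _ nu _ 1 (mcos s c)) => x; exact: cos_max.
have dC (s : R) : is_derive s (1 : R) C (- s * C s).
  have dcos (x y : R) : is_derive x (1 : R) (fun s : R => cos (s * y + c)) (- sin (x * y + c) * y).
    by apply: is_derive_eq; rewrite /GRing.scale/=; ring.
  pose f (s y : R) := cos (s * y + c).
  have p1 (x y : R) : partial1of2 f x y = - sin (x * y + c) * y.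
    by rewrite partial1of2E; exact: (@derive_val _ _ _ _ _ _ _ (dcos x y)).
  have sI : s \in `]s - 1, s + 1[ by rewrite in_itv/=; apply/andP; split; lra.
  have h1 x : x \in `]s - 1, s + 1[ -> nu.-integrable setT (EFin \o f x).
    by move=> _; exact: icos.
  have h2 x y : x \in `]s - 1, s + 1[ -> setT y -> derivable (f ^~ y) x 1.
    by move=> _ _; exact: (@ex_derive _ _ _ _ _ _ _ (dcos x y)).
  have h3 x y : x \in `]s - 1, s + 1[ -> setT y ->
      `|partial1of2 f x y| <= `|y|.
    by move=> _ _; rewrite p1 normrM normrN ler_piMl// sin_max.
  have Cd := derivable_under_integral measurableT sI h1 h2
     (fun y => normr_ge0 y) (L1_abs normal_L1_id) h3.
  have Ce := differentiation_under_integral measurableT sI h1 h2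
     (fun y => normr_ge0 y) (L1_abs normal_L1_id) h3.
  apply: DeriveDef => //; rewrite -derive1E Ce.
  have ixs : L1 nu (fun y => y * sin (s * y + c)).
    apply: (@L1_le _ _ _ nu _ _ _ (L1_abs normal_L1_id)).
      by apply: measurable_funM => //; exact: msin.
    by move=> y; rewrite normrM ler_piMr// sin_max.
  have := normal_stein s c; rewrite EB; [|by apply: L1Z; exact: icos|exact: ixs].
  rewrite EZ; last exact: icos.
  move=> /eqP; rewrite subr_eq0 => /eqP; rewrite mulNr -/(C s) => ->.
  rewrite -mulN1r -EZ; last exact: ixs.
  by apply: eq_Rintegral => y _; rewrite p1; ring.
have dH (s : R) : is_derive s (1 : R) (fun s : R => C s * expR (s ^+ 2 / 2)) 0.
  by apply: is_derive_eq; rewrite /GRing.scale/=; field.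
have H0 := is_derive_0_is_cst t 0 dH.
have C0 : C 0 = cos c.
  rewrite /C -[RHS](E_cst nu); apply: eq_Rintegral => x _.
  by rewrite mul0r add0r.
move: H0; rewrite C0 expr0n/= mul0r expR0 mulr1 => <-.
by rewrite mulrC -mulrA -expRD subrr expR0 mulr1.
Qed.

Lemma normal_sin t : \int[nu]_x sin (t * x) = 0.
Proof.
transitivity (\int[nu]_x cos (t * x + - (pi / 2))).
  by apply: eq_Rintegral => x _; rewrite cosBpihalf.
by rewrite normal_cos cosN cos_pihalf mulr0.
Qed.

End gaussian.

(** * Joint cosine transform of independent Gaussian variables *)

Section independence.
Context d (Y : measurableType d) (R : realType) (P : probability Y R).

Lemma E_indic (G : Y -> R) (A : set Y) : measurable A -> L1 P G ->
  L1 P (fun y => G y * \1_A y) /\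
  (\int[P]_(y in A) (G y)%:E = (\int[P]_y (G y * \1_A y))%:E)%E.
Proof.
move=> mA hG; have iA : L1 P (fun y => G y * \1_A y).
  under eq_fun do rewrite mulrC.
  apply: (@L1_mulb _ _ _ _ _ _ 1) => // y; rewrite indicE.
  by case: (y \in A); rewrite ?normr1// normr0.
split => //; rewrite -EFin_E// integral_mkcond; apply: eq_integral => y _.
by rewrite patchE indicE; case: ifPn; rewrite ?mulr1 ?mulr0.
Qed.

(** The image under [X] of the measure with density [G], and [nu] multiplied by the mean of [G],
    agree on measurable sets, hence integrate [phi] alike. *)
Lemma indep_ge0 (G : Y -> R) (X : Y -> measurableTypeR R) (mX : measurable_fun setT X)
    (nu : probability (measurableTypeR R) R) (phi : R -> R) M :
  (forall y, 0 <= G y) -> L1 P G ->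
  (forall B : set R, measurable B ->
    \int[P]_y (G y * \1_(X @^-1` B) y) = (\int[P]_y G y) * fine (nu B)) ->
  measurable_fun setT phi -> (forall x, 0 <= phi x) -> (forall x, phi x <= M) ->
  \int[P]_y (G y * phi (X y)) = (\int[P]_y G y) * \int[nu]_x phi x.
Proof.
move=> G0 iG hG mphi phi0 phiM.
have EG0 : 0 <= \int[P]_y G y by exact: E_ge0.
pose k : {nonneg R} := NngNum EG0.
have iphi : L1 nu phi.
  by apply: (@L1_bounded _ _ _ nu _ M mphi) => x; rewrite ger0_norm.
have mpre (B : set R) : measurable B -> measurable (X @^-1` B).
  by move=> mB; rewrite -[X in measurable X]setTI; exact: mX.
have e1 := integral_pdens G0 iG mX mphi phi0.
have e2 : (\int[pdens G0 iG mX]_x (phi x)%:E = \int[mscale k nu]_x (phi x)%:E)%E.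
  apply: eq_measure_integral => B mB _.
  rewrite /mscale/= /pdens /pushforward /dens.
  rewrite (E_indic (mpre B mB) iG).2 hG// EFinM.
  by rewrite (fineK (fin_num_measure nu B mB)).
have iGp : L1 P (fun y => phi (X y) * G y).
  apply: (@L1_mulb _ _ _ _ _ _ M) => //; first exact: (measurableT_comp mphi mX).
  by move=> y; rewrite ger0_norm.
transitivity (\int[P]_y (phi (X y) * G y)).
  by apply: eq_Rintegral => y _; rewrite mulrC.
apply: EFin_inj; rewrite -EFin_E// -e1 e2 ge0_integral_mscale//.
- by rewrite EFinM -(EFin_E iphi).
- exact/measurable_EFinP.
- by move=> x _; rewrite lee_fin.
Qed.

(** Adding constants makes [G] and [phi] nonnegative. The extra terms are instances of the same
    factorization with a constant [G], which is where the law of [X] enters. *)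
Lemma indep_bounded (G : Y -> R) (X : Y -> R) (mX : measurable_fun setT X)
    (nu : probability (measurableTypeR R) R) (phi : R -> R) (K M : R) :
  (forall B : set R, measurable B -> P (X @^-1` B) = nu B) ->
  measurable_fun setT G -> (forall y, `|G y| <= K) ->
  (forall B : set R, measurable B ->
    \int[P]_y (G y * \1_(X @^-1` B) y) = (\int[P]_y G y) * fine (nu B)) ->
  measurable_fun setT phi -> (forall x, `|phi x| <= M) ->
  \int[P]_y (G y * phi (X y)) = (\int[P]_y G y) * \int[nu]_x phi x.
Proof.
move=> law mG GK hG mphi phiM.
have M0 : 0 <= M by apply: le_trans (phiM 0).
have K0 : 0 <= K by apply: le_trans (GK point).
have iG : L1 P G by exact: L1_bounded GK.
have iphi : L1 nu phi by exact: (@L1_bounded _ _ _ nu _ M mphi).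
have mpX := measurableT_comp mphi mX.
have ipX : L1 P (fun y => phi (X y)) by apply: (@L1_bounded _ _ _ P _ M) => // y.
have mpre (B : set R) : measurable B -> measurable (X @^-1` B).
  by move=> mB; rewrite -[X in measurable X]setTI; exact: mX.
have GpiL : L1 P (fun y => G y * phi (X y)).
  by apply: (@L1_mulb _ _ _ _ _ _ K).
pose G' y := G y + K; pose phi' x := phi x + M.
have EG' : \int[P]_y G' y = \int[P]_y G y + K.
  by rewrite ED ?E_cst//; exact: L1_cst.
have Ep' : \int[nu]_x phi' x = \int[nu]_x phi x + M.
  by rewrite ED ?E_cst//; exact: (L1_cst nu).
have Indic (B : set R) : measurable B -> \int[P]_y (\1_(X @^-1` B) y : R) = fine (nu B).
  move=> mB; rewrite -law// /Rintegral integral_indic ?setIT//; exact: mpre.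
have c1 y : 0 <= G' y by have := GK y; rewrite ler_norml /G' => /andP[]; lra.
have c2 x : 0 <= phi' x by have := phiM x; rewrite ler_norml /phi' => /andP[]; lra.
have c3 x : phi' x <= M + M by have := phiM x; rewrite ler_norml /phi' => /andP[]; lra.
have hind (C : R) (B : set R) : measurable B -> \int[P]_y (C * \1_(X @^-1` B) y) = C * fine (nu B).
  move=> mB; rewrite EZ ?Indic//.
  by have [+ _] := E_indic (mpre B mB) (L1_cst P 1); under eq_fun do rewrite mul1r.
have mphi' : measurable_fun setT phi' by exact: measurable_funD.
have k1 := @indep_ge0 G' X mX nu phi' (M + M) c1 (L1D iG (L1_cst P K)) _ mphi' c2 c3.
have k2 := @indep_ge0 (fun=> K) X mX nu phi' (M + M) (fun=> K0) (L1_cst P K) _ mphi' c2 c3.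
have {}k1 : \int[P]_y (G' y * phi' (X y)) = (\int[P]_y G y + K) * (\int[nu]_x phi x + M).
  rewrite k1 ?EG' ?Ep'// => B mB.
  have iK : L1 P (fun y => K * \1_(X @^-1` B) y) by have [] := E_indic (mpre B mB) (L1_cst P K).
  transitivity (\int[P]_y (G y * \1_(X @^-1` B) y + K * \1_(X @^-1` B) y)).
    by apply: eq_Rintegral => y _; rewrite mulrDl.
  rewrite ED//; last by have [] := E_indic (mpre B mB) iG.
  by rewrite hG// hind// ?EG' mulrDl.
have {}k2 : \int[P]_y (K * phi' (X y)) = K * (\int[nu]_x phi x + M).
  by rewrite k2 ?E_cst ?Ep'// => B mB; rewrite hind.
have mp'X : measurable_fun setT (fun y => phi' (X y)) by exact: (measurableT_comp mphi' mX).
have i1 : L1 P (fun y => G' y * phi' (X y)).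
  under eq_fun do rewrite mulrC.
  apply: (@L1_mulb _ _ _ _ _ _ (M + M)) => //; last by apply: L1D => //; exact: L1_cst.
  by move=> y; rewrite ger0_norm.
have i2 : L1 P (fun y => K * phi' (X y)).
  by apply: L1Z; apply: (@L1_bounded _ _ _ P _ (M + M)) => // y; rewrite ger0_norm.
have -> : \int[P]_y (G y * phi (X y)) =
    \int[P]_y (G' y * phi' (X y)) - \int[P]_y (K * phi' (X y)) - M * \int[P]_y G y.
  rewrite -EB// -EZ// -EB//; [|exact: L1B|exact: L1Z].
  by apply: eq_Rintegral => y _; rewrite /G' /phi'; ring.
by rewrite k1 k2; ring.
Qed.

Variables (N : option nat) (eta : nat -> {RV P >-> R}).
Hypothesis ind : independent_family (idx N) eta.
Hypothesis law : forall m, idx N m -> forall B : set R, measurable B ->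
  distribution P (eta m) B = normal_prob 0 1 B.

(** Extended by zero, so that every index has a second moment at most 1 and sums run over all
    [m < k]. *)
Definition eta' m y : R := if idx N m then eta m y else 0.

Let meta m : measurable_fun setT (eta m : Y -> R). Proof. exact: measurable_funP. Qed.

Lemma meta' m : measurable_fun setT (eta' m).
Proof. by rewrite /eta'; case: (idx N m). Qed.

Let cyl (s : {fset nat}) (B : nat -> set R) :=
  \bigcap_(m in [set` s]) (eta m @^-1` B m).

Let mpre m (B : set R) : measurable B -> measurable (eta m @^-1` B).
Proof. by move=> mB; rewrite -[X in measurable X]setTI; exact: meta. Qed.

Let mcyl s B : (forall m, m \in s -> measurable (B m)) -> measurable (cyl s B).
Proof.
move=> mB; apply: fin_bigcap_measurable; first exact: finite_fset.
by move=> m /= ms; apply: mpre; exact: mB.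
Qed.

Let linc (t : nat -> R) k c y := \sum_(m < k) t m * eta' m y + c.

Let mlinc t k c : measurable_fun setT (linc t k c).
Proof.
apply: measurable_funD => //; apply: measurable_sum => m.
by apply: measurable_funM => //; exact: meta'.
Qed.

(** The event and the phase are there for the induction on k. An event concerning indices from k on
    only lets the induction hypothesis itself supply the independence of [eta k] from the shorter
    form; the phase lets it treat the sine of that form as a cosine. *)
Lemma gaussian_cyl (t : nat -> R) k c (s : {fset nat}) (B : nat -> set R) :
  (forall m, m \in s -> idx N m && (k <= m)%N) ->
  (forall m, m \in s -> measurable (B m)) ->
  \int[P]_y (cos (linc t k c y) * \1_(cyl s B) y) =
  expR (- (\sum_(m < k | idx N m) t m ^+ 2 / 2)) * cos c *
    \prod_(m <- s) fine (P (eta m @^-1` B m)).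
Proof.
elim: k c s B => [|k IH] c s B hs mB.
  rewrite big_ord0 oppr0 expR0 mul1r.
  have mc := mcyl mB.
  transitivity (\int[P]_y (cos c * \1_(cyl s B) y)).
    by apply: eq_Rintegral => y _; rewrite /linc big_ord0 add0r.
  rewrite EZ; last first.
    by have [+ _] := E_indic mc (L1_cst P 1); under eq_fun do rewrite mul1r.
  congr (_ * _); rewrite /Rintegral integral_indic// setIT.
  transitivity (fine (\prod_(m <- s) P (eta m @^-1` B m))%E).
    by congr fine; apply: ind => // m /hs /andP[].
  apply: EFin_inj; rewrite fineK.
    rewrite -prodEFin; rewrite !big_seq; apply: eq_bigr => m ms.
    by rewrite fineK//; apply: fin_num_measure; apply: mpre; exact: mB.
  rewrite big_seq; apply: prode_fin_num => m ms.
  by apply: fin_num_measure; apply: mpre; exact: mB.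
have hs' m : m \in s -> idx N m && (k <= m)%N.
  by move=> /hs /andP[-> /ltnW].
rewrite big_mkcond big_ord_recr/= -big_mkcond/=.
have [Nk|Nk] := boolP (idx N k); last first.
  rewrite addr0 -IH//; apply: eq_Rintegral => y _.
  by rewrite /linc big_ord_recr/= /eta' (negbTE Nk) mulr0 addr0.
have ks : k \notin s by apply/negP => /hs /andP[_]; rewrite ltnn.
pose G c' y := cos (linc t k c' y) * \1_(cyl s B) y.
have mc' : measurable (cyl s B) by exact: mcyl.
have mcosl c' : measurable_fun setT (fun y => cos (linc t k c' y)).
  exact: (measurableT_comp (continuous_measurable_fun (@continuous_cos R)) (mlinc t k c')).
have mG c' : measurable_fun setT (G c').
  by apply: measurable_funM => //; exact: measurable_indic.
have GK c' y : `|G c' y| <= 1.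
  rewrite /G normrM indicE; case: (_ \in _); rewrite ?normr1 ?normr0 ?mulr0 ?mulr1 ?cos_max//.
(* The factorization required by [indep_bounded]: the event on [eta k] is absorbed into the
   cylinder, which in the induction hypothesis may involve the index k. *)
have hG c' (B0 : set R) : measurable B0 ->
    \int[P]_y (G c' y * \1_(eta k @^-1` B0) y) =
    (\int[P]_y G c' y) * fine ((normal_prob 0 1 : probability (measurableTypeR R) R) B0).
  move=> mB0.
  pose B' m := if m == k then B0 else B m.
  have B'E m : m \in s -> B' m = B m.
    by rewrite /B'; case: eqP => // -> ks'; rewrite ks' in ks.
  have cylE : cyl s B `&` (eta k @^-1` B0) = cyl (k |` s)%fset B'.
    apply/seteqP; split => y /=.
      move=> [h1 h2] m /=; rewrite !inE => /orP[/eqP ->|ms]; first by rewrite /B' eqxx.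
      by rewrite B'E//; exact: h1.
    move=> h; split.
      by move=> m /= ms; have := h m; rewrite B'E//; apply; rewrite /= !inE ms orbT.
    by have := h k; rewrite /B' eqxx; apply; rewrite /= !inE eqxx.
  transitivity (\int[P]_y (cos (linc t k c' y) * \1_(cyl (k |` s)%fset B') y)).
    apply: eq_Rintegral => y _; rewrite -cylE /G -mulrA; congr (_ * _).
    by rewrite indicI.
  rewrite /G !IH//; last 2 first.
  - by move=> m; rewrite !inE => /orP[/eqP ->|/hs']; rewrite ?Nk ?leqnn.
  - by move=> m; rewrite !inE /B'; case: eqP => // _ /= /mB.
  rewrite big_fsetU1//= -!mulrA; congr (_ * (_ * _)).
  rewrite mulrC; congr (_ * _).
    by rewrite !big_seq; apply: eq_bigr => m ms; rewrite B'E.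
  by rewrite /B' eqxx -(law Nk mB0).
have lawk (B0 : set R) : measurable B0 -> P (eta k @^-1` B0) =
    (normal_prob 0 1 : probability (measurableTypeR R) R) B0.
  by move=> mB0; exact: (law Nk mB0).
have mcosR : measurable_fun setT (fun x : R => cos (t k * x + 0)).
  apply: (measurableT_comp (continuous_measurable_fun (@continuous_cos R))).
  by apply: measurable_funD => //; exact: measurable_funM.
have msinR : measurable_fun setT (fun x : R => sin (t k * x)).
  apply: (measurableT_comp (continuous_measurable_fun (@continuous_sin R))).
  exact: measurable_funM.
have k1 := indep_bounded (meta k) lawk (mG c) (GK c) (hG c) mcosR (fun x => cos_max _).
have k2 := indep_bounded (meta k) lawk (mG (c - pi / 2)) (GK _) (hG _) msinR (fun x => sin_max _).
rewrite normal_cos cos0 mulr1 in k1; rewrite normal_sin mulr0 in k2.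
have iG c' (U : R -> R) : measurable_fun setT U -> (forall x, `|U x| <= 1) ->
    L1 P (fun y => G c' y * U (eta k y)).
  move=> mU U1; apply: (@L1_mulb _ _ _ _ _ _ 1) => //.
  by apply: (@L1_bounded _ _ _ P _ 1) => //; exact: (measurableT_comp mU (meta k)).
(* Addition formula, with the sine of the shorter form written as a cosine of phase [c - pi / 2];
   its companion, the sine of [t k * eta k], has mean zero. *)
transitivity (\int[P]_y (G c y * cos (t k * eta k y + 0)) -
    \int[P]_y (G (c - pi / 2) y * sin (t k * eta k y))).
  rewrite -EB.
  - have ek y : eta' k y = eta k y by rewrite /eta' Nk.
    apply: eq_Rintegral => y _; rewrite /G /linc big_ord_recr/= ek addr0.
    set a := \sum_(_ < _) _; rewrite [a + (c - _)]addrA cosBpihalf.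
    by rewrite addrAC cosD; ring.
  - exact: (iG c (fun x => cos (t k * x + 0)) mcosR (fun x => cos_max _)).
  - exact: (iG _ (fun x => sin (t k * x)) msinR (fun x => sin_max _)).
rewrite k1 k2 subr0 /G IH// opprD expRD; ring.
Qed.

Lemma gaussian_cos (t : nat -> R) k :
  \int[P]_y cos (\sum_(m < k) t m * eta' m y) =
  expR (- (\sum_(m < k | idx N m) t m ^+ 2 / 2)).
Proof.
have h0 m : m \in (fset0 : {fset nat}) -> False by [].
have := @gaussian_cyl t k 0 fset0 (fun=> setT).
rewrite big_seq_fset0 cos0 !mulr1 => <-//.
apply: eq_Rintegral => y _; rewrite /linc addr0 /cyl.
by rewrite (_ : bigcap _ _ = setT) ?indicT ?mulr1//; apply/seteqP; split.
Qed.

(** Fatou's lemma for [2 / a ^+ 2 * (1 - cos (a * eta))] as a tends to 0: the means are at most 1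
    because [expR (- x) >= 1 - x]. *)
Lemma gaussian_moment m : L1 P (fun y => eta' m y ^+ 2) /\
  \int[P]_y (eta' m y ^+ 2) <= 1.
Proof.
pose a n : R := (n.+1%:R)^-1.
have a0 n : 0 < a n by rewrite invr_gt0.
pose F n y := 2 / a n ^+ 2 * (1 - cos (a n * eta' m y)).
have mF n : measurable_fun setT (fun y => cos (a n * eta' m y)).
  apply: (measurableT_comp (continuous_measurable_fun (@continuous_cos R))).
  by apply: measurable_funM => //; exact: meta'.
have icos n : L1 P (fun y => cos (a n * eta' m y)).
  by apply: (@L1_bounded _ _ _ P _ 1) => // y; exact: cos_max.
have i1c n : L1 P (fun y => 1 - cos (a n * eta' m y)) by apply: L1B => //; exact: L1_cst.
have a2 n : 0 <= 2 / a n ^+ 2 by rewrite divr_ge0// sqr_ge0.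
have Ecos n : 1 - a n ^+ 2 / 2 <= \int[P]_y cos (a n * eta' m y).
  have := gaussian_cos (fun i => if i == m then a n else 0) m.+1.
  rewrite (_ : Rintegral _ _ _ = \int[P]_y cos (a n * eta' m y)); last first.
    apply: eq_Rintegral => y _; rewrite big_ord_recr/= eqxx big1 ?add0r// => i _.
    by rewrite ifN ?mul0r// neq_ltn ltn_ord.
  move=> ->; apply: le_trans (expR_ge1Dx _); rewrite lerD2l lerN2.
  rewrite big_mkcond big_ord_recr/= eqxx big1 ?add0r => [|i _].
    by case: ifP => // _; rewrite divr_ge0// sqr_ge0.
  have im : (i == m :> nat) = false by apply/negbTE; rewrite neq_ltn ltn_ord.
  by rewrite im expr0n/= mul0r if_same.
have [] := @fatou_L1 _ _ _ P F (fun y => eta' m y ^+ 2) 1.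
- by move=> n; exact: L1Z.
- by move=> n y; rewrite mulr_ge0// subr_ge0 cos_le1.
- move=> n; rewrite EZ// EB ?E_cst//; last exact: L1_cst.
  rewrite -ler_pdivlMl ?divr_gt0 ?exprn_gt0// mulr1 invfM invrK.
  by have := Ecos n; lra.
- by apply: measurable_funX; exact: meta'.
- apply: aeW => y; set x := eta' m y.
  have h n : `|F n y - x ^+ 2| <= 2 * x ^+ 2 * `|x| * a n.
    have -> : F n y - x ^+ 2 = - (2 / a n ^+ 2 * (cos (a n * x) - 1 + (a n * x) ^+ 2 / 2)).
      by rewrite /F; field; rewrite gt_eqF.
    rewrite normrN normrM (ger0_norm (a2 n)).
    have b1 := cos_taylor (a n * x).
    have b2 := min1_le (a n * x); rewrite normrM (gtr0_norm (a0 n)) in b2.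
    apply: (le_trans (ler_wpM2l (a2 n) b1)).
    rewrite exprMn (_ : 2 / a n ^+ 2 * (a n ^+ 2 * x ^+ 2 * min1 (a n * x)) =
      2 * x ^+ 2 * min1 (a n * x)); last by field; rewrite gt_eqF.
    by rewrite -[leRHS]mulrA; apply: ler_wpM2l; [rewrite mulr_ge0 // sqr_ge0|rewrite (mulrC `|x|)].
  apply/subr_cvg0/norm_cvg0P.
  apply: (@squeeze_cvgr _ _ _ _ (fun=> 0) (fun n => 2 * x ^+ 2 * `|x| * a n)).
  + by apply: nearW => n; rewrite normr_ge0 h.
  + exact: cvg_cst.
  + rewrite -[X in _ --> X](mulr0 (2 * x ^+ 2 * `|x|)).
    by apply: cvgM; [exact: cvg_cst|exact: cvg_harmonic].
move=> i2 h; split => //; apply: le_trans h; rewrite le_eqVlt; apply/orP; left.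
by apply/eqP/eq_Rintegral => y _; rewrite ger0_norm// sqr_ge0.
Qed.

End independence.

(** * Kernels and the projective norm *)

Section product_space.
Context d (X : measurableType d) (R : realType) (mu : probability X R).
Local Notation mu2 := ((mu \x mu)%E : probability _ R).
Implicit Types (a b : X -> R).

Lemma L1_tens a b : L1 mu a -> L1 mu b -> L1 mu2 (tens a b) /\
  \int[mu2]_z tens a b z = (\int[mu]_x a x) * \int[mu]_x b x.
Proof.
move=> ha hb; have ma := L1_meas ha; have mb := L1_meas hb.
have mt : measurable_fun setT (fun z => (tens a b z)%:E).
  apply/measurable_EFinP; apply: measurable_funM.
    exact: (measurableT_comp ma measurable_fst).
  exact: (measurableT_comp mb measurable_snd).
have it : L1 mu2 (tens a b).
  apply/integrable12ltyP => //.
  rewrite (_ : integral _ _ _ = \int[mu]_x (`|a x| * \int[mu]_y `|b y|)%:E)%E.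
    rewrite EFin_E ?ltry//; under eq_fun do rewrite mulrC.
    by apply: L1Z; exact: L1_abs.
  apply: eq_integral => x _ /=; rewrite /tens/=.
  rewrite -EZ; last exact: L1_abs.
  rewrite -EFin_E; last by apply: L1Z; exact: L1_abs.
  by apply: eq_integral => y _; rewrite normrM.
split => //; apply: EFin_inj; rewrite -EFin_E//.
rewrite -(@integral12_prod_meas1 _ _ _ _ _ mu mu (EFin \o tens a b) it).
rewrite /fubini_F/= (_ : integral _ _ _ = \int[mu]_x (a x * \int[mu]_y b y)%:E)%E.
  rewrite EFin_E; last by under eq_fun do rewrite mulrC; apply: L1Z.
  by congr EFin; under eq_Rintegral do rewrite mulrC; rewrite EZ// mulrC.
apply: eq_integral => x _; rewrite /tens/= -EZ// -EFin_E//; exact: L1Z.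
Qed.

Lemma L2_tens a b : L2 mu a -> L2 mu b -> L2 mu2 (tens a b).
Proof.
move=> ha hb; apply/L2P; split.
  apply: measurable_funM.
    exact: (measurableT_comp (L2_meas ha) measurable_fst).
  exact: (measurableT_comp (L2_meas hb) measurable_snd).
have [+ _] := L1_tens (L2_sqr ha) (L2_sqr hb).
by rewrite (_ : tens _ _ = fun z => tens a b z ^+ 2)//; apply/funext => z; rewrite /tens exprMn.
Qed.

Lemma ip_tens a b a' b' : L2 mu a -> L2 mu b -> L2 mu a' -> L2 mu b' ->
  ip mu2 (tens a b) (tens a' b') = ip mu a a' * ip mu b b'.
Proof.
move=> ha hb ha' hb'; have [_ <-] := L1_tens (L2_mul ha ha') (L2_mul hb hb').
by apply: eq_Rintegral => z _; rewrite /tens mulrACA.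
Qed.

Lemma nrm_tens a b : L2 mu a -> L2 mu b -> nrm mu2 (tens a b) = nrm mu a * nrm mu b.
Proof. by move=> ha hb; rewrite /nrm ip_tens// sqrtrM// ip_ge0. Qed.

Definition prod_map (S1 S2 : X -> X) (z : X * X) := (S1 z.1, S2 z.2).

Definition swp (z : X * X) := (z.2, z.1).

Lemma mp_prod S1 S2 : measure_preserving mu S1 -> measure_preserving mu S2 ->
  measure_preserving mu2 (prod_map S1 S2).
Proof.
move=> [m1 h1] [m2 h2].
have mS : measurable_fun setT (prod_map S1 S2).
  apply: measurable_fun_pair.
    exact: (measurableT_comp m1 measurable_fst).
  exact: (measurableT_comp m2 measurable_snd).
split => // A mA; apply/esym.
apply: (@product_measure_unique _ _ _ _ _ mu mu (pushforward mu2 (prod_map S1 S2))) => //.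
move=> B C mB mC.
transitivity ((mu \x mu)%E ((S1 @^-1` B) `*` (S2 @^-1` C))); first by [].
have mB' : measurable (S1 @^-1` B) by rewrite -[Z in measurable Z]setTI; exact: m1.
have mC' : measurable (S2 @^-1` C) by rewrite -[Z in measurable Z]setTI; exact: m2.
by rewrite product_measure1E//; congr (_ * _)%E; [exact: h1|exact: h2].
Qed.

Lemma mp_swp : measure_preserving mu2 swp.
Proof.
have mS : measurable_fun setT swp.
  by apply: measurable_fun_pair; [exact: measurable_snd|exact: measurable_fst].
split => // A mA; apply/esym.
apply: (@product_measure_unique _ _ _ _ _ mu mu (pushforward mu2 swp)) => //.
move=> B C mB mC.
transitivity ((mu \x mu)%E (C `*` B)).
  by congr ((mu \x mu)%E _); apply/seteqP; split => z [].
by rewrite product_measure1E// muleC.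
Qed.

Lemma L2_section (f : X * X -> R) : L2 mu2 f -> {ae mu, forall y, L2 mu (fun x => f (x, y))}.
Proof.
move=> hf; have := @ae_integrable2 _ _ _ _ _ mu mu _ (L2_sqr hf).
apply: filterS => y hy; apply/L2P; split => //.
exact: (measurable_fun_pair1 y (L2_meas hf)).
Qed.

Lemma measurable_fubini_section (f : X * X -> R) : L1 mu2 f ->
  measurable_fun setT (fun y => (\int[mu]_x (f (x, y))%:E)%E).
Proof. by move=> hf; exact: (@measurable_fubini_G _ _ _ _ _ mu mu _ hf). Qed.

(** Fubini: for almost every y the section of [phi] at y is square integrable, and the one-variable
    adjoint identity applies to it. All kernels [phi] are covered because the adjoint on the product
    is tested against all of them. *)
Lemma adj_tensl S a b (phi : X * X -> R) : measure_preserving mu S ->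
  L2 mu a -> L2 mu b -> L2 mu2 phi ->
  ip mu2 (fun z => phi (S z.1, z.2)) (tens a b) = ip mu2 phi (tens (adj mu S a) b).
Proof.
move=> hS ha hb hphi.
have hid : measure_preserving mu id by split => //; exact: measurable_id.
have hphiS : L2 mu2 (fun z => phi (S z.1, z.2)) by exact: (mp_L2 (mp_prod hS hid) hphi).
have haS := adj_L2 hS ha.
have i1 := L2_mul hphiS (L2_tens ha hb).
have i2 := L2_mul hphi (L2_tens haS hb).
rewrite /ip /Rintegral; congr fine.
rewrite -(@integral21_prod_meas1 _ _ _ _ _ mu mu _ i1).
rewrite -(@integral21_prod_meas1 _ _ _ _ _ mu mu _ i2).
apply: ae_eq_integral => //.
- exact: (measurable_fubini_section i1).
- exact: (measurable_fubini_section i2).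
apply: filterS (L2_section hphi) => y hy _; rewrite /fubini_G /tens/=.
have e (u v : X -> R) : L2 mu u -> L2 mu v ->
    (\int[mu]_x (u x * (v x * b y))%:E = (b y * ip mu u v)%:E)%E.
  move=> hu hv; rewrite /ip -EZ; last exact: L2_mul.
  rewrite -EFin_E; last by apply: L1Z; exact: L2_mul.
  by apply: eq_integral => x _; congr EFin; ring.
rewrite (e (fun x => phi (S x, y)) a (mp_L2 hS hy) ha) (e (fun x => phi (x, y)) _ hy haS).
by rewrite (ip_adj hS ha hy).
Qed.

Lemma ip_canonical (f : X * X -> R) b : L2 mu2 f -> L2 mu b ->
  {ae mu, forall y, (\int[mu]_z (f (z, y))%:E = 0)%E} ->
  ip mu2 f (tens (fun=> 1) b) = 0.
Proof.
move=> hf hb f0.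
have i1 := L2_mul hf (L2_tens (L2_cst mu 1) hb).
rewrite /ip /Rintegral -(@integral21_prod_meas1 _ _ _ _ _ mu mu _ i1).
rewrite (_ : integral _ _ _ = \int[mu]_x 0)%E; first by rewrite integral0.
apply: ae_eq_integral => //.
  exact: (measurable_fubini_section i1).
apply: filterS2 f0 (L2_section hf) => y fy hy _; rewrite /fubini_G /tens/=.
transitivity (\int[mu]_x ((b y)%:E * (f (x, y))%:E))%E.
  by apply: eq_integral => x _; rewrite -EFinM mul1r mulrC.
by rewrite integralZl ?fy ?mule0//; exact: (L2_L1 hy).
Qed.

End product_space.

(** * Upper bounds for the projective norm *)

Section projective_norm.
Context d (X : measurableType d) (R : realType) (mu : probability X R).
Local Notation mu2 := ((mu \x mu)%E : probability _ R).
Implicit Types (a b : X -> R) (f g u v : X * X -> R) (c e : R).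

(* [acost u c] bounds the cost of a representation of the algebraic tensor u, and
   [piB f c] bounds the projective norm of f; see [alg_pi_norm_lt], [pi_norm_lt] and
   [piB_pi_norm] for the correspondence with the norms. *)
Definition acost u c := L2 mu2 u /\ exists n (a b : 'I_n -> X -> R),
  is_tensor_rep mu a b u /\ \sum_(k < n) nrm mu (a k) * nrm mu (b k) <= c.

Lemma acost_L2 u c : acost u c -> L2 mu2 u.
Proof. by case. Qed.

Lemma acost_le u c c' : c <= c' -> acost u c -> acost u c'.
Proof.
move=> cc [hu [n [a [b [hr hc]]]]]; split => //; exists n, a, b; split => //.
exact: le_trans cc.
Qed.

Lemma acost_ae u v c : L2 mu2 v -> u = v %[ae mu2] -> acost u c -> acost v c.
Proof.
move=> hv uv [hu [n [a [b [[hab hr] hc]]]]]; split => //; exists n, a, b; split => //.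
by split => //; apply: filterS2 uv hr => z h1 h2 t; rewrite -h1// h2.
Qed.

Lemma acost_tens a b : L2 mu a -> L2 mu b -> acost (tens a b) (nrm mu a * nrm mu b).
Proof.
move=> ha hb; split; first exact: L2_tens.
exists 1%N, (fun=> a), (fun=> b); split; last by rewrite big_ord1.
by split => //; apply: aeW => z _; rewrite big_ord1.
Qed.

Lemma acost_cst0 : acost (fun=> 0) 0.
Proof.
split; first exact: L2_cst.
exists 0%N, (fun=> fun=> 0), (fun=> fun=> 0); split; last by rewrite big_ord0.
by split; [case|apply: aeW => z _; rewrite big_ord0].
Qed.

Lemma acostD u v c c' : acost u c -> acost v c' -> acost (fun z => u z + v z) (c + c').
Proof.
move=> [hu [n [a [b [[hab hr] hc]]]]] [hv [m [a' [b' [[hab' hr'] hc']]]]].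
split; first exact: L2D.
pose a2 (k : 'I_(n + m)) := match fintype.split k with inl i => a i | inr j => a' j end.
pose b2 (k : 'I_(n + m)) := match fintype.split k with inl i => b i | inr j => b' j end.
have al i : a2 (lshift m i) = a i by rewrite /a2 (unsplitK (inl i)).
have ar i : a2 (rshift n i) = a' i by rewrite /a2 (unsplitK (inr i)).
have bl i : b2 (lshift m i) = b i by rewrite /b2 (unsplitK (inl i)).
have br i : b2 (rshift n i) = b' i by rewrite /b2 (unsplitK (inr i)).
exists (n + m)%N, a2, b2; split; [split|].
- by move=> k; rewrite /a2 /b2; case: (fintype.split k) => i; [exact: hab|exact: hab'].
- apply: filterS2 hr hr' => z h1 h2 t; rewrite h1// h2// big_split_ord/=.
  by congr (_ + _); apply: eq_bigr => i _; rewrite ?al ?bl ?ar ?br.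
- rewrite big_split_ord/= lerD//.
  + by under eq_bigr do rewrite al bl.
  + by under eq_bigr do rewrite ar br.
Qed.

Lemma acostZ s u c : acost u c -> acost (fun z => s * u z) (`|s| * c).
Proof.
move=> [hu [n [a [b [[hab hr] hc]]]]]; split; first exact: L2Z.
exists n, (fun k x => s * a k x), b; split; [split|].
- by move=> k; have [ha hb] := hab k; split => //; exact: L2Z.
- apply: filterS hr => z h t; rewrite h// mulr_sumr; apply: eq_bigr => k _.
  by rewrite /tens mulrA.
- rewrite (eq_bigr (fun k => `|s| * (nrm mu (a k) * nrm mu (b k)))); last first.
    by move=> k _; have [ha hb] := hab k; rewrite nrmZ// mulrA.
  by rewrite -mulr_sumr ler_wpM2l.
Qed.

Lemma acost_sum I (s : seq I) (P : pred I) (F : I -> X * X -> R) (c : I -> R) :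
  (forall i, P i -> acost (F i) (c i)) ->
  acost (fun z => \sum_(i <- s | P i) F i z) (\sum_(i <- s | P i) c i).
Proof.
move=> h; elim: s => [|i s IH].
  rewrite big_nil (_ : (fun z => _) = fun=> 0); first exact: acost_cst0.
  by apply/funext => z; rewrite big_nil.
rewrite big_cons (_ : (fun z => _) = (fun z => if P i then F i z +
  \sum_(i <- s | P i) F i z else \sum_(i <- s | P i) F i z)); last first.
  by apply/funext => x; rewrite big_cons.
by case: (boolP (P i)) => Pi //; apply: acostD => //; exact: h.
Qed.

Lemma nrm_acost u c : acost u c -> nrm mu2 u <= c.
Proof.
move=> [hu [n [a [b [[hab hr] hc]]]]]; apply: le_trans hc.
have ht k : L2 mu2 (tens (a k) (b k)) by have [] := hab k; exact: L2_tens.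
rewrite (nrm_ae hu _ hr); last by apply: L2_sum => k _.
apply: (le_trans (nrm_sum _ _)) => //.
apply: ler_sum => k _; have [ha hb] := hab k; by rewrite nrm_tens.
Qed.

Let costE n (a b : 'I_n -> X -> R) u : is_tensor_rep mu a b u ->
  (\sum_(k < n) 'N[mu]_2%:E[EFin \o a k] * 'N[mu]_2%:E[EFin \o b k])%E =
  (\sum_(k < n) nrm mu (a k) * nrm mu (b k))%:E.
Proof.
move=> [hab _]; rewrite -sumEFin; apply: eq_bigr => k _.
by have [ha hb] := hab k; rewrite !LnormE.
Qed.

Lemma alg_tensorP u : alg_tensor mu u <-> exists c, acost u c.
Proof.
split=> [[hu [n [a [b hr]]]]|[c [hu [n [a [b [hr _]]]]]]].
  by exists (\sum_(k < n) nrm mu (a k) * nrm mu (b k)); split => //; exists n, a, b.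
by split => //; exists n, a, b.
Qed.

Lemma acost_alg_pi_norm u c : acost u c -> (alg_pi_norm mu u <= c%:E)%E.
Proof.
move=> [hu [n [a [b [hr hc]]]]].
apply: (@le_trans _ _ (\sum_(k < n) nrm mu (a k) * nrm mu (b k))%:E); last by rewrite lee_fin.
by apply: ereal_inf_lbound; exists n, a, b; split => //; rewrite (costE hr).
Qed.

Lemma alg_pi_norm_lt u c : L2 mu2 u -> (alg_pi_norm mu u < c%:E)%E -> acost u c.
Proof.
move=> hu /ereal_inf_lt[_ [n [a [b [hr ->]]]]].
rewrite (costE hr) lte_fin => /ltW hc.
by split => //; exists n, a, b.
Qed.

Lemma alg_pi_norm_ge0 u : (0 <= alg_pi_norm mu u)%E.
Proof.
apply: le_ereal_inf_tmp => _ [n [a [b [hr ->]]]].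
by apply: sume_ge0 => k _; rewrite mule_ge0// Lnorm_ge0.
Qed.

Definition piB f c := L2 mu2 f /\ exists u : nat -> X * X -> R,
  [/\ forall n, acost (u n) c,
      forall e, 0 < e -> exists N, forall p q, (N <= p)%N -> (N <= q)%N ->
        acost (fun z => u p z - u q z) e &
      nrm mu2 (fun z => u n z - f z) @[n --> \oo] --> (0 : R)].

Lemma piB_L2 f c : piB f c -> L2 mu2 f. Proof. by case. Qed.

Lemma acost_piB u c : acost u c -> piB u c.
Proof.
move=> hu; have hL := acost_L2 hu; split => //; exists (fun=> u); split => //.
- move=> e e0; exists 0%N => p q _ _; under eq_fun do rewrite subrr.
  by apply: acost_le acost_cst0; exact: ltW.
- rewrite (_ : (fun n => _) = fun=> 0); first exact: cvg_cst.
  apply/funext => n; under eq_fun do rewrite subrr.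
  by rewrite /nrm /ip; under eq_Rintegral do rewrite mulr0; rewrite E_cst sqrtr0.
Qed.

Lemma piB_ae f g c : L2 mu2 g -> f = g %[ae mu2] -> piB f c -> piB g c.
Proof.
move=> hg fg [hf [u [h1 h2 h3]]]; split => //; exists u; split => //.
rewrite (_ : (fun n => _) = (fun n => nrm mu2 (fun z => u n z - f z)))//.
apply/funext => n; have hu := acost_L2 (h1 n); apply: nrm_ae; [exact: L2B..|].
by apply: filterS fg => z h t; rewrite h.
Qed.

Lemma piBD f g c c' : piB f c -> piB g c' -> piB (fun z => f z + g z) (c + c').
Proof.
move=> [hf [u [h1 h2 h3]]] [hg [v [k1 k2 k3]]]; split; first exact: L2D.
exists (fun n z => u n z + v n z); split.
- by move=> n; exact: acostD.
- move=> e e0; have e2 : 0 < e / 2 by rewrite divr_gt0.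
  have [N1 hN1] := h2 _ e2; have [N2 hN2] := k2 _ e2; exists (N1 + N2)%N => p q Np Nq.
  rewrite (splitr e).
  have := acostD (hN1 p q (leq_trans (leq_addr _ _) Np) (leq_trans (leq_addr _ _) Nq))
    (hN2 p q (leq_trans (leq_addl _ _) Np) (leq_trans (leq_addl _ _) Nq)).
  rewrite (_ : (fun z => _) = (fun z => u p z + v p z - (u q z + v q z)))//.
  by apply/funext => z; ring.
- apply: (@squeeze_cvgr _ _ _ _ (fun=> 0) (fun n =>
    nrm mu2 (fun z => u n z - f z) + nrm mu2 (fun z => v n z - g z))).
  + apply: nearW => n; rewrite nrm_ge0/=.
    have hu := acost_L2 (h1 n); have hv := acost_L2 (k1 n).
    rewrite (_ : (fun z => u n z + v n z - (f z + g z)) =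
      (fun z => (u n z - f z) + (v n z - g z))); last by apply/funext => z; ring.
    exact: (nrmD (L2B hu hf) (L2B hv hg)).
  + exact: cvg_cst.
  + by rewrite -[X in _ --> X](addr0 (0 : R)); exact: cvgD.
Qed.

Lemma piBZ s f c : piB f c -> piB (fun z => s * f z) (`|s| * c).
Proof.
move=> [hf [u [h1 h2 h3]]]; split; first exact: L2Z.
exists (fun n z => s * u n z); split.
- by move=> n; exact: acostZ.
- move=> e e0; have e2 : 0 < e / (`|s| + 1) by rewrite divr_gt0// ltr_wpDl.
  have [N hN] := h2 _ e2; exists N => p q Np Nq.
  apply: (@acost_le _ (`|s| * (e / (`|s| + 1)))).
    rewrite mulrA ler_pdivrMr ?ltr_wpDl// mulrC.
    by apply: ler_wpM2l; rewrite ?lerDl// ltW.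
  have := acostZ s (hN p q Np Nq).
  by under eq_fun do rewrite mulrBr.
- rewrite (_ : (fun n => _) = (fun n => `|s| * nrm mu2 (fun z => u n z - f z))).
    by rewrite -[X in _ --> X](mulr0 `|s|); apply: cvgM => //; exact: cvg_cst.
  apply/funext => n; have hu := acost_L2 (h1 n).
  by rewrite -nrmZ; [congr nrm; apply/funext => z; rewrite mulrBr|exact: L2B].
Qed.

Lemma Lnorm_cvg0 (u : nat -> X * X -> R) f : (forall n, L2 mu2 (u n)) -> L2 mu2 f ->
  ('N[mu2]_2%:E[EFin \o (u n \- f)%R]%E @[n --> \oo] --> 0%E) <->
  (nrm mu2 (fun z => u n z - f z) @[n --> \oo] --> (0 : R)).
Proof.
move=> hu hf.
have e n : 'N[mu2]_2%:E[EFin \o (u n \- f)%R]%E = (nrm mu2 (fun z => u n z - f z))%:E.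
  by rewrite LnormE//; exact: (L2B (hu n) hf).
rewrite (funext e); split => [/fine_cvgP[_ h]|h]; first exact: h.
by apply/fine_cvgP; split; [exact: nearW|exact: h].
Qed.

Lemma pi_representsP (u : nat -> X * X -> R) f : L2 mu2 f -> pi_represents mu u f ->
  [/\ forall n, exists c, acost (u n) c,
      forall e, 0 < e -> exists N, forall p q, (N <= p)%N -> (N <= q)%N ->
        acost (fun z => u p z - u q z) e &
      nrm mu2 (fun z => u n z - f z) @[n --> \oo] --> (0 : R)].
Proof.
move=> hf [h1 h2 h3]; have hu n : L2 mu2 (u n) by have [] := h1 n.
split; [by move=> n; apply/alg_tensorP|move=> e e0|exact/Lnorm_cvg0].
have e0' : (0 < e%:E)%E by rewrite lte_fin.
have := h2 [set x | (x < e%:E)%E] (open_ereal_lt' e0').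
move=> [[A B] /= [[N1 _ hA] [N2 _ hB]] hAB]; exists (maxn N1 N2) => p q.
rewrite !geq_max => /andP[p1 p2] /andP[q1 q2].
apply: alg_pi_norm_lt; first exact: L2B.
by apply: (hAB (p, q)); split; [exact: hA|exact: hB].
Qed.

(** Beyond the Cauchy index for 1, every term costs at most 1 more than one fixed term. *)
Lemma L2pi_piB f : L2pi mu f -> exists c, piB f c.
Proof.
move=> [hf [u /(pi_representsP hf)[h1 h2 h3]]].
have [N hN] := h2 1 ltr01; have [c hc] := h1 N.
exists (1 + c); split => //; exists (fun n => u (n + N)%N); split.
- move=> n; have := acostD (hN (n + N)%N N (leq_addl _ _) (leqnn _)) hc.
  by under eq_fun do rewrite subrK.
- move=> e /h2[M hM]; exists M => p q Mp Mq; apply: hM; exact: leq_trans (leq_addr _ _).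
- by rewrite (cvg_shiftn N (fun n => nrm mu2 (fun z => u n z - f z))).
Qed.

Lemma pi_norm_lt f c : L2 mu2 f -> (pi_norm mu f < c%:E)%E -> piB f c.
Proof.
move=> hf /ereal_inf_lt[l [u [hr hl]] lc].
have [h1 h2 h3] := pi_representsP hf hr.
have [N _ hN] := hl [set x | (x < c%:E)%E] (open_ereal_lt' lc).
split => //; exists (fun n => u (n + N)%N); split.
- move=> n; have [c' /acost_L2 hu] := h1 (n + N)%N.
  by apply: alg_pi_norm_lt => //; apply: hN; exact: leq_addl.
- move=> e /h2[M hM]; exists M => p q Mp Mq; apply: hM; exact: leq_trans (leq_addr _ _).
- by rewrite (cvg_shiftn N (fun n => nrm mu2 (fun z => u n z - f z))).
Qed.

Lemma piB_represents f c : piB f c -> exists2 u, pi_represents mu u f & forall n, acost (u n) c.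
Proof.
move=> [hf [u [h1 h2 h3]]]; exists u => //; split.
- by move=> n; apply/alg_tensorP; exists c.
- apply/fine_cvgP; split.
    have [N hN] := h2 1 ltr01.
    exists ([set n | (N <= n)%N], [set n | (N <= n)%N]).
      by split; exists N.
    move=> [p q] /= [Np Nq]; rewrite ge0_fin_numE ?alg_pi_norm_ge0//.
    apply: (le_lt_trans (acost_alg_pi_norm (hN p q Np Nq))); exact: ltry.
  apply/cvgrPdist_le => e e0; have [N hN] := h2 e e0.
  exists ([set n | (N <= n)%N], [set n | (N <= n)%N]).
    by split; exists N.
  move=> [p q] /= [Np Nq]; have h := acost_alg_pi_norm (hN p q Np Nq).
  rewrite sub0r normrN ger0_norm ?fine_ge0 ?alg_pi_norm_ge0//.
  rewrite -lee_fin fineK// ge0_fin_numE ?alg_pi_norm_ge0//.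
  by apply: (le_lt_trans h); exact: ltry.
- by apply/Lnorm_cvg0 => // n; exact: acost_L2 (h1 n).
Qed.

(** [pi_norm] only sees sequences whose norms converge. Here they do: by the triangle inequality the
    norms form a Cauchy sequence, and their limit is at most c. *)
Lemma piB_pi_norm f c : piB f c -> (pi_norm mu f <= c%:E)%E.
Proof.
move=> /[dup] hc0 [hf _]; have [u hr h1] := piB_represents hc0.
have [_ h2 _] := pi_representsP hf hr.
pose x n := fine (alg_pi_norm mu (u n)).
have xE n : alg_pi_norm mu (u n) = (x n)%:E.
  rewrite fineK// ge0_fin_numE ?alg_pi_norm_ge0//.
  by apply: (le_lt_trans (acost_alg_pi_norm (h1 n))); exact: ltry.
have xd p q e : acost (fun z => u p z - u q z) e -> x p <= x q + e.
  (* The slack [r] is there because the infimum defining the norm may not be attained. *)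
  move=> h; apply/ler_addgt0Pr => r r0; rewrite -lee_fin -xE.
  have hq : acost (u q) (x q + r).
    by apply: alg_pi_norm_lt; [exact: acost_L2 (h1 q)|rewrite xE lte_fin ltrDl].
  rewrite addrAC addrC; apply: acost_alg_pi_norm.
  have := acostD h hq; by under eq_fun do rewrite subrK.
have cx : cvgn x.
  apply/cauchy_cvgP/cauchyP => e e0; have e2 : 0 < e / 2 by rewrite divr_gt0.
  have [N hN] := h2 _ e2; exists (x N), N => // n /= Nn.
  have k1 := xd _ _ _ (hN n N Nn (leqnn _)); have k2 := xd _ _ _ (hN N n (leqnn _) Nn).
  rewrite /ball/= ltr_distl; apply/andP; split; lra.
have lc : lim (x @ \oo) <= c.
  by apply: limr_le => //; apply: nearW => n; rewrite -lee_fin -xE; exact: acost_alg_pi_norm.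
apply: (@le_trans _ _ (lim (x @ \oo))%:E); last by rewrite lee_fin.
apply: ereal_inf_lbound; exists u; split => //.
rewrite (funext xE); apply/fine_cvgP; split; first exact: nearW.
exact: cx.
Qed.

Lemma piB_L2pi f c : piB f c -> L2pi mu f.
Proof.
by move=> h; split; [exact: piB_L2 h|have [u hu _] := piB_represents h; exists u].
Qed.

Lemma nrm_piB f c : piB f c -> nrm mu2 f <= c.
Proof.
move=> [hf [u [h1 h2 h3]]].
have h4 : c + nrm mu2 (fun z => u n z - f z) @[n --> \oo] --> c.
  by rewrite -[X in _ --> X]addr0; apply: cvgD => //; exact: cvg_cst.
rewrite -(cvg_lim _ h4)//; apply: limr_ge; first by apply/cvg_ex; exists c.
apply: nearW => n; have hu := acost_L2 (h1 n).
rewrite (_ : nrm mu2 f = nrm mu2 (fun z => u n z - (u n z - f z))); last first.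
  by congr nrm; apply/funext => z; ring.
apply: (le_trans (nrmB hu (L2B hu hf))); apply: lerD; last exact: lexx.
exact: (nrm_acost (h1 n)).
Qed.

End projective_norm.

Section adjoint_tensors.
Context d (X : measurableType d) (R : realType) (mu : probability X R).
Local Notation mu2 := ((mu \x mu)%E : probability _ R).
Implicit Types (a b : X -> R) (f g u v : X * X -> R) (c e : R).

Lemma L2_swp f : L2 mu2 f -> L2 mu2 (fun z => f (swp z)).
Proof. exact: (mp_L2 (mp_swp mu)). Qed.

Lemma adj_swp S1 S2 f : measure_preserving mu S1 -> measure_preserving mu S2 -> L2 mu2 f ->
  adj mu2 (prod_map S1 S2) (fun z => f (swp z)) =
  (fun z => adj mu2 (prod_map S2 S1) f (swp z)) %[ae mu2].
Proof.
move=> h1 h2 hf; have h12 := mp_prod h1 h2; have h21 := mp_prod h2 h1.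
have hadj := adj_L2 h21 hf.
apply: adj_uniq => //; [exact: L2_swp|exact: L2_swp|move=> phi hphi].
have hphi' := L2_swp hphi.
transitivity (ip mu2 (fun z => phi (swp (prod_map S2 S1 z))) f).
  exact: (mp_ip (mp_swp mu) (mp_L2 h21 hphi') hf).
rewrite -(ip_adj h21 hf hphi').
by rewrite -(mp_ip (mp_swp mu) hphi' hadj); apply: eq_Rintegral => -[x y] _.
Qed.

Lemma mp_id : measure_preserving mu id.
Proof. by split => //; exact: measurable_id. Qed.

Lemma adj_tens1 S a b : measure_preserving mu S -> L2 mu a -> L2 mu b ->
  adj mu2 (prod_map S id) (tens a b) = tens (adj mu S a) b %[ae mu2].
Proof.
move=> hS ha hb; have haS := adj_L2 hS ha.
apply: (adj_uniq (mp_prod hS mp_id)); [exact: L2_tens|exact: L2_tens|move=> phi hphi].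
exact: adj_tensl.
Qed.

Lemma adj_tens2 S a b : measure_preserving mu S -> L2 mu a -> L2 mu b ->
  adj mu2 (prod_map id S) (tens a b) = tens a (adj mu S b) %[ae mu2].
Proof.
move=> hS ha hb.
have := adj_swp mp_id hS (L2_tens hb ha).
rewrite (_ : (fun z => _) = tens a b); last by apply/funext => z; rewrite /tens mulrC.
have := mp_ae (mp_swp mu) (adj_tens1 hS hb ha).
apply: filterS2 => z h1 h2 t; rewrite h2// h1// /tens/= mulrC//.
Qed.

End adjoint_tensors.

(** * Operators controlled by their values on tensors *)

Section operators.
Context d (X : measurableType d) (R : realType) (mu : probability X R).
Local Notation mu2 := ((mu \x mu)%E : probability _ R).
Implicit Types (a b : X -> R) (f g u v : X * X -> R) (c e C k : R)
  (W : (X * X -> R) -> X * X -> R).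

(** Linearity is asked almost everywhere only, since [adj] picks a representative in each class. *)
Record bounded_op W C : Prop := {
  op_L2 : forall f, L2 mu2 f -> L2 mu2 (W f) ;
  op_lin : forall c f g, L2 mu2 f -> L2 mu2 g ->
    W (fun z => c * f z + g z) = (fun z => c * W f z + W g z) %[ae mu2] ;
  op_nrm : forall f, L2 mu2 f -> nrm mu2 (W f) <= C * nrm mu2 f
}.

Lemma op_ae W C f g : bounded_op W C -> L2 mu2 f -> L2 mu2 g ->
  f = g %[ae mu2] -> W f = W g %[ae mu2].
Proof.
move=> hW hf hg fg.
have hd : L2 mu2 (fun z => -1 * g z + f z) by apply: L2D => //; exact: L2Z.
have : nrm mu2 (W (fun z => -1 * g z + f z)) <= 0.
  apply: (le_trans (op_nrm hW hd)); rewrite (_ : nrm _ _ = 0) ?mulr0//.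
  rewrite (nrm_ae hd (L2_cst mu2 0)); last first.
    by apply: filterS fg => z h t; rewrite h//; ring.
  by rewrite /nrm /ip; under eq_Rintegral do rewrite mulr0; rewrite E_cst sqrtr0.
move=> h; have h0 : nrm mu2 (W (fun z => -1 * g z + f z)) = 0.
  by apply/eqP; rewrite eq_le h nrm_ge0.
have := nrm0_ae (op_L2 hW hd) h0; apply: filterS2 (op_lin hW (-1) hg hf) => z h1 h2 t.
by have := h2 t; rewrite h1// /cst => ?; lra.
Qed.

Lemma op_0 W C : bounded_op W C -> W (fun=> 0) = (fun=> 0) %[ae mu2].
Proof.
move=> hW; have h0 : L2 mu2 (fun=> 0) by exact: L2_cst.
have := op_lin hW (-1) h0 h0.
rewrite (_ : (fun z => _) = (fun=> 0)); last by apply/funext => z; rewrite mulr0 addr0.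
by apply: filterS => z h t; have := h t => {}h; lra.
Qed.

Lemma op_sum W C n (F : 'I_n -> X * X -> R) : bounded_op W C ->
  (forall i, L2 mu2 (F i)) ->
  W (fun z => \sum_(i < n) F i z) = (fun z => \sum_(i < n) W (F i) z) %[ae mu2].
Proof.
move=> hW; elim: n F => [|n IH] F hF.
  rewrite (_ : (fun z => _) = (fun=> 0)); last by apply/funext => z; rewrite big_ord0.
  by apply: filterS (op_0 hW) => z h t; rewrite h// big_ord0.
rewrite (_ : (fun z => _) = (fun z => 1 * F ord0 z + \sum_(i < n) F (lift ord0 i) z)).
  have hs : L2 mu2 (fun z => \sum_(i < n) F (lift ord0 i) z) by apply: L2_sum => i _.
  apply: filterS2 (op_lin hW 1 (hF ord0) hs) (IH (fun i => F (lift ord0 i)) (fun i => hF _)).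
  by move=> z h1 h2 t; rewrite h1// h2// big_ord_recl mul1r.
by apply/funext => z; rewrite big_ord_recl mul1r.
Qed.

Lemma op_comp S : measure_preserving mu2 S -> bounded_op (fun f z => f (S z)) 1.
Proof.
move=> hS; split.
- by move=> f; exact: mp_L2.
- by move=> c f g _ _; exact: aeW.
- by move=> f hf; rewrite mul1r (mp_nrm hS).
Qed.

Lemma op_adj S : measure_preserving mu2 S -> bounded_op (adj mu2 S) 1.
Proof.
move=> hS; split.
- by move=> f; exact: adj_L2.
- by move=> c f g hf hg; exact: adj_lin.
- by move=> f hf; rewrite mul1r; exact: adj_nrm.
Qed.

Lemma op_id : bounded_op id 1.
Proof. by split => // [c f g _ _|f hf]; [exact: aeW|rewrite mul1r]. Qed.

Lemma op_compose W W' C C' : bounded_op W C -> bounded_op W' C' -> 0 <= C ->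
  bounded_op (fun f => W (W' f)) (C * C').
Proof.
move=> h h' C0; split.
- by move=> f /(op_L2 h') /(op_L2 h).
- move=> c f g hf hg; have hf' := op_L2 h' hf; have hg' := op_L2 h' hg.
  have hl : L2 mu2 (fun z => c * f z + g z) by apply: L2D => //; exact: L2Z.
  have hl' : L2 mu2 (fun z => c * W' f z + W' g z) by apply: L2D => //; exact: L2Z.
  apply: filterS2 (op_ae h (op_L2 h' hl) hl' (op_lin h' c hf hg)) (op_lin h c hf' hg').
  by move=> z e1 e2 t; rewrite e1// e2.
- move=> f hf; apply: (le_trans (op_nrm h (op_L2 h' hf))).
  by rewrite -mulrA ler_wpM2l// op_nrm.
Qed.

Lemma op_sub W W' C C' : bounded_op W C -> bounded_op W' C' ->
  bounded_op (fun f z => W f z - W' f z) (C + C').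
Proof.
move=> h h'; split.
- by move=> f hf; apply: L2B; [exact: (op_L2 h)|exact: (op_L2 h')].
- move=> c f g hf hg; apply: filterS2 (op_lin h c hf hg) (op_lin h' c hf hg).
  by move=> z e1 e2 t; rewrite e1// e2//; ring.
- move=> f hf; apply: (le_trans (nrmB (op_L2 h hf) (op_L2 h' hf))).
  by rewrite mulrDl lerD//; [exact: (op_nrm h)|exact: (op_nrm h')].
Qed.

Lemma op_bigsum n (W : 'I_n -> (X * X -> R) -> X * X -> R) C :
  (forall i, bounded_op (W i) C) ->
  bounded_op (fun f z => \sum_(i < n) W i f z) (n%:R * C).
Proof.
move=> h; split.
- by move=> f hf; apply: L2_sum => i _; exact: (op_L2 (h i)).
- move=> c f g hf hg.
  suff : {ae mu2, forall z, forall i : 'I_n, W i (fun z => c * f z + g z) z = c * W i f z + W i g z}.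
    apply: filterS => z e _; rewrite mulr_sumr -big_split; apply: eq_bigr => i _; exact: e.
  by apply: filter_forall => i; apply: filterS (op_lin (h i) c hf hg) => z; apply.
- move=> f hf; apply: (le_trans (nrm_sum _ _)) => [i _|]; first exact: (op_L2 (h i)).
  apply: (@le_trans _ _ (\sum_(i < n) C * nrm mu2 f)).
    by apply: ler_sum => i _; exact: (op_nrm (h i)).
  by rewrite sumr_const card_ord -[leLHS]mulr_natl mulrA.
Qed.

Definition tensor_op W k := forall a b, L2 mu a -> L2 mu b ->
  acost mu (W (tens a b)) (k * (nrm mu a * nrm mu b)).

Lemma op_acost W C k u c : bounded_op W C -> tensor_op W k -> 0 <= k ->
  acost mu u c -> acost mu (W u) (k * c).
Proof.
move=> hW hk k0 [hu [n [a [b [[hab hr] hc]]]]].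
have ht i : L2 mu2 (tens (a i) (b i)) by have [? ?] := hab i; exact: L2_tens.
have hs : L2 mu2 (fun z => \sum_(i < n) tens (a i) (b i) z) by apply: L2_sum => i _.
apply: (@acost_le _ _ _ _ _ (\sum_(i < n) k * (nrm mu (a i) * nrm mu (b i)))).
  by rewrite -mulr_sumr ler_wpM2l.
apply: (@acost_ae _ _ _ _ (fun z => \sum_(i < n) W (tens (a i) (b i)) z)).
- exact: (op_L2 hW).
- apply: filterS2 (op_ae hW hu hs hr) (op_sum hW ht) => z e1 e2 t.
  by rewrite e1// e2.
- by apply: acost_sum => i _; have [? ?] := hab i; exact: hk.
Qed.

(** The constant k keeps the costs of the images of an approximating sequence bounded and makes them
    Cauchy; the L_2 bound C identifies their limit as [W f]. Hence k alone enters the estimate, even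
    when C is as large as n^2. *)
Lemma op_piB W C k f c : bounded_op W C -> tensor_op W k -> 0 <= k ->
  piB mu f c -> piB mu (W f) (k * c).
Proof.
move=> hW hk k0 [hf [u [h1 h2 h3]]]; have hWf := op_L2 hW hf.
have hu n := acost_L2 (h1 n).
have dif f1 f2 : L2 mu2 f1 -> L2 mu2 f2 ->
    W (fun z => f1 z - f2 z) = (fun z => W f1 z - W f2 z) %[ae mu2].
  move=> hf1 hf2; have := op_lin hW (-1) hf2 hf1.
  rewrite (_ : (fun z => -1 * _ + _) = (fun z => f1 z - f2 z)); last by apply/funext => z; ring.
  by apply: filterS => z e t; rewrite e//; ring.
split => //; exists (fun n => W (u n)); split.
- by move=> n; exact: op_acost hW hk k0 (h1 n).
- move=> e e0; have e1 : 0 < e / (k + 1) by rewrite divr_gt0// ltr_wpDl.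
  have [N hN] := h2 _ e1; exists N => p q Np Nq.
  apply: (@acost_le _ _ _ _ _ (k * (e / (k + 1)))).
    rewrite mulrA ler_pdivrMr ?ltr_wpDl// mulrC.
    by apply: ler_wpM2l; rewrite ?lerDl// ltW.
  apply: (acost_ae _ (dif _ _ (hu p) (hu q))).
    by apply: L2B; exact: (op_L2 hW).
  by apply: (op_acost hW hk k0); exact: hN.
- apply: (@squeeze_cvgr _ _ _ _ (fun=> 0) (fun n => C * nrm mu2 (fun z => u n z - f z))).
  + apply: nearW => n; rewrite nrm_ge0/=.
    have hd := L2B (hu n) hf.
    rewrite -(nrm_ae _ _ (dif _ _ (hu n) hf)); [exact: (op_nrm hW)|exact: (op_L2 hW)|].
    by apply: L2B => //; exact: (op_L2 hW).
  + exact: cvg_cst.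
  + by rewrite -[X in _ --> X](mulr0 C); apply: cvgM => //; exact: cvg_cst.
Qed.

(** The difference satisfies [tensor_op] with constant 0, so its value at f has projective norm 0,
    which dominates the L_2 norm. *)
Lemma op_ext W W' C C' f c : bounded_op W C -> bounded_op W' C' ->
  (forall a b, L2 mu a -> L2 mu b -> W (tens a b) = W' (tens a b) %[ae mu2]) ->
  piB mu f c -> W f = W' f %[ae mu2].
Proof.
move=> h h' WW' hf; have hd := op_sub h h'.
have h0 : tensor_op (fun f z => W f z - W' f z) 0.
  move=> a b ha hb; rewrite mul0r; have ht := L2_tens ha hb.
  apply: (acost_ae (op_L2 hd ht) _ (acost_cst0 mu)).
  by apply: filterS (WW' a b ha hb) => z e t; rewrite e// subrr.
have := nrm_piB (op_piB hd h0 (lexx 0) hf); rewrite mul0r => n0.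
have /(nrm0_ae (op_L2 hd (piB_L2 hf))) : nrm mu2 (fun z => W f z - W' f z) = 0.
  by apply/eqP; rewrite eq_le n0 nrm_ge0.
apply: filterS => z e t.
by apply/eqP; rewrite -subr_eq0 e.
Qed.

End operators.

Lemma cvg_sumr (R : realType) I (s : seq I) (P : pred I) (F : I -> nat -> R) (l : I -> R) :
  (forall i, P i -> F i n @[n --> \oo] --> l i) ->
  \sum_(i <- s | P i) F i n @[n --> \oo] --> \sum_(i <- s | P i) l i.
Proof.
move=> h; elim: s => [|i s IH].
  by rewrite big_nil; under eq_fun do rewrite big_nil; exact: cvg_cst.
rewrite big_cons; under eq_fun do rewrite big_cons.
by case: (boolP (P i)) => Pi //; apply: cvgD => //; exact: h.
Qed.

(** * Decay of the adjoint iterates on canonical kernels *)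

Section adjoint_decay.
Context d (X : measurableType d) (R : realType) (mu : probability X R).
Local Notation mu2 := ((mu \x mu)%E : probability _ R).
Implicit Types (a b : X -> R) (f g u v phi : X * X -> R) (c e : R).
Variables (T : X -> X) (hT : exact_transformation mu T).
Let mpT : measure_preserving mu T. Proof. by case: hT. Qed.
Let mpTn n : measure_preserving mu (iter n T). Proof. exact: mp_iter. Qed.

Lemma exact_adj_mean a : L2 mu a ->
  nrm mu (fun x => adj mu (iter n T) a x - \int[mu]_y a y) @[n --> \oo] --> (0 : R).
Proof.
move=> ha; set m := \int[mu]_y a y; have hm := L2_cst mu m.
have ha' := L2B ha hm.
have := exact_adj0 hT ha'.
rewrite EB ?E_cst ?subrr; [|exact: L2_L1..] => /(_ erefl).
rewrite (_ : (fun n => nrm mu (adj mu (iter n T) _)) =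
  (fun n => nrm mu (fun x => adj mu (iter n T) a x - m)))//.
apply/funext => n; apply: nrm_ae; [exact: (adj_L2 (mpTn n))|
  by apply: L2B => //; exact: (adj_L2 (mpTn n))|].
have := adj_lin (mpTn n) (-1) hm ha; rewrite (_ : (fun x => -1 * _ + _) = (fun x => a x - m)).
  by apply: filterS2 (adjK (mpTn n) hm) => x e1 e2 t; rewrite e2// e1//; ring.
by apply/funext => x; ring.
Qed.

Let nrm1 : nrm mu (fun=> 1) = 1.
Proof. by rewrite /nrm /ip; under eq_Rintegral do rewrite mulr1; rewrite E_cst sqrtr1. Qed.

(** The kernel on the left is the orthogonal projection of [u] to the kernels of the second variable
    alone; [f] is orthogonal to these, so it may be subtracted from [u]. *)
Lemma nrm_mean_tens f n (a b : 'I_n -> X -> R) u : L2 mu2 f -> L2 mu2 u ->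
  is_tensor_rep mu a b u ->
  {ae mu, forall y, (\int[mu]_z (f (z, y))%:E = 0)%E} ->
  nrm mu2 (tens (fun=> 1) (fun y => \sum_(k < n) (\int[mu]_x a k x) * b k y)) <=
  nrm mu2 (fun z => u z - f z).
Proof.
move=> hf hu [hab hr] f0; pose beta y := \sum_(k < n) (\int[mu]_x a k x) * b k y.
rewrite -/beta.
have hb : L2 mu beta by apply: L2_sum => k _; apply: L2Z; have [] := hab k.
have h1 := L2_cst mu 1; have ht := L2_tens h1 hb.
have htk k : L2 mu2 (tens (a k) (b k)) by have [] := hab k; exact: L2_tens.
have E1 : nrm mu2 (tens (fun=> 1) beta) ^+ 2 = ip mu2 (fun z => u z - f z) (tens (fun=> 1) beta).
  rewrite ipBl// (ip_canonical hf hb f0) subr0 nrm_tens// nrm1 mul1r nrmK.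
  have hst : L2 mu2 (fun z => \sum_(k < n) tens (a k) (b k) z) by apply: L2_sum => k _.
  rewrite (ip_ael hu hst ht hr).
  rewrite [RHS](ip_suml _ _ ht)//.
  transitivity (ip mu (fun y => \sum_(k < n) (\int[mu]_x a k x) * b k y) beta); first by [].
  rewrite ip_suml//; last by move=> k _; apply: L2Z; have [] := hab k.
  apply: eq_bigr => k _; have [hak hbk] := hab k; rewrite ipZl// ip_tens//; congr (_ * _).
  by apply: eq_Rintegral => x _; rewrite mulr1.
have := cauchy_schwarz (L2B hu hf) ht; rewrite -E1 ger0_norm ?sqr_ge0// expr2.
have := nrm_ge0 mu2 (tens (fun=> 1) beta); rewrite le_eqVlt => /predU1P[<- _|p0].
  exact: nrm_ge0.
by rewrite ler_pM2r.
Qed.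

(* On tensors the limit is the mean of the first factor; f is orthogonal to all
   kernels 1 (x) b. *)
Lemma kernel_adj0 f : L2pi mu f ->
  {ae mu, forall y, (\int[mu]_z (f (z, y))%:E = 0)%E} ->
  nrm mu2 (adj mu2 (prod_map (iter n T) id) f) @[n --> \oo] --> (0 : R).
Proof.
move=> /L2pi_piB[c [hf [u [h1 h2 h3]]]] f0.
apply/cvgrPdist_le => e e0; have e3 : 0 < e / 3 by rewrite divr_gt0.
move/cvgrPdist_le : h3 => /(_ _ e3)[N _ /(_ N (leqnn _))].
rewrite /= sub0r normrN ger0_norm; last exact: nrm_ge0.
move=> hN.
have [hu [m [a [b [hr _]]]]] := h1 N.
have hab k : L2 mu (a k) /\ L2 mu (b k) by have [h _] := hr; exact: h.
set v := u N in hu hr hN.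
have mpS n : measure_preserving mu2 (prod_map (iter n T) id) by apply: mp_prod => //; exact: mp_id.
(* The limit of the iterates on the tensor [v], each [a k] tending to its mean. The three thirds of
   [e] are for passing from f to [v], from [v] to [w], and for [w] itself. *)
pose w := tens (fun=> 1) (fun y => \sum_(k < m) (\int[mu]_x a k x) * b k y).
have hw : L2 mu2 w.
  by apply: L2_tens; [exact: L2_cst|apply: L2_sum => k _; apply: L2Z; have [] := hab k].
have w_le : nrm mu2 w <= e / 3 by exact: le_trans (nrm_mean_tens hf hu hr f0) hN.
have hak n k : L2 mu (fun x => adj mu (iter n T) (a k) x - \int[mu]_x a k x).
  by apply: L2B; [apply: (adj_L2 (mpTn n)); have [] := hab k|exact: L2_cst].
have cv : \sum_(k < m) nrm mu (fun x => adj mu (iter n T) (a k) x - \int[mu]_x a k x) * nrm mu (b k)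
    @[n --> \oo] --> (0 : R).
  rewrite [X in _ --> X](_ : _ = \sum_(k < m) 0 * nrm mu (b k)); last by rewrite big1// => k _; rewrite mul0r.
  apply: (@cvg_sumr _ _ _ _ (fun k n => nrm mu (fun x => adj mu (iter n T) (a k) x -
    \int[mu]_x a k x) * nrm mu (b k)) (fun k => 0 * nrm mu (b k))) => k _; apply: cvgM; last exact: cvg_cst.
  by apply: exact_adj_mean; have [] := hab k.
move/cvgrPdist_le : cv => /(_ _ e3); apply: filterS => n.
rewrite !sub0r !normrN ger0_norm; last first.
  by apply: sumr_ge0 => k _; rewrite mulr_ge0// nrm_ge0.
rewrite [in X in _ -> X]ger0_norm ?nrm_ge0// => hn.
have hAf := adj_L2 (mpS n) hf; have hAu := adj_L2 (mpS n) hu.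
have k1 : nrm mu2 (fun z => adj mu2 (prod_map (iter n T) id) f z -
    adj mu2 (prod_map (iter n T) id) v z) <= e / 3.
  apply: le_trans hN; rewrite [leRHS]nrmBC.
  apply: le_trans (adj_nrm (mpS n) (L2B hf hu)).
  rewrite le_eqVlt; apply/orP; left; apply/eqP; apply: nrm_ae; [exact: L2B|exact: (adj_L2 (mpS n) (L2B hf hu))|].
  have := adj_lin (mpS n) (-1) hu hf; rewrite (_ : (fun x => -1 * _ + _) = (fun x => f x - v x)).
    by apply: filterS => z e1 t; rewrite e1//; ring.
  by apply/funext => z; ring.
have k2 : nrm mu2 (fun z => adj mu2 (prod_map (iter n T) id) v z - w z) <= e / 3.
  apply: le_trans hn.
  have hs k : L2 mu2 (tens (fun x => adj mu (iter n T) (a k) x - \int[mu]_x a k x) (b k)).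
    by apply: L2_tens => //; have [] := hab k.
  rewrite (@nrm_ae _ _ _ _ _ (fun z => \sum_(k < m)
    tens (fun x => adj mu (iter n T) (a k) x - \int[mu]_x a k x) (b k) z)).
  - apply: (le_trans (nrm_sum _ _)) => //.
    by apply: ler_sum => k _; rewrite nrm_tens//; have [] := hab k.
  - exact: L2B.
  - exact: L2_sum.
  have hA := op_adj (mpS n).
  have ht k : L2 mu2 (tens (a k) (b k)) by have [] := hab k; exact: L2_tens.
  have hst : L2 mu2 (fun z => \sum_(k < m) tens (a k) (b k) z) by exact: L2_sum.
  have e1 := op_ae hA hu hst hr.2.
  have e2 := op_sum hA ht.
  have e3' : {ae mu2, forall z, forall k : 'I_m, adj mu2 (prod_map (iter n T) id) (tens (a k) (b k)) z =
      tens (adj mu (iter n T) (a k)) (b k) z}.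
    apply: filter_forall => k; have [hak' hbk] := hab k.
    by have := adj_tens1 (mpTn n) hak' hbk; apply: filterS => z; apply.
  apply: filterS3 e1 e2 e3' => z z1 z2 z3 t; rewrite z1// z2//.
  rewrite /w /tens mul1r -sumrB; apply: eq_bigr => k _.
  by rewrite [LHS]/= z3 /tens mulrBl.
have k3 := nrmD3 hAf (L2_cst mu2 0) hAu; have k4 := nrmD3 hAu (L2_cst mu2 0) hw.
have s0 q : (fun z => q z - 0) = q :> (X * X -> R) by apply/funext => z; rewrite subr0.
by rewrite !s0 in k3 k4; lra.
Qed.

End adjoint_decay.

Lemma telescope_ord (R : zmodType) (F : nat -> R) n :
  \sum_(i < n) (F i - F i.+1) = F 0%N - F n.
Proof. by elim: n => [|n IH]; rewrite ?big_ord0 ?subrr// big_ord_recr/= IH addrA subrK. Qed.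

Lemma telescope_ord2 (R : comNzRingType) (F : nat -> nat -> R) n :
  \sum_(i < n) \sum_(j < n) (F i j - F i.+1 j - (F i j.+1 - F i.+1 j.+1)) =
  F 0%N 0%N - F n 0%N - F 0%N n + F n n.
Proof.
under eq_bigr => i _ do rewrite (telescope_ord (fun j => F i j - F i.+1 j)).
rewrite sumrB (telescope_ord (F^~ 0%N)) (telescope_ord (F^~ n)); ring.
Qed.

(** * Decomposition of the kernel *)

Section kernel_decomposition.
Context d (X : measurableType d) (R : realType) (mu : probability X R).
Local Notation mu2 := ((mu \x mu)%E : probability _ R).
Implicit Types (a b : X -> R) (f g h u v phi : X * X -> R) (c e : R).
Variables (T : X -> X) (hT : exact_transformation mu T).
Let mpT : measure_preserving mu T. Proof. by case: hT. Qed.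
Let mpTn n : measure_preserving mu (iter n T). Proof. exact: mp_iter. Qed.
Let mpS i j : measure_preserving mu2 (prod_map (iter i T) (iter j T)).
Proof. exact: mp_prod. Qed.

Let S1 : X * X -> X * X := prod_map T id.
Let S2 : X * X -> X * X := prod_map id T.
Let mpS1 : measure_preserving mu2 S1. Proof. exact: (mpS 1 0). Qed.
Let mpS2 : measure_preserving mu2 S2. Proof. exact: (mpS 0 1). Qed.

Lemma VstarE i j : Vstar mu T i j = adj mu2 (prod_map (iter i T) (iter j T)).
Proof. by rewrite adj.unlock. Qed.

Definition subadj (S : X * X -> X * X) h z := h z - adj mu2 S h z.
(** The operator I - V A of the composition V with [S] and its adjoint A: the projection to the
    orthogonal complement of all [phi o S], compare [ip_subproj]. *)
Definition subproj (S : X * X -> X * X) h z := h z - adj mu2 S h (S z).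

Lemma ip_subadj S h phi : measure_preserving mu2 S -> L2 mu2 h -> L2 mu2 phi ->
  ip mu2 phi (subadj S h) = ip mu2 (fun z => phi z - phi (S z)) h.
Proof.
move=> hS hh hphi; rewrite ipBr ?ipBl//; [|exact: (mp_L2 hS)|exact: (adj_L2 hS)].
by rewrite (ip_adj hS).
Qed.

Lemma ip_subproj S h phi : measure_preserving mu2 S -> L2 mu2 h -> L2 mu2 phi ->
  ip mu2 (fun z => phi (S z)) (subproj S h) = 0.
Proof.
move=> hS hh hphi; have hA := adj_L2 hS hh; have hphiS := mp_L2 hS hphi.
rewrite ipBr//; last exact: (mp_L2 hS).
by rewrite (mp_ip hS hphi hA) (ip_adj hS hh hphi) subrr.
Qed.

Lemma g_emptyE h : g_empty mu T h = subproj S1 (subproj S2 h).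
Proof. by rewrite /g_empty /I_sub_VVstar !VstarE. Qed.

Definition green n f z := \sum_(i < n) \sum_(j < n) Vstar mu T i j f z.

Lemma green_L2 n f : L2 mu2 f -> L2 mu2 (green n f).
Proof.
by move=> hf; apply: L2_sum => i _; apply: L2_sum => j _; rewrite VstarE; exact: (adj_L2 (mpS i j)).
Qed.

(** Both difference operators are moved to [phi], where the double sum telescopes to its four
    corners. In the last corner one power of [T] stays on [phi], so that only adjoint iterates in a
    single variable have to be small. *)
Lemma ip_green n f phi : L2 mu2 f -> L2 mu2 phi ->
  ip mu2 (fun z => phi z - phi (S1 z) - (phi (S2 z) - phi (S1 (S2 z)))) (green n f) =
  ip mu2 phi f - ip mu2 phi (adj mu2 (prod_map (iter n T) id) f)
  - ip mu2 phi (adj mu2 (prod_map id (iter n T)) f)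
  + ip mu2 (fun z => phi (z.1, iter n T z.2)) (adj mu2 (prod_map (iter n T) id) f).
Proof.
move=> hf hphi; set E := fun z => _.
have hE : L2 mu2 E.
  have h1 := mp_L2 mpS1 hphi.
  by apply: L2B; apply: L2B => //; [exact: (mp_L2 mpS2 hphi)|exact: (mp_L2 mpS2 h1)].
have hES i j : L2 mu2 (fun z => E (prod_map (iter i T) (iter j T) z)) by exact: (mp_L2 (mpS i j)).
have hphiS i j : L2 mu2 (fun z => phi (prod_map (iter i T) (iter j T) z)) by exact: (mp_L2 (mpS i j)).
transitivity (ip mu2 (fun z => \sum_(i < n) \sum_(j < n) E (prod_map (iter i T) (iter j T) z)) f).
  rewrite ip_sumr//; last first.
    by move=> i _; apply: L2_sum => j _; rewrite VstarE; exact: (adj_L2 (mpS i j)).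
  rewrite ip_suml//; last by move=> i _; apply: L2_sum => j _.
  apply: eq_bigr => i _; rewrite ip_sumr//; last first.
    by move=> j _; rewrite VstarE; exact: (adj_L2 (mpS i j)).
  rewrite ip_suml//; apply: eq_bigr => j _.
  by rewrite VstarE (ip_adj (mpS i j)).
rewrite (_ : (fun z => \sum_(i < n) _) = (fun z => phi z - phi (prod_map (iter n T) id z)
  - phi (prod_map id (iter n T) z) + phi (prod_map (iter n T) (iter n T) z))); last first.
  apply/funext => -[x y].
  exact: (telescope_ord2 (fun i j => phi (iter i T x, iter j T y))).
have hn0 : L2 mu2 (fun z => phi (prod_map (iter n T) id z)) by exact: (hphiS n 0%N).
have h0n : L2 mu2 (fun z => phi (prod_map id (iter n T) z)) by exact: (hphiS 0%N n).
rewrite ipDl//; [|by apply: L2B => //; exact: L2B].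
rewrite ipBl//; [|exact: L2B]; rewrite ipBl//.
congr (_ - _ - _ + _).
- by rewrite (ip_adj (mpS n 0)).
- by rewrite (ip_adj (mpS 0 n)).
- by rewrite (ip_adj (mpS n 0) hf h0n).
Qed.

Lemma symmetric_swp f : symmetric_kernel mu f -> (fun z => f (swp z)) = f %[ae mu2].
Proof. by apply: filterS => z e _. Qed.

Lemma kernel_adj0' f : L2pi mu f -> symmetric_kernel mu f ->
  {ae mu, forall y, (\int[mu]_z (f (z, y))%:E = 0)%E} ->
  nrm mu2 (adj mu2 (prod_map id (iter n T)) f) @[n --> \oo] --> (0 : R).
Proof.
move=> /[dup] hf [h _] hsym /(kernel_adj0 hT hf).
rewrite (_ : (fun n => _) = (fun n => nrm mu2 (adj mu2 (prod_map id (iter n T)) f)))//.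
apply/funext => n; have hA := adj_L2 (mpS n 0) h.
rewrite -[LHS](mp_nrm (mp_swp mu) hA); apply: nrm_ae; [exact: (L2_swp hA)|exact: (adj_L2 (mpS 0 n))|].
have e1 := adj_swp (mp_id mu) (mpTn n) h.
have e2 := adj_ae (mpS 0 n) (L2_swp h) h (symmetric_swp hsym).
by apply: filterS2 e1 e2 => z z1 z2 t; rewrite -z1// z2.
Qed.

Section decomposition.
Variables (f g : X * X -> R).
Hypotheses (hf : L2pi mu f) (hsym : symmetric_kernel mu f)
  (f0 : {ae mu, forall y, (\int[mu]_z (f (z, y))%:E = 0)%E}) (hg : L2pi mu g).
Hypothesis hfg : pi_norm mu (fun z =>
        (\sum_(i1 < n.1) \sum_(i2 < n.2) Vstar mu T i1 i2 f z) - g z)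
      @[n --> (\oo, \oo)] --> 0%E.
Let hf2 : L2 mu2 f. Proof. by case: hf. Qed.
Let hg2 : L2 mu2 g. Proof. by case: hg. Qed.

(** The diagonal of the double limit, with the L_2 norm bounded by the projective norm. *)
Lemma green_cvg : nrm mu2 (fun z => green n f z - g z) @[n --> \oo] --> (0 : R).
Proof.
apply/cvgrPdist_le => e e0; have e0' : (0 < e%:E)%E by rewrite lte_fin.
have := hfg (open_ereal_lt' e0').
move=> [[A B] /= [[N1 _ hA] [N2 _ hB]] hAB]; exists (maxn N1 N2) => // n /=.
rewrite geq_max => /andP[n1 n2].
rewrite sub0r normrN ger0_norm ?nrm_ge0//; apply: nrm_piB.
apply: pi_norm_lt; first by apply: L2B => //; exact: green_L2.
by apply: (hAB (n, n)); split; [exact: hA|exact: hB].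
Qed.

(** [ip_green] in the limit: its left side tends to the inner product with [g], and of the four
    corners only the one with f survives, by [kernel_adj0] and [kernel_adj0']. *)
Lemma kernel_green : f = subadj S1 (subadj S2 g) %[ae mu2].
Proof.
have hD2 : L2 mu2 (subadj S2 g) by apply: L2B => //; exact: (adj_L2 mpS2).
have hD1 : L2 mu2 (subadj S1 (subadj S2 g)) by apply: L2B => //; exact: (adj_L2 mpS1).
apply: weak_ae => // phi hphi.
pose E z := phi z - phi (S1 z) - (phi (S2 z) - phi (S1 (S2 z))).
have h1 := mp_L2 mpS1 hphi.
have hE : L2 mu2 E.
  by apply: L2B; apply: L2B => //; [exact: (mp_L2 mpS2 hphi)|exact: (mp_L2 mpS2 h1)].
have Eg : ip mu2 phi (subadj S1 (subadj S2 g)) = ip mu2 E g.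
  by rewrite (ip_subadj mpS1)// (ip_subadj mpS2)//; exact: L2B.
rewrite Eg; apply/eqP; rewrite -subr_eq0 -normr_eq0; apply/eqP.
have k1 := kernel_adj0 hT hf f0; have k2 := kernel_adj0' hf hsym f0.
(* The multiplicity 2 counts the iterates in the first variable, which occur in two corners. *)
have cv : nrm mu2 phi * (nrm mu2 (adj mu2 (prod_map (iter n T) id) f) *+ 2 +
    nrm mu2 (adj mu2 (prod_map id (iter n T)) f)) +
    nrm mu2 E * nrm mu2 (fun z => green n f z - g z) @[n --> \oo] --> (0 : R).
  rewrite [X in _ --> X](_ : _ = nrm mu2 phi * (0 *+ 2 + 0) + nrm mu2 E * 0); last by ring.
  apply: cvgD; apply: cvgM; [exact: cvg_cst| |exact: cvg_cst|exact: green_cvg].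
  by apply: cvgD => //; exact: cvgMn.
apply/eqP; rewrite eq_le normr_ge0 andbT -(cvg_lim _ cv)//; apply: limr_ge.
  by apply/cvg_ex; exists 0.
apply: nearW => n; have hG := green_L2 n hf2.
have := ip_green n hf2 hphi; rewrite -/E.
have a1 := adj_L2 (mpS n 0) hf2; have a2 := adj_L2 (mpS 0 n) hf2.
have h0n := mp_L2 (mpS 0 n) hphi.
have c1 := cauchy_schwarz hphi a1; have c2 := cauchy_schwarz hphi a2.
have c3 := cauchy_schwarz h0n a1; rewrite (mp_nrm (mpS 0 n) hphi) in c3.
have c4 := cauchy_schwarz hE (L2B hG hg2); rewrite ipBr// in c4.
move: c1 c2 c3 c4.
rewrite (_ : prod_map (iter n T) (iter 0 T) = prod_map (iter n T) id)//.
rewrite (_ : prod_map (iter 0 T) (iter n T) = prod_map id (iter n T))//.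
rewrite (_ : (fun z => phi (prod_map id (iter n T) z)) = (fun z => phi (z.1, iter n T z.2)))//.
set i1 := ip mu2 phi (adj _ (prod_map (iter n T) id) f).
set i2 := ip mu2 phi (adj _ (prod_map id (iter n T)) f).
set i3 := ip mu2 (fun z => phi (z.1, iter n T z.2)) _.
move=> c1 c2 c3 c4; rewrite -/(ip mu2 E (green n f)) => e1.
rewrite (_ : _ - _ = i1 + i2 - i3 + (ip mu2 E (green n f) - ip mu2 E g)); last by rewrite e1; ring.
apply: (le_trans (ler_normD _ _)); apply: lerD => //.
apply: (le_trans (ler_normB _ _)); apply: le_trans (lerD (le_trans (ler_normD _ _) (lerD c1 c2)) c3) _.
by rewrite mulrDr mulrnAr mulr2n addrAC.
Qed.

End decomposition.
End kernel_decomposition.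

(** * Coboundaries, martingale parts and the remainder *)

Section kernel_operators.
Context d (X : measurableType d) (R : realType) (mu : probability X R).
Local Notation mu2 := ((mu \x mu)%E : probability _ R).
Implicit Types (a b : X -> R) (f g h u v phi : X * X -> R) (c e : R).
Variables (T : X -> X) (hT : exact_transformation mu T).
Let mpT : measure_preserving mu T. Proof. by case: hT. Qed.
Let mpTn n : measure_preserving mu (iter n T). Proof. exact: mp_iter. Qed.
Let mpS i j : measure_preserving mu2 (prod_map (iter i T) (iter j T)).
Proof. exact: mp_prod. Qed.

Let S1 : X * X -> X * X := prod_map T id.
Let S2 : X * X -> X * X := prod_map id T.
Let mpS1 : measure_preserving mu2 S1. Proof. exact: (mpS 1 0). Qed.
Let mpS2 : measure_preserving mu2 S2. Proof. exact: (mpS 0 1). Qed.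

Lemma op_subadj S : measure_preserving mu2 S -> bounded_op mu (subadj mu S) 2.
Proof. by move=> hS; apply: (op_sub (op_id mu) (op_adj hS)). Qed.

Lemma op_subproj S : measure_preserving mu2 S -> bounded_op mu (subproj mu S) 2.
Proof.
move=> hS; rewrite (_ : 2 = 1 + 1 * 1); last by rewrite mulr1.
exact: (op_sub (op_id mu) (op_compose (op_comp hS) (op_adj hS) ler01)).
Qed.

(** The one-variable factor of [subadj]. With h the adjoint of [a], it is [martingale_part a] plus
    the coboundary [h o T - h]. *)
Definition coboundary a x := a x - adj mu T a x.

(* By [ip_martingale_part], the orbit of this function is a sequence of reversed
   martingale differences. *)
Definition martingale_part a x := a x - adj mu T a (T x).

Lemma coboundary_L2 a : L2 mu a -> L2 mu (coboundary a).
Proof. by move=> ha; apply: L2B => //; exact: (adj_L2 mpT). Qed.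

Lemma martingale_part_L2 a : L2 mu a -> L2 mu (martingale_part a).
Proof. by move=> ha; apply: L2B => //; apply: (mp_L2 mpT); exact: (adj_L2 mpT). Qed.

Lemma nrm_martingale_part a : L2 mu a -> nrm mu (martingale_part a) <= 2 * nrm mu a.
Proof.
move=> ha; apply: (le_trans (nrmB ha (mp_L2 mpT (adj_L2 mpT ha)))).
rewrite (mp_nrm mpT); last exact: (adj_L2 mpT).
by have := adj_nrm mpT ha; lra.
Qed.

Lemma ip_martingale_part a psi : L2 mu a -> L2 mu psi ->
  ip mu (fun x => psi (T x)) (martingale_part a) = 0.
Proof.
move=> ha hpsi; have hA := adj_L2 mpT ha.
rewrite ipBr//; [|exact: (mp_L2 mpT)..].
by rewrite (mp_ip mpT)// (ip_adj mpT)// subrr.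
Qed.

Lemma subadj_tens1 a b : L2 mu a -> L2 mu b ->
  subadj mu S1 (tens a b) = tens (coboundary a) b %[ae mu2].
Proof.
move=> ha hb; apply: filterS (adj_tens1 mpT ha hb) => z e t.
by rewrite /subadj e// /tens mulrBl.
Qed.

Lemma subadj_tens2 a b : L2 mu a -> L2 mu b ->
  subadj mu S2 (tens a b) = tens a (coboundary b) %[ae mu2].
Proof.
move=> ha hb; apply: filterS (adj_tens2 mpT ha hb) => z e t.
by rewrite /subadj e// /tens mulrBr.
Qed.

Lemma subproj_tens1 a b : L2 mu a -> L2 mu b ->
  subproj mu S1 (tens a b) = tens (martingale_part a) b %[ae mu2].
Proof.
move=> ha hb; apply: filterS (mp_ae mpS1 (adj_tens1 mpT ha hb)) => z e t.
by rewrite /subproj e// /tens mulrBl.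
Qed.

Lemma subproj_tens2 a b : L2 mu a -> L2 mu b ->
  subproj mu S2 (tens a b) = tens a (martingale_part b) %[ae mu2].
Proof.
move=> ha hb; apply: filterS (mp_ae mpS2 (adj_tens2 mpT ha hb)) => z e t.
by rewrite /subproj e// /tens mulrBr.
Qed.

Lemma subproj_tens12 a b : L2 mu a -> L2 mu b ->
  subproj mu S1 (subproj mu S2 (tens a b)) =
  tens (martingale_part a) (martingale_part b) %[ae mu2].
Proof.
move=> ha hb; have hb' := martingale_part_L2 hb.
have h2 := op_subproj mpS2; have h1 := op_subproj mpS1.
have e1 := op_ae h1 (op_L2 h2 (L2_tens ha hb)) (L2_tens ha hb') (subproj_tens2 ha hb).
by apply: filterS2 e1 (subproj_tens1 ha hb') => z z1 z2 t; rewrite z1// z2.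
Qed.

Lemma subproj_tens21 a b : L2 mu a -> L2 mu b ->
  subproj mu S2 (subproj mu S1 (tens a b)) =
  tens (martingale_part a) (martingale_part b) %[ae mu2].
Proof.
move=> ha hb; have ha' := martingale_part_L2 ha.
have h2 := op_subproj mpS2; have h1 := op_subproj mpS1.
have e1 := op_ae h2 (op_L2 h1 (L2_tens ha hb)) (L2_tens ha' hb) (subproj_tens1 ha hb).
by apply: filterS2 e1 (subproj_tens2 ha' hb) => z z1 z2 t; rewrite z1// z2.
Qed.

Lemma subadj_tens12 a b : L2 mu a -> L2 mu b ->
  subadj mu S1 (subadj mu S2 (tens a b)) = tens (coboundary a) (coboundary b) %[ae mu2].
Proof.
move=> ha hb; have hb' := coboundary_L2 hb.
have h2 := op_subadj mpS2; have h1 := op_subadj mpS1.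
have e1 := op_ae h1 (op_L2 h2 (L2_tens ha hb)) (L2_tens ha hb') (subadj_tens2 ha hb).
by apply: filterS2 e1 (subadj_tens1 ha hb') => z z1 z2 t; rewrite z1// z2.
Qed.

Lemma tensor_subproj1 : tensor_op mu (subproj mu S1) 2.
Proof.
move=> a b ha hb; have ha' := martingale_part_L2 ha.
apply: (@acost_le _ _ _ _ _ (nrm mu (martingale_part a) * nrm mu b)).
  by rewrite mulrA ler_wpM2r ?nrm_ge0// nrm_martingale_part.
apply: (acost_ae _ _ (acost_tens ha' hb)).
  by apply: (op_L2 (op_subproj mpS1)); exact: L2_tens.
by apply: filterS (subproj_tens1 ha hb) => z e t; rewrite e.
Qed.

Lemma tensor_subproj2 : tensor_op mu (subproj mu S2) 2.
Proof.
move=> a b ha hb; have hb' := martingale_part_L2 hb.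
apply: (@acost_le _ _ _ _ _ (nrm mu a * nrm mu (martingale_part b))).
  by rewrite mulrCA ler_wpM2l ?nrm_ge0// nrm_martingale_part.
apply: (acost_ae _ _ (acost_tens ha hb')).
  by apply: (op_L2 (op_subproj mpS2)); exact: L2_tens.
by apply: filterS (subproj_tens2 ha hb) => z e t; rewrite e.
Qed.

Lemma subproj_swp h : L2 mu2 h ->
  (fun z => subproj mu S1 h (swp z)) = subproj mu S2 (fun z => h (swp z)) %[ae mu2].
Proof.
move=> hh; have e := mp_ae mpS2 (adj_swp (mp_id mu) mpT hh).
by apply: filterS e => z z1 t; rewrite /subproj z1.
Qed.

(** Exchanging the variables turns one projection into the other, so symmetry amounts to their
    commuting, which is checked on tensors and extended by [op_ext]. *)
Lemma g_empty_L2pi_sym g : L2pi mu g -> symmetric_kernel mu g ->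
  L2pi_sym mu (g_empty mu T g).
Proof.
move=> hg hsym; rewrite g_emptyE; have [c hc] := L2pi_piB hg.
have h1 := op_subproj mpS1; have h2 := op_subproj mpS2.
have hg2 : L2 mu2 g by case: hg.
have le02 : 0 <= 2 :> R by [].
split.
  by apply: piB_L2pi (op_piB h1 tensor_subproj1 le02 (op_piB h2 tensor_subproj2 le02 hc)).
have hK2 := op_L2 h2 hg2; have hK1 := op_L2 h1 hg2.
have k1 := subproj_swp hK2.
have k2 := mp_ae (mp_swp mu) (subproj_swp (L2_swp hg2)).
have k3 : (fun z => subproj mu S2 g (swp z)) = subproj mu S1 (fun z => g (swp z)) %[ae mu2].
  move: k2; rewrite (_ : (fun z => g (swp (swp z))) = g); last by apply/funext => -[x y].
  by apply: filterS => -[x y] e t; rewrite -e.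
have k4 := op_ae h1 (L2_swp hg2) hg2 (symmetric_swp hsym).
have k34 : (fun z => subproj mu S2 g (swp z)) = subproj mu S1 g %[ae mu2].
  by apply: filterS2 k3 k4 => z z1 z2 t; rewrite z1// z2.
have k5 := op_ae h2 (L2_swp hK2) hK1 k34.
suff k6 : subproj mu S1 (subproj mu S2 g) = subproj mu S2 (subproj mu S1 g) %[ae mu2].
  apply: filterS3 k1 k5 k6 => z z1 z2 z3; rewrite z3// -z2// -z1//.
apply: (op_ext (op_compose h1 h2 le02) (op_compose h2 h1 le02) _ hc) => a b ha hb.
by apply: filterS2 (subproj_tens12 ha hb) (subproj_tens21 ha hb) => z z1 z2 t; rewrite z1// z2.
Qed.

Definition orbit_sum n f z := \sum_(i < n) \sum_(j < n) V T i j f z.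

Lemma op_orbit_sum n : bounded_op mu (orbit_sum n) (n%:R * (n%:R * 1)).
Proof.
by apply: op_bigsum => i; apply: op_bigsum => j; exact: (op_comp (mpS i j)).
Qed.

Lemma orbit_sum_tens n a b z :
  orbit_sum n (tens a b) z = tens (psum T a n) (psum T b n) z.
Proof.
rewrite /tens /psum big_distrl; apply: eq_bigr => i _.
by rewrite big_distrr; apply: eq_bigr => j _.
Qed.

Let r n : R := Num.sqrt n%:R.

Lemma nrm_psum_martingale_part n a : L2 mu a ->
  nrm mu (psum T (martingale_part a) n) <= 2 * r n * nrm mu a.
Proof.
move=> ha; have ha' := martingale_part_L2 ha.
rewrite -ler_sqr ?nnegrE ?mulr_ge0 ?nrm_ge0 ?sqrtr_ge0//.
rewrite (nrm_psum hT ha') => [|psi hpsi]; last exact: ip_martingale_part.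
rewrite [leRHS](_ : _ = n%:R * (2 * nrm mu a) ^+ 2); last first.
  by rewrite !exprMn /r sqr_sqrtr//; ring.
apply: ler_wpM2l => //.
by rewrite ler_sqr ?nnegrE ?mulr_ge0 ?nrm_ge0// nrm_martingale_part.
Qed.

(** The difference telescopes along the orbit to two boundary terms, whatever n, while each sum
    alone may grow like sqrt n. *)
Lemma nrm_psum_diff n a : L2 mu a ->
  nrm mu (fun x => psum T (coboundary a) n x - psum T (martingale_part a) n x) <= 2 * nrm mu a.
Proof.
move=> ha; have hA := adj_L2 mpT ha; have hAn := mp_L2 (mpTn n) hA.
rewrite (_ : (fun x => _) = (fun x => adj mu T a (iter n T x) - adj mu T a x)).
  apply: (le_trans (nrmB hAn hA)); rewrite (mp_nrm (mpTn n) hA).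
  by have := adj_nrm mpT ha; lra.
apply/funext => x; rewrite /psum -sumrB -[RHS]opprB.
rewrite -(telescope_ord (fun i => adj mu T a (iter i T x))) -sumrN.
by apply: eq_bigr => i _; rewrite /coboundary /martingale_part /=; ring.
Qed.

Definition remainder n h z := orbit_sum n (subadj mu S1 (subadj mu S2 h)) z -
  orbit_sum n (subproj mu S1 (subproj mu S2 h)) z.

Lemma op_remainder n : exists C, bounded_op mu (remainder n) C.
Proof.
have le02 : 0 <= 2 :> R by [].
have h1 := op_compose (op_subadj mpS1) (op_subadj mpS2) le02.
have h2 := op_compose (op_subproj mpS1) (op_subproj mpS2) le02.
have n0 : 0 <= n%:R * (n%:R * 1) :> R by rewrite mulr1 mulr_ge0.
eexists; exact: (op_sub (op_compose (op_orbit_sum n) h1 n0) (op_compose (op_orbit_sum n) h2 n0)).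
Qed.

(** With Q and M the two kinds of sums, Q_a (x) Q_b - M_a (x) M_b = (Q_a - M_a) (x) Q_b + M_a (x)
    (Q_b - M_b). Up to the factor |a| |b| these cost at most 2 (2 + 2 sqrt n) and 4 sqrt n. *)
Lemma tensor_remainder n : tensor_op mu (remainder n) (8 * r n + 4).
Proof.
move=> a b ha hb; have [C hC] := op_remainder n; have ht := L2_tens ha hb.
have hca := coboundary_L2 ha; have hcb := coboundary_L2 hb.
have hma := martingale_part_L2 ha; have hmb := martingale_part_L2 hb.
have U := op_orbit_sum n.
have q1 := op_ae U (op_L2 (op_subadj mpS1) (op_L2 (op_subadj mpS2) ht)) (L2_tens hca hcb) (subadj_tens12 ha hb).
have q2 := op_ae U (op_L2 (op_subproj mpS1) (op_L2 (op_subproj mpS2) ht)) (L2_tens hma hmb) (subproj_tens12 ha hb).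
set Qa := psum T (coboundary a) n; set Qb := psum T (coboundary b) n.
set Ma := psum T (martingale_part a) n; set Mb := psum T (martingale_part b) n.
have lQ (q : X -> R) : L2 mu q -> L2 mu (psum T q n) by move=> hq; exact: (psum_L2 hT hq).
have hQa : L2 mu Qa by exact: lQ. have hQb : L2 mu Qb by exact: lQ.
have hMa : L2 mu Ma by exact: lQ. have hMb : L2 mu Mb by exact: lQ.
have k1 := acost_tens (L2B hQa hMa) hQb.
have k2 := acost_tens hMa (L2B hQb hMb).
have k := acostD k1 k2.
apply: (@acost_le _ _ _ _ _ _ _ _ (@acost_ae _ _ _ _ _ _ _ (op_L2 hC ht) _ k)); last first.
  apply: filterS2 q1 q2 => z z1 z2 t; rewrite /remainder z1// z2// !orbit_sum_tens.
  by rewrite /tens -/Qa -/Qb -/Ma -/Mb; ring.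
have b1 := nrm_psum_diff n ha; have b2 := nrm_psum_diff n hb.
have b3 := nrm_psum_martingale_part n ha; have b4 := nrm_psum_martingale_part n hb.
have b5 : nrm mu Qb <= 2 * nrm mu b + 2 * r n * nrm mu b.
  have := nrmD (L2B hQb hMb) hMb; under eq_fun do rewrite subrK.
  by move/le_trans; apply; exact: lerD.
have na := nrm_ge0 mu a; have nb := nrm_ge0 mu b; have r0 : 0 <= r n by exact: sqrtr_ge0.
apply: (le_trans (lerD (ler_pM (nrm_ge0 _ _) (nrm_ge0 _ _) b1 b5) (ler_pM (nrm_ge0 _ _) (nrm_ge0 _ _) b3 b2))).
by rewrite le_eqVlt; apply/orP; left; apply/eqP; ring.
Qed.

Lemma piB_remainder n g c : piB mu g c -> piB mu (remainder n g) ((8 * r n + 4) * c).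
Proof.
move=> hg; have [C hC] := op_remainder n.
by apply: (op_piB hC (tensor_remainder n) _ hg); rewrite addr_ge0// mulr_ge0// sqrtr_ge0.
Qed.

End kernel_operators.

(** * Symmetry of the limit of the series *)

Section symmetric_limit.
Context d (X : measurableType d) (R : realType) (mu : probability X R).
Local Notation mu2 := ((mu \x mu)%E : probability _ R).
Variables (T : X -> X) (hT : exact_transformation mu T).
Let mpT : measure_preserving mu T. Proof. by case: hT. Qed.
Let mpTn n : measure_preserving mu (iter n T). Proof. exact: mp_iter. Qed.
Let mpS i j : measure_preserving mu2 (prod_map (iter i T) (iter j T)).
Proof. exact: mp_prod. Qed.

(** Exchanging the variables turns the term (i, j) into (j, i), and the summation is over a
    square. *)
Lemma green_swp n (f : X * X -> R) : L2 mu2 f -> symmetric_kernel mu f ->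
  (fun z => green mu T n f (swp z)) = green mu T n f %[ae mu2].
Proof.
move=> hf hsym.
have e i j : (fun z => Vstar mu T i j f (swp z)) = Vstar mu T j i f %[ae mu2].
  rewrite !VstarE; have e1 := adj_swp (mpTn j) (mpTn i) hf.
  have e2 := adj_ae (mpS j i) (L2_swp hf) hf (symmetric_swp hsym).
  by apply: filterS2 e1 e2 => z z1 z2 t; rewrite -z1// z2.
have : {ae mu2, forall z, forall i j : 'I_n, Vstar mu T i j f (swp z) = Vstar mu T j i f z}.
  apply: filter_forall => i; apply: filter_forall => j.
  by apply: filterS (e i j) => z; apply.
apply: filterS => z h _; rewrite /green exchange_big/=.
by apply: eq_bigr => i _; apply: eq_bigr => j _; exact: h.
Qed.

Lemma green_limit_sym (f g : X * X -> R) : L2 mu2 f -> symmetric_kernel mu f -> L2 mu2 g ->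
  nrm mu2 (fun z => green mu T n f z - g z) @[n --> \oo] --> (0 : R) ->
  symmetric_kernel mu g.
Proof.
move=> hf hsym hg cv; have hgs := L2_swp hg.
suff : (fun z => g (swp z)) = g %[ae mu2].
  by apply: filterS => z e; rewrite -e.
apply: ae_nrm0 => //; apply/eqP; rewrite eq_le nrm_ge0 andbT.
have cv2 : nrm mu2 (fun z => green mu T n f z - g z) *+ 2 @[n --> \oo] --> (0 : R).
  by rewrite -[X in _ --> X](mul0rn _ 2); exact: cvgMn.
rewrite -(cvg_lim _ cv2)//; apply: limr_ge; first by apply/cvg_ex; exists 0.
apply: nearW => n; have hG := green_L2 hT n hf; have hGs := L2_swp hG.
rewrite mulr2n; apply: (le_trans (nrmD3 hgs hg hGs)); apply: lerD.
  rewrite nrmBC; have := mp_nrm (mp_swp mu) (L2B hG hg).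
  by move=> <-.
rewrite (@nrm_ae _ _ _ _ _ (fun z => green mu T n f z - g z))//; [exact: L2B..|].
by apply: filterS (green_swp n hf hsym) => z z1 t; rewrite z1.
Qed.

End symmetric_limit.

(** * Eigenfunction expansions in the projective norm *)

Section eigenfunctions.
Context d (X : measurableType d) (R : realType) (mu : probability X R).
Local Notation mu2 := ((mu \x mu)%E : probability _ R).
Variables (N : option nat) (lambda : nat -> R).

Definition abs_sum k := \sum_(m < k | idx N m) `|lambda m|.

Definition expansion (phi : nat -> X -> R) k (z : X * X) :=
  \sum_(m < k | idx N m) lambda m * tens (phi m) (phi m) z.

Hypothesis sl : cvgn abs_sum.

Definition abs_tail k := lim (abs_sum @ \oo) - abs_sum k.

Lemma abs_tail_cvg0 : abs_tail k @[k --> \oo] --> (0 : R).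
Proof. by rewrite -[X in _ --> X](subrr (lim (abs_sum @ \oo))); apply: cvgB => //; exact: cvg_cst. Qed.

Lemma abs_sum_nd k l : (k <= l)%N -> abs_sum k <= abs_sum l.
Proof.
move=> kl; rewrite -subr_ge0 /abs_sum -!(big_mkord (idx N) (fun m => `|lambda m|)).
by rewrite (big_cat_nat _ kl)//= addrAC subrr add0r; apply: sumr_ge0.
Qed.

Lemma abs_sum_le k : abs_sum k <= lim (abs_sum @ \oo).
Proof. by apply: nondecreasing_cvgn_le => //; exact: abs_sum_nd. Qed.

Lemma abs_tail_ge0 k : 0 <= abs_tail k.
Proof. by rewrite subr_ge0 abs_sum_le. Qed.

Section expansion_cost.
Variables (phi : nat -> X -> R) (s : R).
Hypotheses (hphi : forall m, idx N m -> L2 mu (phi m))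
  (nphi : forall m, idx N m -> nrm mu (phi m) ^+ 2 <= s).

Lemma acost_expansionB k l : (k <= l)%N ->
  acost mu (fun z => expansion phi l z - expansion phi k z) (s * (abs_sum l - abs_sum k)).
Proof.
move=> kl.
have -> : (fun z => expansion phi l z - expansion phi k z) =
    (fun z => \sum_(k <= m < l | idx N m) lambda m * tens (phi m) (phi m) z).
  apply/funext => z; rewrite /expansion.
  rewrite -!(big_mkord (idx N) (fun m => lambda m * tens (phi m) (phi m) z)).
  by rewrite (big_cat_nat _ kl)//= addrAC subrr add0r.
have -> : s * (abs_sum l - abs_sum k) = \sum_(k <= m < l | idx N m) `|lambda m| * s.
  rewrite /abs_sum -!(big_mkord (idx N) (fun m => `|lambda m|)).
  by rewrite (big_cat_nat _ kl)//= addrAC subrr add0r mulr_sumr; apply: eq_bigr => m _; rewrite mulrC.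
apply: acost_sum => m Nm; apply: acostZ; apply: acost_le (acost_tens (hphi Nm) (hphi Nm)).
by rewrite -expr2; exact: nphi.
Qed.

Lemma expansion_L2 k : L2 mu2 (expansion phi k).
Proof. by apply: L2_sum => m Nm; apply: L2Z; apply: L2_tens; exact: hphi. Qed.

(** Convergence is given in L_2 only; the summability of [lambda] makes the partial sums Cauchy for
    the projective norm too, with the same limit. The bound [s] is left free because the lemma is
    applied to the ergodic sums of the eigenfunctions, with [s = n]. *)
Lemma piB_expansion_tail h k : 0 <= s -> L2 mu2 h ->
  nrm mu2 (fun z => h z - expansion phi l z) @[l --> \oo] --> (0 : R) ->
  piB mu (fun z => h z - expansion phi k z) (s * abs_tail k).
Proof.
move=> s0 hh cv; have hk := expansion_L2 k.
split; first exact: L2B.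
exists (fun l z => expansion phi (l + k)%N z - expansion phi k z); split.
- move=> l; apply: acost_le (acost_expansionB (leq_addl _ _)).
  by apply: ler_wpM2l => //; rewrite lerD2r abs_sum_le.
- move=> e e0; have e1 : 0 < e / (s + 1) by rewrite divr_gt0// ltr_wpDl.
  have e2 : s * (e / (s + 1)) <= e.
    rewrite mulrA ler_pdivrMr ?ltr_wpDl// mulrC.
    by apply: ler_wpM2l; rewrite ?lerDl// ltW.
  have := abs_tail_cvg0 => /cvgrPdist_le /(_ _ e1)[M _ hM].
  have key p q : (M <= q)%N -> (q <= p)%N -> acost mu (fun z =>
      expansion phi (p + k) z - expansion phi k z - (expansion phi (q + k) z - expansion phi k z)) e.
    move=> Mq qp; rewrite (_ : (fun z => _) = (fun z => expansion phi (p + k)%N z - expansion phi (q + k)%N z)).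
      apply: acost_le (acost_expansionB _); last by rewrite leq_add2r.
      apply: le_trans e2; apply: ler_wpM2l => //.
      have := hM (q + k)%N (leq_trans Mq (leq_addr _ _)).
      rewrite /= sub0r normrN ger0_norm ?abs_tail_ge0//; apply: le_trans.
      by rewrite lerD2r abs_sum_le.
    by apply/funext => z; ring.
  exists M => p q Mp Mq; case: (leqP q p) => [qp|/ltnW pq]; first exact: key.
  have := acostZ (-1) (key _ _ Mp pq); rewrite normrN1 mul1r.
  rewrite (_ : (fun z => -1 * _) = (fun z =>
      expansion phi (p + k) z - expansion phi k z - (expansion phi (q + k) z - expansion phi k z)))//.
  by apply/funext => z; ring.
- have := cv; rewrite -(cvg_shiftn k (fun l => nrm mu2 (fun z => h z - expansion phi l z))).
  rewrite (_ : (fun l => nrm _ _) = (fun l => nrm mu2 (fun z =>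
    expansion phi (l + k) z - expansion phi k z - (h z - expansion phi k z))))//.
  apply/funext => l; rewrite nrmBC; congr nrm; apply/funext => z; ring.
Qed.

End expansion_cost.

Section martingale_eigenfunctions.
Variables (T : X -> X) (hT : exact_transformation mu T) (h : X * X -> R) (phi : nat -> X -> R).
Hypotheses (hh : L2 mu2 h) (hphi : forall m, idx N m -> L2 mu (phi m))
  (ophi : forall m k, idx N m -> idx N k -> ip mu (phi m) (phi k) = (m == k)%:R)
  (lam0 : forall m, idx N m -> lambda m != 0)
  (cv : nrm mu2 (fun z => h z - expansion phi l z) @[l --> \oo] --> (0 : R)).

(** Exact by orthonormality for every partial sum of more than m terms, hence for the L_2 limit. *)
Lemma ip_eigen a m : idx N m -> L2 mu a ->
  ip mu2 (tens a (phi m)) h = lambda m * ip mu a (phi m).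
Proof.
move=> Nm ha; have hm := hphi Nm; have ht := L2_tens ha hm.
have E k : (m < k)%N -> ip mu2 (tens a (phi m)) (expansion phi k) = lambda m * ip mu a (phi m).
  move=> mk; rewrite ip_sumr//; last first.
    by move=> j Nj; apply: L2Z; apply: L2_tens; exact: hphi.
  rewrite (bigD1 (Ordinal mk))//= big1 ?addr0; last first.
    move=> j /andP[Nj jm]; have hj := hphi Nj; rewrite ipZr ?ip_tens//; last exact: L2_tens.
    by rewrite ophi// (_ : (m == j) = false) ?mulr0 ?mulr0//; apply/negbTE; rewrite eq_sym.
  by rewrite ipZr ?ip_tens//; [rewrite ophi// eqxx mulr1|exact: L2_tens].
apply/eqP; rewrite -subr_eq0 -normr_eq0 eq_le normr_ge0 andbT.
have cv2 : nrm mu2 (tens a (phi m)) * nrm mu2 (fun z => h z - expansion phi l z) @[l --> \oo] --> (0 : R).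
  by rewrite -[X in _ --> X](mulr0 (nrm mu2 (tens a (phi m)))); apply: cvgM => //; exact: cvg_cst.
rewrite -(cvg_lim _ cv2)//; apply: limr_ge; first by apply/cvg_ex; exists 0.
exists m.+1 => // k /= mk; have hk := expansion_L2 hphi k.
by rewrite -(E k mk) -ipBr//; apply: cauchy_schwarz => //; exact: L2B.
Qed.

(** Pairing h with the tensor of [psi o T] and [phi m] gives 0 by assumption, and [lambda m] times
    the wanted inner product by [ip_eigen]; the nonzero eigenvalue is cancelled. *)
Lemma eigen_martingale m psi : idx N m -> L2 mu psi ->
  (forall phi, L2 mu2 phi -> ip mu2 (fun z => phi (prod_map T id z)) h = 0) ->
  ip mu (fun x => psi (T x)) (phi m) = 0.
Proof.
move=> Nm hpsi h0; have hm := hphi Nm; have [mpT _] := hT.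
have := ip_eigen Nm (mp_L2 mpT hpsi).
have -> : ip mu2 (tens (fun x => psi (T x)) (phi m)) h = 0 by exact: (h0 _ (L2_tens hpsi hm)).
by move/esym/eqP; rewrite mulf_eq0 (negbTE (lam0 Nm)) => /eqP.
Qed.

End martingale_eigenfunctions.

End eigenfunctions.

(** * Diagonal sums *)

Section diagonal_map.
Context d (X : measurableType d) (R : realType) (mu : probability X R).
Local Notation mu2 := ((mu \x mu)%E : probability _ R).
Variables (D2 : (X * X -> R) -> X -> R) (hD2 : is_D2 mu D2).
Implicit Types (f h : X * X -> R) (c : R).

Lemma D2_le h c : piB mu h c -> L1 mu (D2 h) /\ \int[mu]_x `|D2 h x| <= c.
Proof.
move=> hc; have hL := piB_L2pi hc.
have h1 : L1 mu (D2 h) by apply/Lfun1_integrable; exact: D2_L1.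
split => //; rewrite -lee_fin -EFin_E; last exact: L1_abs.
apply: le_trans (piB_pi_norm hc); apply: le_trans (D2_norm hD2 hL).
by rewrite Lnorm1.
Qed.

Lemma D2_sub f h c c' : piB mu f c -> piB mu h c' ->
  D2 (fun z => f z - h z) = (fun x => D2 f x - D2 h x) %[ae mu].
Proof.
move=> hf hh; have := D2_linear hD2 (-1) (piB_L2pi hh) (piB_L2pi hf).
rewrite (_ : (fun z => -1 * h z + f z) = (fun z => f z - h z)); last by apply/funext => z; ring.
by apply: filterS => x e t; rewrite e//; ring.
Qed.

Lemma D2_0 : D2 (fun=> 0) = (fun=> 0) %[ae mu].
Proof.
have h0 := acost_piB (acost_cst0 mu).
have := D2_sub h0 h0; rewrite (_ : (fun z => _) = (fun=> 0)); last by apply/funext => z; rewrite subr0.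
by apply: filterS => x e t; rewrite e// subrr.
Qed.

Lemma piB_sum I (s : seq I) (P : pred I) (F : I -> X * X -> R) :
  (forall i, P i -> exists c, piB mu (F i) c) ->
  exists c, piB mu (fun z => \sum_(i <- s | P i) F i z) c.
Proof.
move=> hF; elim: s => [|i s [c IH]].
  exists 0; rewrite (_ : (fun z => _) = fun=> 0); first exact: acost_piB (acost_cst0 mu).
  by apply/funext => z; rewrite big_nil.
case: (boolP (P i)) => Pi; last first.
  exists c; rewrite (_ : (fun z => _) = (fun z => \sum_(i <- s | P i) F i z))//.
  by apply/funext => z; rewrite big_cons (negbTE Pi).
have [c' hc'] := hF i Pi; exists (c' + c).
rewrite (_ : (fun z => _) = (fun z => F i z + \sum_(i <- s | P i) F i z)); first exact: piBD.
by apply/funext => z; rewrite big_cons Pi.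
Qed.

Lemma D2_sum I (s : seq I) (P : pred I) (a : I -> R) (F : I -> X * X -> R) :
  (forall i, P i -> exists c, piB mu (F i) c) ->
  D2 (fun z => \sum_(i <- s | P i) a i * F i z) =
  (fun x => \sum_(i <- s | P i) a i * D2 (F i) x) %[ae mu].
Proof.
move=> hF; elim: s => [|i s IH].
  rewrite (_ : (fun z => _) = fun=> 0); last by apply/funext => z; rewrite big_nil.
  by apply: filterS D2_0 => x e t; rewrite e// big_nil.
case: (boolP (P i)) => Pi; last first.
  rewrite (_ : (fun z => _) = (fun z => \sum_(i <- s | P i) a i * F i z)).
    by apply: filterS IH => x e t; rewrite e// big_cons (negbTE Pi).
  by apply/funext => z; rewrite big_cons (negbTE Pi).
have [c' hc'] := hF i Pi.
have [c hc] : exists c, piB mu (fun z => \sum_(i <- s | P i) a i * F i z) c.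
  apply: piB_sum => j Pj; have [e he] := hF j Pj.
  by exists (`|a j| * e); exact: piBZ.
rewrite (_ : (fun z => _) = (fun z => a i * F i z + \sum_(i <- s | P i) a i * F i z)).
  have := D2_linear hD2 (a i) (piB_L2pi hc') (piB_L2pi hc).
  by apply: filterS2 IH => x e1 e2 t; rewrite e2// e1// big_cons Pi.
by apply/funext => z; rewrite big_cons Pi.
Qed.

Section approximation.
Variables (T : X -> X) (hT : exact_transformation mu T).
Let mpT : measure_preserving mu T. Proof. by case: hT. Qed.
Let mpTn n : measure_preserving mu (iter n T). Proof. exact: mp_iter. Qed.
Let mpS i j : measure_preserving mu2 (prod_map (iter i T) (iter j T)).
Proof. exact: mp_prod. Qed.

Lemma piB_V f c i j : piB mu f c -> piB mu (V T i j f) c.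
Proof.
move=> hf; rewrite -[c]mul1r; apply: (op_piB (op_comp (mpS i j)) _ ler01 hf) => a b ha hb.
rewrite mul1r -(mp_nrm (mpTn i) ha) -(mp_nrm (mpTn j) hb).
by apply: acost_tens; exact: (mp_L2 (mpTn _)).
Qed.

Definition diag_avg f n x := n%:R^-1 * \sum_(i < n) \sum_(j < n) D2 (V T i j f) x.

Lemma diag_avg_L1 f c n : piB mu f c -> L1 mu (diag_avg f n).
Proof.
move=> hf; apply: L1Z; apply: L1_sum => i _; apply: L1_sum => j _.
by have [] := D2_le (piB_V i j hf).
Qed.

Lemma D2_orbit_sum f c n : piB mu f c ->
  D2 (orbit_sum T n f) = (fun x => \sum_(i < n) \sum_(j < n) D2 (V T i j f) x) %[ae mu].
Proof.
move=> hf.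
have h1 i : exists c, piB mu (fun z => \sum_(j < n) V T i j f z) c.
  by apply: piB_sum => j _; exists c; exact: piB_V.
have e1 := @D2_sum _ (index_enum 'I_n) xpredT (fun=> 1) (fun i z => \sum_(j < n) V T i j f z) (fun i _ => h1 i).
have e2 i := @D2_sum _ (index_enum 'I_n) xpredT (fun=> 1) (fun j => V T i j f)
  (fun j _ => ex_intro _ c (piB_V i j hf)).
have e3 : {ae mu, forall x, forall i : 'I_n,
    D2 (fun z => \sum_(j < n) 1 * V T i j f z) x = \sum_(j < n) 1 * D2 (V T i j f) x}.
  by apply: filter_forall => i; apply: filterS (e2 i) => x; apply.
have s1 i : (fun z => \sum_(j < n) 1 * V T i j f z) = (fun z => \sum_(j < n) V T i j f z).
  by apply/funext => z; apply: eq_bigr => j _; rewrite mul1r.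
move: e1; rewrite (_ : (fun z => _) = orbit_sum T n f); last first.
  by apply/funext => z; apply: eq_bigr => i _; rewrite mul1r.
apply: filterS2 e3 => x x3 x1 t; rewrite x1//; apply: eq_bigr => i _.
rewrite mul1r -s1 x3; apply: eq_bigr => j _; exact: mul1r.
Qed.

Lemma D2_expansion (N : option nat) (lambda : nat -> R) (phi : nat -> X -> R) k :
  (forall m, idx N m -> L2 mu (phi m)) ->
  D2 (expansion N lambda phi k) =
  (fun x => \sum_(m < k | idx N m) lambda m * phi m x ^+ 2) %[ae mu].
Proof.
move=> hphi.
have e1 := @D2_sum _ (index_enum 'I_k) (fun m => idx N m) (fun m => lambda m)
  (fun m => tens (phi m) (phi m)) (fun m Nm => ex_intro _ _ (acost_piB (acost_tens (hphi _ Nm) (hphi _ Nm)))).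
have e2 : {ae mu, forall x, forall m : 'I_k, idx N m -> D2 (tens (phi m) (phi m)) x = phi m x * phi m x}.
  apply: filter_forall => m; case: (boolP (idx N m)) => Nm; last exact: aeW.
  by apply: filterS (D2_tens hD2 (hphi _ Nm) (hphi _ Nm)) => x e _; exact: e.
apply: filterS2 e1 e2 => x x1 x2 t; rewrite [LHS]x1//.
by apply: eq_bigr => m Nm; rewrite x2// expr2.
Qed.

Variables (f g : X * X -> R) (cg cf : R).
Hypotheses (hg : piB mu g cg) (hf : piB mu f cf)
  (fg : f = subadj mu (prod_map T id) (subadj mu (prod_map id T) g) %[ae mu2]).
Variables (N : option nat) (lambda : nat -> R) (phi : nat -> X -> R).
Let h := subproj mu (prod_map T id) (subproj mu (prod_map id T) g).
Hypotheses (hphi : forall m, idx N m -> L2 mu (phi m))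
  (nphi : forall m, idx N m -> nrm mu (phi m) = 1)
  (mphi : forall m psi, idx N m -> L2 mu psi -> ip mu (fun x => psi (T x)) (phi m) = 0)
  (sl : cvgn (abs_sum N lambda))
  (cv : nrm mu2 (fun z => h z - expansion N lambda phi l z) @[l --> \oo] --> (0 : R)).

Let r n : R := Num.sqrt n%:R.

(** Both errors are projective norms passed through [D2_le]: [piB_remainder] for replacing f by [h],
    and the tail of the expansion summed over the orbit, of cost [n * abs_tail]. Division by n
    leaves O(1 / sqrt n) and a tail independent of n. *)
Lemma diag_avg_approx n k :
  L1 mu (fun x => \sum_(m < k | idx N m) lambda m * ((r n)^-1 * psum T (phi m) n x) ^+ 2) /\
  \int[mu]_x `|diag_avg f n x - \sum_(m < k | idx N m) lambda m * ((r n)^-1 * psum T (phi m) n x) ^+ 2|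
  <= n%:R^-1 * ((8 * r n + 4) * cg) + abs_tail N lambda k.
Proof.
have hps m : idx N m -> L2 mu (psum T (phi m) n) by move=> Nm; exact: (psum_L2 hT (hphi Nm)).
have nps m : idx N m -> nrm mu (psum T (phi m) n) ^+ 2 <= n%:R.
  move=> Nm; rewrite (nrm_psum hT (hphi Nm)) ?nphi ?expr1n ?mulr1//.
  by move=> psi hpsi; exact: mphi.
have mpS1 := mpS 1 0; have mpS2 := mpS 0 1.
have hg2 := piB_L2 hg; have hf2 := piB_L2 hf.
have U := op_orbit_sum hT n.
have hBg : L2 mu2 (subadj mu (prod_map T id) (subadj mu (prod_map id T) g)).
  by apply: (op_L2 (op_subadj mpS1)); exact: (op_L2 (op_subadj mpS2)).
have hh : L2 mu2 h by apply: (op_L2 (op_subproj mpS1)); exact: (op_L2 (op_subproj mpS2)).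
have hexp l := expansion_L2 lambda hphi l.
set psi := fun m => psum T (phi m) n.
have Uexp l : orbit_sum T n (expansion N lambda phi l) = expansion N lambda psi l.
  apply/funext => z; rewrite /orbit_sum /expansion /V.
  under eq_bigr do rewrite exchange_big/=; rewrite exchange_big/=.
  apply: eq_bigr => m Nm; rewrite -orbit_sum_tens /orbit_sum mulr_sumr.
  by apply: eq_bigr => i _; rewrite mulr_sumr.
have Usub q1 q2 z : orbit_sum T n (fun z => q1 z - q2 z) z = orbit_sum T n q1 z - orbit_sum T n q2 z.
  by rewrite /orbit_sum -sumrB; apply: eq_bigr => i _; rewrite -sumrB.
(* The operator bound n^2 is harmless: n is fixed and only l varies. *)
have cvU : nrm mu2 (fun z => orbit_sum T n h z - expansion N lambda psi l z) @[l --> \oo] --> (0 : R).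
  apply: (@squeeze_cvgr _ _ _ _ (fun=> 0) (fun l => n%:R * (n%:R * 1) * nrm mu2 (fun z => h z - expansion N lambda phi l z))).
  - apply: nearW => l; rewrite nrm_ge0/= -Uexp.
    have <- : orbit_sum T n (fun z => h z - expansion N lambda phi l z) =
        (fun z => orbit_sum T n h z - orbit_sum T n (expansion N lambda phi l) z).
      by apply/funext => z; rewrite Usub.
    by apply: (op_nrm U); exact: L2B.
  - exact: cvg_cst.
  - by rewrite -[X in _ --> X](mulr0 (n%:R * (n%:R * 1))); apply: cvgM => //; exact: cvg_cst.
have b1 := piB_expansion_tail sl hps nps k (ler0n R n) (op_L2 U hh) cvU.
have b2 := piB_remainder hT n hg.
have b3 := piBD b2 b1.
have hUf : L2 mu2 (orbit_sum T n f) by exact: (op_L2 U).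
have hes : L2 mu2 (expansion N lambda psi k) by exact: expansion_L2.
have b4 : piB mu (fun z => orbit_sum T n f z - expansion N lambda psi k z)
    ((8 * r n + 4) * cg + n%:R * abs_tail N lambda k).
  apply: piB_ae b3; first exact: L2B.
  by apply: filterS (op_ae U hf2 hBg fg) => z e t; rewrite e// /remainder subrKA.
have [cU hcU] : exists c, piB mu (orbit_sum T n f) c.
  by apply: piB_sum => i _; apply: piB_sum => j _; exists cf; exact: piB_V.
have [ce hce] : exists c, piB mu (expansion N lambda psi k) c.
  apply: piB_sum => m Nm; exists (`|lambda m| * (nrm mu (psi m) * nrm mu (psi m))).
  by apply/acost_piB/acostZ/acost_tens; exact: hps.
have [i1 i2] := D2_le b4.
have r2 : (r n)^-1 ^+ 2 = n%:R^-1 by rewrite exprVn /r sqr_sqrtr.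
have sE x : \sum_(m < k | idx N m) lambda m * ((r n)^-1 * psi m x) ^+ 2 =
    n%:R^-1 * \sum_(m < k | idx N m) lambda m * psi m x ^+ 2.
  by rewrite mulr_sumr; apply: eq_bigr => m _; rewrite exprMn r2 mulrCA.
have Ls : L1 mu (fun x => \sum_(m < k | idx N m) lambda m * ((r n)^-1 * psi m x) ^+ 2).
  apply: L1_sum => m Nm; apply: L1Z; apply: L2_sqr; apply: L2Z; exact: hps.
split; first exact: Ls.
rewrite (_ : \int[mu]_x _ = n%:R^-1 * \int[mu]_x
    `|D2 (fun z => orbit_sum T n f z - expansion N lambda psi k z) x|).
  apply: le_trans (ler_wpM2l _ i2) _; first by rewrite invr_ge0.
  (* At n = 0 the inverse is 0, and the tail is nonnegative. *)
  rewrite mulrDr lerD2l mulrA; have [->|n0] := eqVneq n 0%N.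
    by rewrite mulr0 mul0r abs_tail_ge0.
  by rewrite mulVf ?mul1r// pnatr_eq0.
rewrite -EZ; last exact: L1_abs.
apply: ae_E.
- by apply: (@L1_meas _ _ _ mu); apply: L1_abs; apply: L1B => //; exact: (diag_avg_L1 n hf).
- by apply: (@L1_meas _ _ _ mu); apply: L1Z; exact: L1_abs.
have e1 := D2_sub hcU hce; have e2 := D2_orbit_sum n hf; have e3 := D2_expansion lambda k hps.
apply: filterS3 e1 e2 e3 => x x1 x2 x3 t; rewrite x1// x2// x3//.
by rewrite -/psi sE /diag_avg -mulrBr normrM ger0_norm// invr_ge0.
Qed.

End approximation.
End diagonal_map.

(** * Convergence in law of quadratic forms *)

Section convergence_of_laws.
Context (R : realType).

Lemma E_dist d (X : measurableType d) (nu : probability X R) (f g b : X -> R) :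
  L1 nu f -> L1 nu g -> L1 nu b -> (forall x, `|f x - g x| <= b x) ->
  `|\int[nu]_x f x - \int[nu]_x g x| <= \int[nu]_x b x.
Proof.
move=> hf hg hb fgb; have hfg := L1B hf hg; rewrite -EB//.
apply: (le_trans (E_abs hfg)); apply: E_le => //; exact: L1_abs.
Qed.

Lemma L1_comp_bounded d (X : measurableType d) (nu : probability X R) (h : R -> R) (M : R) (f : X -> R) :
  continuous h -> (forall t, `|h t| <= M) -> measurable_fun setT f -> L1 nu (fun x => h (f x)).
Proof.
move=> ch hM mf; apply: (@L1_bounded _ _ _ nu (fun x => h (f x)) M) => //.
exact: (measurableT_comp (continuous_measurable_fun ch) mf).
Qed.

Lemma L1_quadratic d (X : measurableType d) (nu : probability X R) (w : nat -> X -> R) (a : nat -> R) k :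
  (forall m, L1 nu (fun x => w m x ^+ 2)) ->
  L1 nu (fun x => \sum_(m < k) a m * w m x ^+ 2).
Proof. by move=> hw; apply: L1_sum => m _; apply: L1Z. Qed.

(** The pointwise bound of [trigp_approx] is integrated; second moments at most 1 turn the sum of
    squares into k. *)
Lemma E_trigp_dist d (X : measurableType d) (nu : probability X R) (w : nat -> X -> R)
    (h : R -> R) (M : R) (a : nat -> R) k (F : (nat -> R) -> R) (e : R) :
  continuous h -> (forall t, `|h t| <= M) -> 0 <= e ->
  (forall m, measurable_fun setT (w m)) ->
  (forall m, L1 nu (fun x => w m x ^+ 2) /\ \int[nu]_x w m x ^+ 2 <= 1) ->
  trigp k F ->
  (forall v : nat -> R, `|h (\sum_(m < k) a m * v m ^+ 2) - F v| <= e * (1 + \sum_(m < k) v m ^+ 2)) ->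
  L1 nu (fun x => F (w^~ x)) /\
  `|\int[nu]_x h (\sum_(m < k) a m * w m x ^+ 2) - \int[nu]_x F (w^~ x)| <= e * (1 + k%:R).
Proof.
move=> ch hM e0 mw hw [s hF] hFe.
have mq : measurable_fun setT (fun x => \sum_(m < k) a m * w m x ^+ 2).
  by apply: (@L1_meas _ _ _ nu); apply: L1_quadratic => m; have [] := hw m.
have LF : L1 nu (fun x => F (w^~ x)).
  under eq_fun do rewrite hF; apply: L1_sum => p _; apply: L1Z.
  apply: (@L1_bounded _ _ _ nu _ 1) => [|x]; last by rewrite ler_norml cos_geN1 cos_le1.
  apply: (measurableT_comp (continuous_measurable_fun (@continuous_cos R))).
  by apply: measurable_sum => m; apply: measurable_funM.
split => //.
have Lb : L1 nu (fun x => 1 + \sum_(m < k) w m x ^+ 2).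
  by apply: L1D; [exact: L1_cst|apply: L1_sum => m _; have [] := hw m].
apply: (le_trans (E_dist (L1_comp_bounded _ ch hM mq) LF (L1Z e Lb) _)) => [x|]; first exact: hFe.
rewrite EZ// ler_wpM2l// ED; [|exact: L1_cst|by apply: L1_sum => m _; have [] := hw m].
rewrite E_cst lerD2l E_sum; last by move=> m _; have [] := hw m.
apply: (@le_trans _ _ (\sum_(m < k) 1)); last by rewrite sumr_const card_ord.
by apply: ler_sum => m _; have [] := hw m.
Qed.

Section quadratic_forms.
Context d (X : measurableType d) (mu : probability X R).
Context d' (Y : measurableType d') (P : probability Y R).
Variables (w : nat -> nat -> X -> R) (y : nat -> Y -> R) (a : nat -> R) (h : R -> R) (M : R).
Hypotheses (ch : continuous h) (hM : forall t, `|h t| <= M).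
Hypotheses (mw : forall n m, measurable_fun setT (w n m))
  (hw : forall n m, L1 mu (fun x => w n m x ^+ 2) /\ \int[mu]_x w n m x ^+ 2 <= 1)
  (my : forall m, measurable_fun setT (y m))
  (hy : forall m, L1 P (fun x => y m x ^+ 2) /\ \int[P]_x y m x ^+ 2 <= 1)
  (cos_cvg : forall (t : nat -> R) k,
    (\int[mu]_x cos (\sum_(m < k) t m * w n m x)) @[n --> \oo] -->
    \int[P]_x cos (\sum_(m < k) t m * y m x)).

Lemma quadratic_form_cvg k :
  (\int[mu]_x h (\sum_(m < k) a m * w n m x ^+ 2)) @[n --> \oo] -->
  \int[P]_x h (\sum_(m < k) a m * y m x ^+ 2).
Proof.
apply/cvgrPdist_le => e e0.
have k0 : 0 < 3 * (1 + k%:R) :> R by rewrite mulr_gt0// ltr_pwDl.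
have e2 : 0 < e / (3 * (1 + k%:R)) by rewrite divr_gt0.
have e3 : 0 < e / 3 by rewrite divr_gt0.
have eE : e / (3 * (1 + k%:R)) * (1 + k%:R) = e / 3.
  by field; rewrite -natr1 in k0 *; rewrite (_ : 1 + k%:R = k.+1%:R) ?pnatr_eq0// -natr1 addrC.
have [F tF hF] := trigp_approx k a ch hM e2.
have [LFy Fy] := E_trigp_dist ch hM (ltW e2) my hy tF hF.
have [s hs] := tF.
have Lcos d0 (Z : measurableType d0) (nu : probability Z R) (v : nat -> Z -> R) (t : nat -> R) :
    (forall m, measurable_fun setT (v m)) -> L1 nu (fun x => cos (\sum_(m < k) t m * v m x)).
  move=> mv; apply: (@L1_bounded _ _ _ nu _ 1) => [|x]; last by rewrite ler_norml cos_geN1 cos_le1.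
  apply: (measurableT_comp (continuous_measurable_fun (@continuous_cos R))).
  by apply: measurable_sum => m; apply: measurable_funM.
have EF d0 (Z : measurableType d0) (nu : probability Z R) (v : nat -> Z -> R) :
    (forall m, measurable_fun setT (v m)) ->
    \int[nu]_x F (v^~ x) = \sum_(p <- s) p.1 * \int[nu]_x cos (\sum_(m < k) p.2 m * v m x).
  move=> mv; under eq_Rintegral do rewrite hs.
  rewrite E_sum; last by move=> p _; apply: L1Z; exact: Lcos.
  by apply: eq_bigr => p _; rewrite EZ//; exact: Lcos.
have cF : (\int[mu]_x F ((w n)^~ x)) @[n --> \oo] --> \int[P]_x F (y^~ x).
  rewrite (EF _ _ P y my) (_ : (fun n => _) = (fun n => \sum_(p <- s) p.1 * \int[mu]_x cos (\sum_(m < k) p.2 m * w n m x))).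
    apply: (@cvg_sumr _ _ s xpredT (fun p n => p.1 * \int[mu]_x cos (\sum_(m < k) p.2 m * w n m x))
      (fun p => p.1 * \int[P]_x cos (\sum_(m < k) p.2 m * y m x))) => p _.
    by apply: cvgM; [exact: cvg_cst|exact: cos_cvg].
  by apply/funext => n; rewrite (EF _ _ mu (w n) (mw n)).
move/cvgrPdist_le : cF => /(_ _ e3); apply: filterS => n hn.
have [_ Fw] := E_trigp_dist ch hM (ltW e2) (mw n) (hw n) tF hF.
rewrite eE in Fy Fw; move: hn Fy Fw.
set A := \int[P]_x _; set B := \int[mu]_x _; set C := \int[P]_x _; set D := \int[mu]_x _ => hn Fy Fw.
rewrite (_ : C - D = (C - A) + (A - B) - (D - B)); last by ring.
apply: (le_trans (ler_normB _ _)); apply: (le_trans (lerD (ler_normD _ _) (lexx _))).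
by lra.
Qed.

Variables (S : nat -> X -> R) (xi : Y -> R) (eps tau : nat -> R) (L : R).
Hypotheses (hS : forall n, L1 mu (S n))
  (aL : forall k, \sum_(m < k) `|a m| <= L)
  (Sw : forall n k, \int[mu]_x `|S n x - \sum_(m < k) a m * w n m x ^+ 2| <= eps n + tau k)
  (eps0 : eps n @[n --> \oo] --> (0 : R)) (tau0 : tau k @[k --> \oo] --> (0 : R))
  (mxi : measurable_fun setT xi)
  (yxi : {ae P, forall x, (\sum_(m < k) a m * y m x ^+ 2) @[k --> \oo] --> xi x}).

(** The truncation k is fixed before n. One fifth of [e] pays for truncating the limit, one for
    [quadratic_form_cvg] at that k, and three for replacing [S n] by the truncated form: one from
    the modulus, one each from [eps] and [tau]. *)
Lemma law_cvg : (\int[mu]_x h (S n x)) @[n --> \oo] --> \int[P]_x h (xi x).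
Proof.
apply/cvgrPdist_le => e e0; have e5 : 0 < e / 5 by rewrite divr_gt0.
have L0 : 0 <= L by apply: le_trans (aL 0); rewrite big_ord0.
have L1p : 0 < 1 + L by rewrite ltr_pwDl.
(* This modulus tolerates an error proportional to [|x|], and the forms are bounded by L in L_1:
   hence the division by [1 + L]. *)
have [C C0 hC] := growth_modulus ch hM (divr_gt0 e5 L1p).
have C1 : 0 < C + 1 by rewrite ltr_wpDl.
have eC : 0 < e / 5 / (C + 1) by rewrite divr_gt0.
have Ce : C * (e / 5 / (C + 1)) <= e / 5.
  by rewrite mulrA ler_pdivrMr// mulrC; apply: ler_wpM2l; rewrite ?lerDl// ltW.
have mq k : measurable_fun setT (fun x => \sum_(m < k) a m * y m x ^+ 2).
  by apply: (@L1_meas _ _ _ P); apply: L1_quadratic => m; have [] := hy m.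
have cY : (\int[P]_x h (\sum_(m < k) a m * y m x ^+ 2)) @[k --> \oo] --> \int[P]_x h (xi x).
  apply: (@DCT _ _ _ P (fun k x => h (\sum_(m < k) a m * y m x ^+ 2)) (fun x => h (xi x)) (fun=> M)).
  - move=> k; exact: (measurableT_comp (continuous_measurable_fun ch) (mq k)).
  - exact: (measurableT_comp (continuous_measurable_fun ch) mxi).
  - exact: L1_cst.
  - by move=> k x; exact: hM.
  - apply: filterS yxi => x hx; by apply: cvg_comp; [exact: hx|exact: ch].
move/cvgrPdist_le : (cY) => /(_ _ e5)[k1 _ hk1].
move/cvgrPdist_le : (tau0) => /(_ _ eC)[k2 _ hk2].
pose k := maxn k1 k2.
have {}hk1 := hk1 k (leq_maxl _ _); have {}hk2 := hk2 k (leq_maxr _ _).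
rewrite /= in hk1 hk2.
move/cvgrPdist_le : (eps0) => /(_ _ eC)[n1 _ hn1].
have /cvgrPdist_le /(_ _ e5)[n2 _ hn2] := @quadratic_form_cvg k.
exists (maxn n1 n2) => // n /=; rewrite geq_max => /andP[nn1 nn2].
have {}hn1 := hn1 n nn1; have {}hn2 := hn2 n nn2; rewrite /= in hn1 hn2.
have Lq : L1 mu (fun x => \sum_(m < k) a m * w n m x ^+ 2).
  by apply: L1_quadratic => m; have [] := hw n m.
have Lb := L1D (L1D (L1_cst mu (e / 5 / (1 + L))) (L1Z (e / 5 / (1 + L)) (L1_abs Lq)))
  (L1Z C (L1_abs (L1B Lq (hS n)))).
have key := E_dist (L1_comp_bounded mu ch hM (L1_meas Lq)) (L1_comp_bounded mu ch hM (L1_meas (hS n))) Lb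
  (fun x => hC _ _).
have b1 : \int[mu]_x `|\sum_(m < k) a m * w n m x ^+ 2| <= L.
  apply: le_trans (aL k); apply: (@le_trans _ _ (\int[mu]_x \sum_(m < k) `|a m| * w n m x ^+ 2)).
    apply: E_le => [||x]; [exact: L1_abs|by apply: (L1_quadratic (fun m => `|a m|)) => m; have [] := hw n m|].
    apply: (le_trans (ler_norm_sum _ _ _)); apply: ler_sum => m _.
    by rewrite normrM [X in _ * X]ger0_norm// sqr_ge0.
  rewrite E_sum; last by move=> m _; apply: L1Z; have [] := hw n m.
  apply: ler_sum => m _; have [i1 i2] := hw n m; rewrite EZ//.
  by rewrite -[leRHS]mulr1 ler_wpM2l.
have b2 : \int[mu]_x `|\sum_(m < k) a m * w n m x ^+ 2 - S n x| <= e / 5 / (C + 1) *+ 2.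
  under eq_Rintegral do rewrite distrC.
  apply: (le_trans (Sw n k)); rewrite mulr2n lerD//.
    by apply: le_trans hn1; rewrite sub0r normrN ler_norm.
  by apply: le_trans hk2; rewrite sub0r normrN ler_norm.
have b3 : `|\int[mu]_x h (\sum_(m < k) a m * w n m x ^+ 2) - \int[mu]_x h (S n x)| <= e / 5 *+ 3.
  apply: (le_trans key).
  rewrite ED; [|by apply: L1D; [exact: L1_cst|apply: L1Z; exact: L1_abs]|by apply: L1Z; apply: L1_abs; exact: L1B].
  rewrite ED; [|exact: L1_cst|by apply: L1Z; exact: L1_abs].
  rewrite E_cst EZ; last exact: L1_abs.
  rewrite EZ; last by apply: L1_abs; exact: L1B.
  have q1 := ler_wpM2l (ltW (divr_gt0 e5 L1p)) b1; have q2 := ler_wpM2l C0 b2.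
  have q3 : e / 5 / (1 + L) + e / 5 / (1 + L) * L = e / 5.
    by rewrite -[X in X + _]mulr1 -mulrDr divfK// gt_eqF.
  apply: (le_trans (lerD (lerD (lexx _) q1) q2)); rewrite q3 mulrnAr.
  by move: Ce; set z := C * _ => Ce; lra.
move: hk1 hn2 b3.
set A := \int[P]_x _; set B := \int[P]_x _; set D := \int[mu]_x _; set E := \int[mu]_x _ => hk1 hn2 b3.
rewrite (_ : A - E = (A - B) + (B - D) + (D - E)); last by ring.
apply: (le_trans (ler_normD _ _)); apply: (le_trans (lerD (ler_normD _ _) (lexx _))).
by apply: (le_trans (lerD (lerD hk1 hn2) b3)); rewrite -mulr_natr; lra.
Qed.

End quadratic_forms.
End convergence_of_laws.

(** * Normalized ergodic sums of the eigenfunctions *)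

Section diagonal_averages.
Context d (X : measurableType d) (R : realType) (mu : probability X R).
Local Notation mu2 := ((mu \x mu)%E : probability _ R).

Lemma error_cvg0 (c : R) :
  n%:R^-1 * ((8 * Num.sqrt n%:R + 4) * c) @[n --> \oo] --> (0 : R).
Proof.
suff h : n.+1%:R^-1 * ((8 * Num.sqrt n.+1%:R + 4) * c) @[n --> \oo] --> (0 : R).
  by rewrite -(cvg_shiftS (fun n => n%:R^-1 * ((8 * Num.sqrt n%:R + 4) * c))).
rewrite (_ : (fun n => _) = (fun n => 8 * c * Num.sqrt (harmonic n) + 4 * c * harmonic n)).
  have cs : Num.sqrt (harmonic n) @[n --> \oo] --> (0 : R).
    by rewrite -[X in _ --> X]sqrtr0; apply: continuous_cvg; [exact: sqrt_continuous|exact: cvg_harmonic].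
  rewrite [X in _ --> X](_ : _ = 8 * c * 0 + 4 * c * 0); last by rewrite !mulr0 addr0.
  by apply: cvgD; apply: cvgM => //; [exact: cvg_cst|exact: cvg_cst|exact: cvg_harmonic].
apply/funext => n; rewrite /harmonic/= sqrtrV//.
have s0 : Num.sqrt n.+1%:R != 0 :> R by rewrite sqrtr_eq0 -ltNge.
have := @sqr_sqrtr R n.+1%:R (ler0n _ _); set s := Num.sqrt _ in s0 * => <-.
by field.
Qed.

Lemma partial_sum_cvg (N : option nat) (lambda : nat -> R) : cvgn (abs_sum N lambda) ->
  cvgn (fun n => \sum_(m < n | idx N m) lambda m).
Proof.
move=> sl; pose u m := if idx N m then lambda m else 0.
have -> : (fun n => \sum_(m < n | idx N m) lambda m) = series u.
  by apply/funext => n; rewrite seriesEord/= big_mkcond.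
apply: normed_cvg; rewrite (_ : [normed series u] = abs_sum N lambda)//.
apply/funext => n; rewrite /normed_series_of seriesEord/= /abs_sum [RHS]big_mkcond.
by apply: eq_bigr => m _; rewrite /u; case: ifP => _ //=; rewrite ?normr0.
Qed.

Variables (T : X -> X) (hT : exact_transformation mu T).
Let mpT : measure_preserving mu T. Proof. by case: hT. Qed.

Section orthonormal_martingales.
Variables (N : option nat) (phi : nat -> X -> R).
Hypotheses (hphi : forall m, idx N m -> L2 mu (phi m))
  (ophi : forall m k, idx N m -> idx N k -> ip mu (phi m) (phi k) = (m == k)%:R)
  (mphi : forall m psi, idx N m -> L2 mu psi -> ip mu (fun x => psi (T x)) (phi m) = 0).

(** Zero outside the index set, to match [eta']. *)
Definition scaled_psum n m x :=
  if idx N m then (Num.sqrt n%:R)^-1 * psum T (phi m) n x else 0.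

Lemma nrm_eigenfunction m : idx N m -> nrm mu (phi m) = 1.
Proof. by move=> Nm; rewrite /nrm ophi// eqxx sqrtr1. Qed.

Lemma scaled_psum_L2 n m : L2 mu (scaled_psum n m).
Proof.
rewrite /scaled_psum; case: (idx N m) (@hphi m) => [/(_ erefl) hm|_]; last exact: L2_cst.
by apply: L2Z; exact: (psum_L2 hT hm).
Qed.

Lemma scaled_psum_moment n m : (0 < n)%N ->
  \int[mu]_x scaled_psum n m x ^+ 2 = (idx N m)%:R.
Proof.
move=> n0; rewrite /scaled_psum; case: (boolP (idx N m)) => Nm; last first.
  by under eq_Rintegral do rewrite expr0n; rewrite E_cst.
have hp := psum_L2 hT (hphi Nm) n.
under eq_Rintegral do rewrite exprMn.
rewrite EZ; last exact: L2_sqr.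
rewrite exprVn sqr_sqrtr// (_ : \int[mu]_x _ = nrm mu (psum T (phi m) n) ^+ 2).
  rewrite (nrm_psum hT (hphi Nm)) => [|psi hpsi]; last exact: mphi.
  by rewrite nrm_eigenfunction// expr1n mulr1 mulVf// pnatr_eq0 -lt0n.
by rewrite nrmK; apply: eq_Rintegral => x _; rewrite expr2.
Qed.

Lemma scaled_psum_moment_le n m :
  L1 mu (fun x => scaled_psum n m x ^+ 2) /\ \int[mu]_x scaled_psum n m x ^+ 2 <= 1.
Proof.
split; first exact: L2_sqr (scaled_psum_L2 n m).
have [->|n0] := posnP n; last by rewrite scaled_psum_moment//; case: idx.
rewrite (_ : \int[mu]_x _ = 0) ?ler01// -[RHS](E_cst mu 0); apply: eq_Rintegral => x _.
by rewrite /scaled_psum /psum big_ord0 mulr0 if_same expr0n.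
Qed.

(** Cramer-Wold: a linear combination of eigenfunctions is again orthogonal to all [psi o T], so the
    univariate [clt_cos] applies to it, and orthonormality gives its variance. *)
Lemma scaled_psum_cos (t : nat -> R) k :
  (\int[mu]_x cos (\sum_(m < k) t m * scaled_psum n m x)) @[n --> \oo] -->
  expR (- \sum_(m < k | idx N m) t m ^+ 2 / 2).
Proof.
pose Z x := \sum_(m < k | idx N m) t m * phi m x.
have hZ : L2 mu Z by apply: L2_sum => m Nm; apply: L2Z; exact: hphi.
have hm m : idx N m -> L2 mu (fun x => t m * phi m x) by move=> Nm; apply: L2Z; exact: hphi.
have mZ psi : L2 mu psi -> ip mu (fun x => psi (T x)) Z = 0.
  move=> hpsi; have hpsiT := mp_L2 mpT hpsi; rewrite ip_sumr//; last by move=> m; exact: hm.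
  by apply: big1 => m Nm; rewrite ipZr ?mphi ?mulr0//; exact: hphi.
have nZ : nrm mu Z ^+ 2 = \sum_(m < k | idx N m) t m ^+ 2.
  rewrite nrmK ip_suml//; last by move=> m; exact: hm.
  apply: eq_bigr => m Nm; rewrite ip_sumr//; [|by move=> j; exact: hm|exact: hm].
  rewrite (bigD1 m)//= big1 ?addr0 => [|j /andP[Nj jm]].
    by rewrite ipZl ?ipZr ?ophi ?eqxx//; [rewrite mulr1 expr2|exact: hphi..|exact: hm].
  rewrite ipZl ?ipZr ?ophi//; [|exact: hphi..|exact: hm].
  by rewrite (_ : (m == j :> nat) = false) ?mulr0//; apply/negbTE; rewrite eq_sym.
have := clt_cos hT hZ mZ; rewrite nZ mulr_suml.
rewrite (_ : (fun n => _) = (fun n => \int[mu]_x cos (\sum_(m < k) t m * scaled_psum n m x)))//.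
apply/funext => n; apply: eq_Rintegral => x _; congr cos.
rewrite /psum /Z mulr_sumr; under eq_bigr do rewrite mulr_sumr.
rewrite exchange_big/= [RHS](bigID (fun m : 'I_k => idx N m))/= [X in _ = _ + X]big1 ?addr0; last first.
  by move=> m /negbTE Nm; rewrite /scaled_psum Nm mulr0.
apply: eq_bigr => m Nm; rewrite /scaled_psum Nm /psum !mulr_sumr.
by apply: eq_bigr => i _; rewrite mulrCA.
Qed.

End orthonormal_martingales.
End diagonal_averages.

(** * Limits of the expectations and of the laws *)

Section diagonal_averages_limit.
Context d (X : measurableType d) (R : realType) (mu : probability X R).
Local Notation mu2 := ((mu \x mu)%E : probability _ R).
Variables (T : X -> X) (hT : exact_transformation mu T).
Variables (D2 : (X * X -> R) -> X -> R) (hD2 : is_D2 mu D2).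
Variables (f g : X * X -> R) (cg cf : R).
Hypotheses (hg : piB mu g cg) (hf : piB mu f cf)
  (fg : f = subadj mu (prod_map T id) (subadj mu (prod_map id T) g) %[ae mu2]).
Variables (N : option nat) (lambda : nat -> R) (phi : nat -> X -> R).
Hypothesis hE : eigen_decomposition mu (g_empty mu T g) N lambda phi.
Let mpT : measure_preserving mu T. Proof. by case: hT. Qed.
Let mpS1 : measure_preserving mu2 (prod_map T id). Proof. exact: (mp_prod mpT (mp_id mu)). Qed.
Let mpS2 : measure_preserving mu2 (prod_map id T). Proof. exact: (mp_prod (mp_id mu) mpT). Qed.
Let hphi m : idx N m -> L2 mu (phi m). Proof. exact: (eigen_L2 hE). Qed.
Let ophi m k : idx N m -> idx N k -> ip mu (phi m) (phi k) = (m == k)%:R.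
Proof. exact: (eigen_orthonormal hE). Qed.
Let sl : cvgn (abs_sum N lambda). Proof. exact: (eigen_summable hE). Qed.
Let hg2 : L2 mu2 g. Proof. exact: piB_L2 hg. Qed.
Let hK2 : L2 mu2 (subproj mu (prod_map id T) g).
Proof. exact: (op_L2 (op_subproj mpS2)). Qed.
Let hK1 : L2 mu2 (subproj mu (prod_map T id) (subproj mu (prod_map id T) g)).
Proof. exact: (op_L2 (op_subproj mpS1)). Qed.

Let cvE : nrm mu2 (fun z => subproj mu (prod_map T id) (subproj mu (prod_map id T) g) z -
   expansion N lambda phi l z) @[l --> \oo] --> (0 : R).
Proof.
have := eigen_expansion hE; rewrite g_emptyE => h.
have hexp l := expansion_L2 lambda hphi l.
rewrite (_ : (fun l => _) = (fun l => nrm mu2 (fun z => expansion N lambda phi l z -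
    subproj mu (prod_map T id) (subproj mu (prod_map id T) g) z))); last first.
  by apply/funext => l; rewrite nrmBC.
apply/Lnorm_cvg0 => //.
set H := subproj _ _ _ in h *.
have e l : 'N[mu2]_2%:E[EFin \o (expansion N lambda phi l \- H)%R]%E =
    'N[mu2]_2%:E[EFin \o (H \- expansion N lambda phi l)%R]%E.
  rewrite !LnormE; [|exact: (L2B hK1 (hexp l))|exact: (L2B (hexp l) hK1)].
  by congr EFin; exact: nrmBC.
by rewrite (funext e); exact: h.
Qed.

Let mphi m psi : idx N m -> L2 mu psi -> ip mu (fun x => psi (T x)) (phi m) = 0.
Proof.
move=> Nm hpsi; apply: (eigen_martingale hT hK1 hphi ophi (eigen_neq0 hE) cvE Nm hpsi) => q hq.
exact: (ip_subproj mpS1).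
Qed.

Let nphi m : idx N m -> nrm mu (phi m) = 1.
Proof. exact: nrm_eigenfunction. Qed.

Let approx n k := diag_avg_approx hD2 hT hg hf fg hphi nphi mphi sl cvE n k.

(** For n > 0 the truncated form has mean exactly the partial sum of [lambda], so [approx] bounds
    the distance to the mean of [diag_avg]. With n fixed, letting k tend to infinity removes the
    tail. *)
Lemma expectation_diag_avg :
  (\int[mu]_x diag_avg D2 T f n x) @[n --> \oo] -->
  lim ((fun n => \sum_(m < n | idx N m) lambda m) @ \oo).
Proof.
have cl := partial_sum_cvg sl; set l := lim _.
apply/cvgrPdist_le => e e0.
move/cvgrPdist_le : (error_cvg0 cg) => /(_ _ e0)[n0 _ hn0].
exists n0.+1 => // n /= nn; have := hn0 n (ltnW nn).
rewrite /= sub0r normrN => hn; apply: le_trans hn; apply: le_trans (ler_norm _).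
have Ln := diag_avg_L1 hD2 hT n hf.
have n1 : (0 < n)%N by exact: leq_ltn_trans nn.
have cv1 : `|\sum_(m < k | idx N m) lambda m - \int[mu]_x diag_avg D2 T f n x| @[k --> \oo] -->
    `|l - \int[mu]_x diag_avg D2 T f n x|.
  by apply: cvg_norm; apply: cvgB; [exact: cl|exact: cvg_cst].
have cv2 : n%:R^-1 * ((8 * Num.sqrt n%:R + 4) * cg) + abs_tail N lambda k @[k --> \oo] -->
    n%:R^-1 * ((8 * Num.sqrt n%:R + 4) * cg).
  rewrite [X in _ --> X](_ : _ = n%:R^-1 * ((8 * Num.sqrt n%:R + 4) * cg) + 0); last by rewrite addr0.
  by apply: cvgD; [exact: cvg_cst|exact: abs_tail_cvg0].
rewrite -(cvg_lim _ cv1)// -(cvg_lim _ cv2)//; apply: ler_lim.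
- by apply/cvg_ex; eexists; exact: cv1.
- by apply/cvg_ex; eexists; exact: cv2.
apply: nearW => k; have [i1 i2] := approx n k; apply: le_trans i2; rewrite distrC.
rewrite (_ : \sum_(m < k | idx N m) lambda m = \int[mu]_x (\sum_(m < k | idx N m)
    lambda m * ((Num.sqrt n%:R)^-1 * psum T (phi m) n x) ^+ 2)).
  by rewrite -EB//; apply: E_abs; exact: L1B.
have hs m : idx N m -> L1 mu (fun x => ((Num.sqrt n%:R)^-1 * psum T (phi m) n x) ^+ 2).
  by move=> Nm; apply: L2_sqr; apply: L2Z; exact: (psum_L2 hT (hphi Nm)).
rewrite E_sum => [|m Nm]; last by apply: L1Z; exact: hs.
apply: eq_bigr => m Nm; rewrite EZ; last exact: hs.
have := scaled_psum_moment hT hphi ophi mphi m n1; rewrite /scaled_psum Nm => ->.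
by rewrite mulr1.
Qed.

Lemma law_diag_avg d' (Y : measurableType d') (P : probability Y R)
    (eta : nat -> {RV P >-> R}) (xi : Y -> R) (h : R -> R) (M : R) :
  independent_family (idx N) eta ->
  (forall m, idx N m -> forall B : set R, measurable B ->
     distribution P (eta m) B = normal_prob 0 1 B) ->
  measurable_fun setT xi ->
  {ae P, forall y, (\sum_(m < n | idx N m) lambda m * eta m y ^+ 2) @[n --> \oo] --> xi y} ->
  continuous h -> (forall t, `|h t| <= M) ->
  (\int[mu]_x h (diag_avg D2 T f n x)) @[n --> \oo] --> \int[P]_y h (xi y).
Proof.
move=> ind law mxi cxi ch hM.
(* Extending [lambda] by zero turns sums over the index set into the full sums of [law_cvg]. *)
pose a m := if idx N m then lambda m else 0.
have aE k (w : nat -> R) : \sum_(m < k) a m * w m = \sum_(m < k | idx N m) lambda m * w m.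
  by rewrite [RHS]big_mkcond; apply: eq_bigr => m _; rewrite /a; case: ifP; rewrite ?mul0r.
have mL := scaled_psum_L2 hT hphi.
apply: (@law_cvg R _ X mu _ Y P (scaled_psum T N phi) (eta' N eta) a h M ch hM _ _ _ _ _ (diag_avg D2 T f) xi
  (fun n => n%:R^-1 * ((8 * Num.sqrt n%:R + 4) * cg)) (abs_tail N lambda) (lim (abs_sum N lambda @ \oo))) => //.
- by move=> n m; exact: L2_meas (mL n m).
- by move=> n m; exact: (scaled_psum_moment_le hT hphi ophi mphi).
- by move=> m; exact: meta'.
- by move=> m; exact: gaussian_moment.
- by move=> t k; rewrite gaussian_cos//; exact: (scaled_psum_cos hT hphi ophi mphi).
- by move=> n; exact: (diag_avg_L1 hD2 hT n hf).
- move=> k; apply: le_trans (abs_sum_le sl k); rewrite /abs_sum [leRHS]big_mkcond.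
  by apply: ler_sum => m _; rewrite /a; case: ifP; rewrite ?normr0.
- move=> n k; have [_] := approx n k; apply: le_trans; rewrite le_eqVlt; apply/orP; left; apply/eqP.
  apply: eq_Rintegral => x _; congr (`|_ - _|); rewrite (aE k (fun m => scaled_psum T N phi n m x ^+ 2)); apply: eq_bigr => m Nm.
  by rewrite /scaled_psum Nm.
- exact: error_cvg0.
- exact: abs_tail_cvg0.
- apply: filterS cxi => y; rewrite (_ : (fun n => _) = (fun k => \sum_(m < k) a m * eta' N eta m y ^+ 2))//.
  apply/funext => k; rewrite (aE k (fun m => eta' N eta m y ^+ 2)); apply: eq_bigr => m Nm; by rewrite /eta' Nm.
Qed.

End diagonal_averages_limit.

Theorem theorem4 (R : realType) (d : measure_display) (X : measurableType d)
    (mu : probability X R) (hX : standard_space mu)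
    (T : X -> X) (hT : exact_transformation mu T)
    (D2 : (X * X -> R) -> X -> R) (hD2 : is_D2 mu D2)
    (f : X * X -> R) (hf : L2pi_sym mu f) (hfc : canonical_kernel mu f)
    (g : X * X -> R) (hg : L2pi mu g)
    (hfg : pi_norm mu (fun z =>
        (\sum_(i1 < n.1) \sum_(i2 < n.2) Vstar mu T i1 i2 f z) - g z)
      @[n --> (\oo, \oo)] --> 0%E) :
  let S := fun (n : nat) (x : X) =>
    n%:R^-1 * \sum_(i1 < n) \sum_(i2 < n) D2 (V T i1 i2 f) x in
  L2pi_sym mu (g_empty mu T g) /\
  forall (N : option nat) (lambda : nat -> R) (phi : nat -> X -> R),
    eigen_decomposition mu (g_empty mu T g) N lambda phi ->
    (forall (d' : measure_display) (Y : measurableType d')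
        (P : probability Y R) (eta : nat -> {RV P >-> R}) (xi : {RV P >-> R}),
      independent_family (idx N) eta ->
      (forall m, idx N m -> forall B : set R, measurable B ->
         distribution P (eta m) B = normal_prob 0 1 B) ->
      {ae P, forall y,
         (\sum_(m < n | idx N m) lambda m * eta m y ^+ 2)
           @[n --> \oo] --> xi y} ->
      cvg_in_distribution mu P S xi) /\
    ('E_mu[S n])%E @[n --> \oo] -->
      (limn (fun n => \sum_(m < n | idx N m) lambda m))%:E.
Proof.
move=> S; have [hf1 hfs] := hf; have [f0 _] := hfc.
have hf2 : L2 (mu \x mu)%E f by case: hf1.
have hg2 : L2 (mu \x mu)%E g by case: hg.
have fg := kernel_green hT hf1 hfs f0 hg hfg.
(* [g] inherits symmetry from [f] through the square partial sums; the symmetry of [g_empty] rests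
   on it. *)
have gs := green_limit_sym hT hf2 hfs hg2 (green_cvg hT hf1 hg hfg).
split; first exact: g_empty_L2pi_sym.
move=> N lambda phi hE; have [cg hcg] := L2pi_piB hg; have [cf hcf] := L2pi_piB hf1.
have LS n : L1 mu (S n) := diag_avg_L1 hD2 hT n hcf.
split=> [d' Y P eta xi ind law cxi|]; last first.
  rewrite (_ : (fun n => 'E_mu[S n])%E = (fun n => (\int[mu]_x S n x)%:E)); last first.
    by apply/funext => n; rewrite unlock EFin_E.
  by apply: cvg_EFin; [exact: nearW|exact: (expectation_diag_avg hT hD2 hcg hcf fg hE)].
split=> [n|h ch [M hM]]; first exact: L1_meas (LS n).
have mxi : measurable_fun setT xi by exact: measurable_funP.
rewrite (EFin_E (L1_comp_bounded P ch hM mxi)).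
rewrite (_ : (fun n => _) = (fun n => (\int[mu]_x h (S n x))%:E)); last first.
  by apply/funext => n; rewrite EFin_E//; exact: (L1_comp_bounded mu ch hM (L1_meas (LS n))).
apply: cvg_EFin; first exact: nearW.
exact: (law_diag_avg hT hD2 hcg hcf fg hE ind law mxi cxi ch hM).
Qed.
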